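(* Let $T\sim\{X_n\}_{n=1}^\infty$ be a random weighted shift on $\mathcal H$ with $R=\max\operatorname{essran}X_1=1$. (i) Almost surely, $\mathscr A_T$, the Banach algebra generated by $T$, is isometrically isomorphic to the disk algebra $\mathcal A(\mathbb D)$. (ii) Almost surely $\mathscr O_T=\mathscr W_T$, where $\mathscr O_T$ is the dual algebra generated by $T$ and $\mathscr W_T$ is the weakly closed algebra generated by $T$. (iii) Moreover, if $\mathbb P(X_1=0)=0$, then almost surely $\mathscr O_T=\mathscr W_T=\{T\}'=\{T\}''$ and this algebra is isometrically isomorphic to $H^\infty(\mathbb D)$. In particular, the multiplier algebra of $H^2_\mu$ is almost surely isometrically isomorphic to $H^\infty(\mathbb D)$.
   Context: $\mathcal H$ is a complex separable infinite-dimensional Hilbert space with orthonormal basis $\{e_n\}_{n=1}^\infty$. $\{X_n\}_{n=1}^\infty$ are nonnegative, bounded, i.i.d. random variables on a probability space $(\Omega,\mathcal F,\mathbb P)$. Writing $T\sim\{X_n\}$ means that $T=T(\omega)$ is the random unilateral weighted shift $T(\omega)e_n=X_n(\omega)e_{n+1}$, $n\ge1$. $\operatorname{essran}X_1$ is the essential range of $X_1$ (closed support of its law). For $A\in\mathcal B(\mathcal H)$: $\mathscr A_A$, $\mathscr W_A$, $\mathscr O_A$ are the closures of the set of polynomials in $A$ in, respectively, the norm topology, the weak operator topology, and the weak* topology of $\mathcal B(\mathcal H)$ as the dual of the trace class; $\{A\}'$ and $\{A\}''$ are the commutant and double commutant of $A$. $\mathbb D$ is the open unit disk; $\mathcal A(\mathbb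 D)$ is the disk algebra and $H^\infty(\mathbb D)$ the algebra of bounded analytic functions on $\mathbb D$, both with sup norm. The random Hardy space is $H^2_\mu(\omega)=\{f(z)=\sum_{n\ge0}a_nz^n:\ \|f\|^2(\omega)=\sum_{n\ge0}|a_n|^2w_n(\omega)^2<\infty\}$, where $w_0=1$, $w_n=X_1\cdots X_n$ for $n\ge1$, and $\mu$ is the law of $X_1$; $T(\omega)$ is unitarily equivalent to multiplication by $z$ on $H^2_\mu(\omega)$. The multiplier algebra of $H^2_\mu(\omega)$ consists of the power series $\varphi$ with $\varphi H^2_\mu(\omega)\subset H^2_\mu(\omega)$, with the operator norm of multiplication by $\varphi$. *)

(* Defs.v *)
From HB Require Import structures.
From mathcomp Require Import all_boot all_order all_algebra.
From mathcomp Require Import complex.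
From mathcomp Require Import all_classical all_reals all_analysis.

Set Implicit Arguments.
Unset Strict Implicit.
Unset Printing Implicit Defensive.

Import Order.TTheory GRing.Theory Num.Theory.
Import numFieldNormedType.Exports.

Local Open Scope classical_set_scope.
Local Open Scope ring_scope.
Local Open Scope complex_scope.

(* Norms of normed spaces over R[i] take their values in R[i]; this is the same
   norm, as an element of R. *)
Definition normR (R : realType) (V : normedZmodType R[i]) (x : V) : R :=
  complex.Re `|x|.

Section isometric_isomorphism.
Context {R : realType} {U V : lmodType R[i]}.

(* A and B are subalgebras of U and V for the products mulU and mulV. *)
Definition isometrically_isomorphic
    (mulU : U -> U -> U) (normU : U -> R) (A : set U)
    (mulV : V -> V -> V) (normV : V -> R) (B : set V) : Prop :=
  exists phi : U -> V,
    [/\ set_bij A B phi,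
        forall (c : R[i]) x y, A x -> A y ->
          phi (c *: x + y) = c *: phi x + phi y,
        forall x y, A x -> A y -> phi (mulU x y) = mulV (phi x) (phi y) &
        forall x, A x -> normV (phi x) = normU x].

End isometric_isomorphism.

Section operators.
Context {R : realType} {H : completeNormedModType R[i]}.
Implicit Types (A B K : H -> H) (S : set (H -> H)).

Definition bounded_operator A : Prop :=
  linear A /\ exists M : R, forall x, normR (A x) <= M * normR x.

Definition operator_norm A : R :=
  sup [set normR (A x) | x in [set x : H | normR x <= 1]].

Definition comp_op A B : H -> H := A \o B.

(* Constant terms are allowed, p`_0 being the coefficient of the identity. *)
Definition poly_op A (p : {poly R[i]}) : H -> H :=
  fun x => \sum_(k < size p) p`_k *: iter k A x.

Definition polynomials_in A : set (H -> H) := range (poly_op A).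

Definition commutant S : set (H -> H) :=
  [set A | bounded_operator A /\ forall B, S B -> A \o B = B \o A].

Definition norm_closure S : set (H -> H) :=
  [set A | bounded_operator A /\
    forall eps : R, 0 < eps -> exists2 B, S B & operator_norm (A - B) < eps].

Section inner_product.
Variable ip : {dot H for Num.conj}.

Definition orthonormal_basis (e : nat -> H) : Prop :=
  (forall m n, ip (e m) (e n) = (m == n)%:R) /\
  (forall x : H, series (fun n => ip x (e n) *: e n) @ \oo --> x).

(* The closures below are spelled out with the basic neighbourhoods of the
   topologies, each given by finitely many of the defining functionals. *)
Definition wot_closure S : set (H -> H) :=
  [set A | bounded_operator A /\
    forall (m : nat) (x y : 'I_m -> H) (eps : R), 0 < eps ->
      exists2 B, S B &
        forall i, normR (ip (A (x i) - B (x i)) (y i)) < eps].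

Definition adjoint_of A B : Prop :=
  bounded_operator B /\ forall x y, ip (A x) y = ip x (B y).

Definition positive_operator A : Prop :=
  bounded_operator A /\ forall x, 0 <= ip (A x) x.

(* P = |K|, the positive square root of K^* K *)
Definition absolute_value_of K P : Prop :=
  positive_operator P /\ exists2 L, adjoint_of K L & P \o P = L \o K.

Variable e : nat -> H.

(* For e an orthonormal basis, trace-class membership and the trace do not
   depend on e. *)
Definition trace_class K : Prop :=
  bounded_operator K /\
  exists2 P, absolute_value_of K P &
    cvgn (series (fun n => ip (P (e n)) (e n) : R[i]^o)).

Definition trace K : R[i]^o := limn (series (fun n => ip (K (e n)) (e n) : R[i]^o)).

(* The weak-star topology is that of the functionals A |-> trace (A K),
   for K of trace class. *)
Definition weak_star_closure S : set (H -> H) :=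
  [set A | bounded_operator A /\
    forall (m : nat) (K : 'I_m -> H -> H) (eps : R), 0 < eps ->
      (forall i, trace_class (K i)) ->
      exists2 B, S B & forall i, normR (trace ((A - B) \o K i)) < eps].

Definition weighted_shift (w : nat -> R) A : Prop :=
  bounded_operator A /\ forall n, A (e n) = (w n)%:C *: e n.+1.

End inner_product.
End operators.

Section disk.
Context {R : realType}.
Implicit Types (E : set R[i]^o) (f g : R[i]^o -> R[i]^o).

Definition open_disk : set R[i]^o := [set z | normR z < 1].
Definition closed_disk : set R[i]^o := [set z | normR z <= 1].

Definition analytic_at f (a : R[i]^o) : Prop :=
  exists (c : nat -> R[i]) (r : R), 0 < r /\
    forall z, normR (z - a) < r ->
      series (fun n => c n * (z - a) ^+ n : R[i]^o) @ \oo --> f z.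

Definition vanishes_off E f : Prop := forall z, ~ E z -> f z = 0.

Definition sup_norm E f : R := sup [set normR (f z) | z in E].

Definition pointwise_mul f g : R[i]^o -> R[i]^o := fun z => f z * g z.

(* A function on a subset E of the plane is represented by its extension by 0,
   so that equality is equality on E. *)
Definition disk_algebra : set (R[i]^o -> R[i]^o) :=
  [set f | [/\ vanishes_off closed_disk f,
               {within closed_disk, continuous f} &
               forall a, open_disk a -> analytic_at f a]].

Definition Hardy_infinity : set (R[i]^o -> R[i]^o) :=
  [set f | [/\ vanishes_off open_disk f,
               exists M : R, forall z, open_disk z -> normR (f z) <= M &
               forall a, open_disk a -> analytic_at f a]].

End disk.

Section weighted_Hardy_space.
Context {R : realType}.
Implicit Types (X : nat -> R) (a b : nat -> R[i]^o).

(* Formal power series are given by their coefficients.  The weight sequence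
   X_1, X_2, ... is indexed from 0. *)
Definition weight X (n : nat) : R := \prod_(i < n) X i.

Definition square_terms X a (n : nat) : R := normR (a n) ^+ 2 * weight X n ^+ 2.

Definition Hardy_space X : set (nat -> R[i]^o) :=
  [set a | cvgn (series (square_terms X a))].

Definition Hardy_norm X a : R := Num.sqrt (limn (series (square_terms X a))).

Definition mul_series b a : nat -> R[i]^o :=
  fun n => \sum_(k < n.+1) b k * a (n - k)%N.

Definition multiplier_algebra X : set (nat -> R[i]^o) :=
  [set b | forall a, Hardy_space X a -> Hardy_space X (mul_series b a)].

Definition multiplier_norm X b : R :=
  sup [set Hardy_norm X (mul_series b a)
      | a in [set a | Hardy_space X a /\ Hardy_norm X a <= 1]].

End weighted_Hardy_space.

Section probability.
Context {R : realType} {d : measure_display} {Omega : measurableType d}.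
Context {P : probability Omega R}.

Definition mutually_independent (X : nat -> {RV P >-> R}) : Prop :=
  forall (J : seq nat) (B : nat -> set R), uniq J ->
    (forall j, measurable (B j)) ->
    P (\bigcap_(j in [set` J]) (X j @^-1` B j)) =
    (\prod_(j <- J) P (X j @^-1` B j))%E.

Definition identically_distributed (X : nat -> {RV P >-> R}) : Prop :=
  forall n (B : set R), measurable B ->
    distribution P (X n) B = distribution P (X 0%N) B.

(* the closed support of the law *)
Definition essran (Y : {RV P >-> R}) : set R :=
  [set x | forall eps : R, 0 < eps -> (0 < distribution P Y (ball x eps))%E].

Definition is_max (A : set R) (m : R) : Prop := A m /\ ubound A m.

(* T ~ {X_n}; since a bounded operator is determined by its values on a basis,
   this determines T almost surely. *)
Definition random_weighted_shift (H : completeNormedModType R[i])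
    (e : nat -> H) (X : nat -> {RV P >-> R}) (T : Omega -> H -> H) : Prop :=
  {ae P, forall omega, weighted_shift e (fun n => X n omega) (T omega)}.

End probability.

(* Main.v *)
Require Import Defs.
From HB Require Import structures.
From mathcomp Require Import all_boot all_order all_algebra.
From mathcomp Require Import complex.
From mathcomp Require Import all_classical all_reals all_analysis.
From mathcomp Require Import separable ring lra zify.

Set Implicit Arguments.
Unset Strict Implicit.
Unset Printing Implicit Defensive.

Import Order.TTheory GRing.Theory Num.Theory.
Import numFieldNormedType.Exports.

Local Open Scope classical_set_scope.
Local Open Scope ring_scope.

(** Let [w] be a realization of the weights and [T] the shift that it defines.
    Almost surely all weights are at most 1, since the law has support in
    [[0, 1]] ([ae_le_max_essran]), and for every [N] and [eps] there are [N]
    consecutive weights above [1 - eps], since disjoint blocks of indices are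
    independent and each is of this kind with the same positive probability
    ([ae_near_one_windows]).  The rest of the proof concerns one such [w].

    The operators in question are the formal power series [b(T) = sum_k b_k T^k]
    ([symbol]), and the point is that such an operator is bounded exactly when
    [b] is the Taylor series of a bounded analytic function [f] on the disk, and
    then [|b(T)|] is the supremum norm of [f].
    - Upper bound.  The form [<b(T) x, y>] is affine in each weight, so it
      suffices to bound it for weights 1 and -1; these are removed by a diagonal
      unitary, and for the unweighted shift the form is an average over roots of
      unity ([Toeplitz_le], [symbol_exists]).
    - Lower bound.  On windows of weights close to 1 the operator [b(T)] is close
      to the Toeplitz operator of [b], so it dominates the latter, and testing
      this on reproducing kernels bounds [f] ([window_Toeplitz_le],
      [symbol_sup_le]).

    Closures are then computed through matrix entries.  Whatever is in the norm,
    weak or weak-star closure of the polynomials in [T] is an entrywise limit of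
    them and hence has a symbol ([entrywise_closure_symbol]).  Conversely, the
    polynomials that approximate the dilates [f(r z)] give a bounded sequence of
    operators converging to [b(T)] entrywise, therefore weakly and, a trace-class
    operator being a sum of rank-one operators with summable norms, weak-star
    ([bounded_entries_weak], [bounded_entries_weak_star]).  So both of these
    closures consist of all operators with a symbol, a copy of the bounded
    analytic functions.  In norm, uniform limits of polynomials are the members
    of the disk algebra ([disk_algebra_poly_dense],
    [disk_algebra_uniform_limit]).  The factorization of trace-class operators
    is obtained without spectral theory, by Cholesky elimination on [|K|] along
    the basis ([trace_class_factor]).

    If no weight vanishes, an operator commuting with [T] is determined by the
    image of [e_0], and it has a symbol, so the commutant is the same algebra;
    being commutative, it is its own commutant.  In the same case the weighted
    Hardy space is unitarily equivalent to [H], and a multiplier becomes an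
    operator with a symbol, bounded by the uniform boundedness principle.

    Analyticity being a local notion in the statement, the global Taylor
    expansion on the disk is needed as well; it is derived from Cauchy's
    estimates without integration ([Cauchy_estimate], [analytic_disk_psum]). *)

(** * Real-valued norms and sequential limits *)

Section norms.
Context {R : realType}.
Local Open Scope complex_scope.

Section zmod.
Context {V : normedZmodType R[i]}.
Implicit Types (x y : V) (u v : nat -> V).

Lemma normR_def x : `|x| = (normR x)%:C.
Proof. by rewrite /normR RRe_real ?ger0_real. Qed.

Lemma normR_ge0 x : 0 <= normR x.
Proof. by rewrite -lecR -normR_def; exact: normr_ge0. Qed.

Lemma normRD x y : normR (x + y) <= normR x + normR y.
Proof. by rewrite -lecR (rmorphD (real_complex R)) /= -!normR_def ler_normD. Qed.

Lemma normRN x : normR (- x) = normR x.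
Proof. by rewrite /normR normrN. Qed.

Lemma normR0 : normR (0 : V) = 0.
Proof. by rewrite /normR normr0. Qed.

Lemma normR_eq0 x : (normR x == 0) = (x == 0).
Proof. by rewrite -[RHS]normr_eq0 normR_def -(inj_eq (@complexI R)). Qed.

Lemma normR_distC x y : normR (x - y) = normR (y - x).
Proof. by rewrite /normR distrC. Qed.

Lemma normRB x y : normR (x - y) <= normR x + normR y.
Proof. by rewrite -(normRN y) normRD. Qed.

Lemma normR_sum (I : Type) (r : seq I) (Q : pred I) (F : I -> V) :
  normR (\sum_(i <- r | Q i) F i) <= \sum_(i <- r | Q i) normR (F i).
Proof.
elim/big_ind2 : _ => [|a b c d ab cd|//]; first by rewrite normR0.
by apply: le_trans (normRD _ _) _; rewrite lerD.
Qed.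

Lemma normR_tri (z x y : V) : normR (x - y) <= normR (x - z) + normR (z - y).
Proof.
have -> : x - y = (x - z) + (z - y) by rewrite addrA subrK.
exact: normRD.
Qed.

Lemma normR_small_eq0 x : (forall eps : R, 0 < eps -> normR x <= eps) -> x = 0.
Proof.
move=> h; apply/eqP; rewrite -normR_eq0 eq_le normR_ge0 andbT.
by apply/ler_addgt0Pl => e e0; rewrite addr0 h.
Qed.

(** Convergence of a sequence in terms of the real-valued norm; it spares the
    order on [R[i]] in all estimates. *)
Definition tendsto u (l : V) :=
  forall eps : R, 0 < eps -> exists N, forall n, (N <= n)%N -> normR (u n - l) < eps.

Lemma tendsto_squeeze u (l : V) (v : nat -> R) :
  (forall n, normR (u n - l) <= v n) -> v @ \oo --> (0 : R) -> tendsto u l.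
Proof.
move=> uv /cvgrPdist_lt v0 eps eps0.
have [N _ hN] := v0 _ eps0.
exists N => n Nn; apply: le_lt_trans (uv n) _.
have := hN n Nn; rewrite sub0r normrN; exact: le_lt_trans (ler_norm _).
Qed.

Lemma tendsto_cst (l : V) : tendsto (fun=> l) l.
Proof. by move=> eps eps0; exists 0%N => n _; rewrite subrr normR0. Qed.

Lemma tendstoD u v (l m : V) :
  tendsto u l -> tendsto v m -> tendsto (fun n => u n + v n) (l + m).
Proof.
move=> ul vm eps eps0; have e2 : 0 < eps / 2 by rewrite divr_gt0.
have [N1 h1] := ul _ e2; have [N2 h2] := vm _ e2.
exists (maxn N1 N2) => n; rewrite geq_max => /andP[n1 n2].
rewrite opprD addrACA (splitr eps); apply: le_lt_trans (normRD _ _) _.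
by rewrite ltrD ?h1 ?h2.
Qed.

Lemma tendstoN u (l : V) : tendsto u l -> tendsto (fun n => - u n) (- l).
Proof.
by move=> ul eps /ul[N hN]; exists N => n /hN; rewrite -opprD normRN.
Qed.

Lemma tendstoB u v (l m : V) :
  tendsto u l -> tendsto v m -> tendsto (fun n => u n - v n) (l - m).
Proof. by move=> ul vm; apply: tendstoD => //; exact: tendstoN. Qed.

Lemma eq_tendsto u v (l : V) : u =1 v -> tendsto u l -> tendsto v l.
Proof. by move=> /funext ->. Qed.

Lemma tendsto_sum (I : Type) (r : seq I) (Q : pred I) (F : I -> nat -> V)
    (l : I -> V) : (forall i, Q i -> tendsto (F i) (l i)) ->
  tendsto (fun n => \sum_(i <- r | Q i) F i n) (\sum_(i <- r | Q i) l i).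
Proof.
move=> Fl; elim: r => [|i r ih].
  apply: (eq_tendsto (u := fun=> 0)); last by rewrite big_nil; exact: tendsto_cst.
  by move=> n; rewrite big_nil.
rewrite big_cons; case: ifPn => Qi.
  apply: (eq_tendsto (u := fun n => F i n + \sum_(i <- r | Q i) F i n)).
    by move=> n; rewrite big_cons Qi.
  exact: tendstoD (Fl _ Qi) ih.
by apply: eq_tendsto ih => n; rewrite big_cons (negbTE Qi).
Qed.

Lemma tendsto_normR_le u (l : V) (M : R) (N0 : nat) :
  tendsto u l -> (forall n, (N0 <= n)%N -> normR (u n) <= M) -> normR l <= M.
Proof.
move=> ul uM; apply/ler_addgt0Pl => e e0; have [N hN] := ul _ e0.
have hm : (N <= maxn N0 N)%N by rewrite leq_maxr.
have /uM h : (N0 <= maxn N0 N)%N by rewrite leq_maxl.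
have -> : l = u (maxn N0 N) - (u (maxn N0 N) - l) by rewrite opprB addrC subrK.
by apply: le_trans (normRB _ _) _; rewrite addrC lerD// ltW// hN.
Qed.

Lemma tendsto_unique u (l m : V) : tendsto u l -> tendsto u m -> l = m.
Proof.
move=> ul um; apply/eqP; rewrite -subr_eq0 -normR_eq0 eq_le normR_ge0 andbT.
apply: (@tendsto_normR_le (fun n => u n - u n) _ _ 0); first exact: tendstoB.
by move=> n _; rewrite subrr normR0.
Qed.

Lemma tendsto_bounded u (l : V) : tendsto u l -> exists M, forall n, normR (u n) <= M.
Proof.
move=> /(_ 1 ltr01)[N hN].
exists (normR l + 1 + \sum_(i < N) normR (u i)) => n.
have s0 : 0 <= \sum_(i < N) normR (u i) by apply: sumr_ge0 => i _; rewrite normR_ge0.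
have [Nn|nN] := leqP N n.
  rewrite -(subrK l (u n)); apply: le_trans (normRD _ _) _.
  by have := hN _ Nn; lra.
rewrite (bigD1 (Ordinal nN))//=.
have : 0 <= \sum_(i < N | i != Ordinal nN) normR (u i).
  by apply: sumr_ge0 => i _; rewrite normR_ge0.
by have := normR_ge0 l; lra.
Qed.

Lemma tendsto_sub u (l : V) (f : nat -> nat) :
  (forall n, (n <= f n)%N) -> tendsto u l -> tendsto (u \o f) l.
Proof.
move=> nf ul eps /ul[N hN]; exists N => n Nn; apply: hN.
exact: leq_trans Nn (nf n).
Qed.

End zmod.

Lemma cvg_tendsto (V : normedModType R[i]) (u : nat -> V) (l : V) :
  u @ \oo --> l <-> tendsto u l.
Proof.
split=> [/cvgrPdist_lt ul eps eps0|ul].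
  have [N _ hN] := ul eps%:C (ltac:(by rewrite ltcR)).
  exists N => n Nn; have := hN n Nn.
  by rewrite normR_def ltcR normR_distC.
apply/cvgrPdist_lt => eps eps0.
have eR : eps = (complex.Re eps)%:C by rewrite RRe_real// gtr0_real.
have e0 : 0 < complex.Re eps by rewrite -ltcR -eR.
have [N hN] := ul _ e0.
exists N => // n Nn; rewrite /= distrC normR_def eR ltcR; exact: hN.
Qed.

Section complex_numbers.
Implicit Types (z : R[i]).

Lemma normR_real (x : R) : normR (x%:C) = `|x|.
Proof.
by rewrite /normR normc_def /= expr0n addr0 sqrtr_sqr.
Qed.

Lemma normR1 : normR (1 : R[i]) = 1.
Proof. by rewrite (_ : 1 = 1%:C)// normR_real normr1. Qed.

Lemma normRM z1 z2 : normR (z1 * z2) = normR z1 * normR z2.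
Proof. by apply: complexI; rewrite rmorphM /= -!normR_def normrM. Qed.

Lemma normRX z n : normR (z ^+ n) = normR z ^+ n.
Proof. by elim: n => [|n ih]; rewrite ?expr0 ?normR1// !exprS normRM ih. Qed.

Lemma normRV z : normR (z^-1) = (normR z)^-1.
Proof. by apply: complexI; rewrite fmorphV /= -!normR_def normfV. Qed.

Lemma normR_nat n : normR (n%:R : R[i]) = n%:R.
Proof. by rewrite -(rmorph_nat (real_complex R)) normR_real ger0_norm. Qed.

Lemma conj_real (x : R) : Num.conj (x%:C) = x%:C.
Proof. by rewrite conj_Creal// complex_real. Qed.

Lemma normR_conj z : normR (Num.conj z) = normR z.
Proof. by rewrite /normR norm_conjC. Qed.

Lemma conjM_normR z : z * Num.conj z = (normR z ^+ 2)%:C.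
Proof. by rewrite rmorphXn /= -normR_def normCK. Qed.

Lemma normR_Re z : `|complex.Re z| <= normR z.
Proof. by have := normc_ge_Re z; rewrite normR_def lecR. Qed.

Lemma Re_is_additive : additive (@complex.Re R).
Proof. by move=> [a b] [c d]. Qed.

Lemma normR_ReIm z : normR z <= `|complex.Re z| + `|complex.Im z|.
Proof.
rewrite [in normR z](complexE z); apply: le_trans (normRD _ _) _.
rewrite normRM !normR_real lerD2l ler_piMl//.
by rewrite /normR normc_def /= expr0n expr1n add0r sqrtr1.
Qed.

Lemma normR_Im z : `|complex.Im z| <= normR z.
Proof.
rewrite /normR normc_def /= -sqrtr_sqr ler_wsqrtr//.
by rewrite lerDr sqr_ge0.
Qed.

Lemma tendstoM (u v : nat -> R[i]) (l m : R[i]) :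
  tendsto u l -> tendsto v m -> tendsto (fun n => u n * v n) (l * m).
Proof.
move=> ul vm; have [M hM] := tendsto_bounded ul.
move=> eps eps0.
have M0 : 0 <= M := le_trans (normR_ge0 _) (hM 0%N).
have d0 : 0 < 1 + M + normR m by have := normR_ge0 m; lra.
have [N1 h1] := ul _ (divr_gt0 eps0 d0).
have [N2 h2] := vm _ (divr_gt0 eps0 d0).
exists (maxn N1 N2) => n; rewrite geq_max => /andP[/h1 {}h1 /h2 {}h2].
have -> : u n * v n - l * m = u n * (v n - m) + (u n - l) * m by ring.
apply: le_lt_trans (normRD _ _) _; rewrite !normRM.
set e := eps / _ in h1 h2.
have -> : eps = (1 + M + normR m) * e by rewrite mulrC divfK// gt_eqF.
have e0 : 0 < e by rewrite divr_gt0.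
have : normR (u n) * normR (v n - m) <= M * e by rewrite ler_pM ?normR_ge0// ltW.
have : normR (u n - l) * normR m <= e * normR m by rewrite ler_wpM2r ?normR_ge0// ltW.
lra.
Qed.

Lemma tendstoMl (c : R[i]) (v : nat -> R[i]) (m : R[i]) :
  tendsto v m -> tendsto (fun n => c * v n) (c * m).
Proof. by apply: tendstoM; exact: tendsto_cst. Qed.

Lemma tendsto_real (u : nat -> R) (l : R) :
  tendsto (fun n => (u n)%:C) l%:C <-> u @ \oo --> l.
Proof.
split=> [ul|/cvgrPdist_lt ul eps eps0].
  apply/cvgrPdist_lt => eps eps0; have [N hN] := ul _ eps0.
  by exists N => // n Nn; have := hN n Nn; rewrite -rmorphB normR_real distrC.
have [N _ hN] := ul _ eps0; exists N => n Nn.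
by rewrite -rmorphB normR_real distrC; exact: hN.
Qed.

(** Completeness of the plane, read off from that of the line coordinatewise. *)
Lemma Cauchy_tendsto (u : nat -> R[i]) :
  (forall eps : R, 0 < eps -> exists N, forall m n, (N <= m)%N -> (N <= n)%N ->
     normR (u m - u n) < eps) -> exists l, tendsto u l.
Proof.
move=> uC.
have coord (f : R[i] -> R) : (forall z, `|f z| <= normR z) ->
    (forall z1 z2, f (z1 - z2) = f z1 - f z2) ->
    exists l : R, (f \o u) @ \oo --> l.
  move=> fle fB; suff h : cvgn (f \o u) by exists (limn (f \o u)).
  apply: cauchy_cvg; apply: cauchy_exP => eps eps0.
  have [N hN] := uC _ eps0; exists (f (u N)); exists N => // n Nn.
  by rewrite -ball_normE /= -fB; apply: le_lt_trans (fle _) (hN _ _ _ _).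
have [a ha] := coord _ normR_Re (fun z1 z2 => Re_is_additive z1 z2).
have [b hb] := coord (@complex.Im R) normR_Im (fun z1 z2 => let: (Complex _ _) := z1 in
   let: Complex _ _ := z2 in erefl).
exists (Complex a b) => eps eps0.
have e2 : 0 < eps / 2 by rewrite divr_gt0.
move/cvgrPdist_lt/(_ _ e2) : ha => [N1 _ h1].
move/cvgrPdist_lt/(_ _ e2) : hb => [N2 _ h2].
exists (maxn N1 N2) => n; rewrite geq_max => /andP[/h1 {}h1 /h2 {}h2].
apply: le_lt_trans (normR_ReIm _) _; rewrite (splitr eps).
move: h1 h2; rewrite /= distrC => h1; rewrite distrC => h2.
by case: (u n) h1 h2 => x y /= h1 h2; rewrite ltrD.
Qed.

End complex_numbers.

Lemma normRZ (V : normedModType R[i]) (c : R[i]) (x : V) :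
  normR (c *: x) = normR c * normR x.
Proof. by apply: complexI; rewrite rmorphM /= -!normR_def normrZ. Qed.

Lemma Cauchy_tendsto_complete (V : completeNormedModType R[i]) (u : nat -> V) :
  (forall eps : R, 0 < eps -> exists N, forall m n, (N <= m)%N -> (N <= n)%N ->
     normR (u m - u n) < eps) -> exists l, tendsto u l.
Proof.
move=> uC; exists (limn u); apply/cvg_tendsto.
apply: cauchy_cvg; apply: cauchy_exP => eps eps0.
have eR : eps = (complex.Re eps)%:C by rewrite RRe_real// gtr0_real.
have e0 : 0 < complex.Re eps by rewrite -ltcR -eR.
have [N hN] := uC _ e0; exists (u N); exists N => // n Nn.
by rewrite -ball_normE /= normR_def eR ltcR; apply: hN.
Qed.

End norms.

(** * Toeplitz forms and von Neumann's inequality for weighted shifts *)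

Section Toeplitz.
Context {R : realType}.
Local Open Scope complex_scope.
Implicit Types (b x y : nat -> R[i]) (w : nat -> R).

Definition nsq N x : R := \sum_(n < N) normR (x n) ^+ 2.

(** The coefficient of [e_m] in [T^(m - n) e_n], for the shift [T] of weights [w]. *)
Definition wprod w n m : R := \prod_(n <= i < m) w i.

(** The form [<b(T) x, y>] on the span of the first [N] basis vectors, for the
    shift [T] of weights [w] and the power series [b]. *)
Definition Toeplitz b w N x y : R[i] :=
  \sum_(m < N) (\sum_(n < m.+1) b (m - n)%N * (wprod w n m)%:C * x n) * Num.conj (y m).

Lemma nsq_ge0 N x : 0 <= nsq N x.
Proof. by apply: sumr_ge0 => i _; rewrite sqr_ge0. Qed.

Lemma ex_prim_root n : (0 < n)%N -> exists z : R[i], n.-primitive_root z.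
Proof.
move=> n0; have [s ps] := closed_field_poly_normal ('X^n - 1 : {poly R[i]}).
have lc : lead_coef ('X^n - 1 : {poly R[i]}) = 1.
  by apply/eqP; rewrite -monicE monicXnsubC.
rewrite lc scale1r in ps.
have rs z : (z \in s) = n.-unity_root z.
  by rewrite -root_prod_XsubC -ps.
have us : uniq s.
  rewrite -separable_prod_XsubC -ps cyclotomic.separable_Xn_sub_1 //.
  by rewrite pnatr_eq0 -lt0n.
have ss : size s = n.
  by apply: succn_inj; rewrite -(size_prod_XsubC s id) -ps size_XnsubC.
have /hasP[z _ zp] : has n.-primitive_root s.
  apply: cyclic.has_prim_root => //; last by rewrite ss.
  by apply/allP => z; rewrite rs.
by exists z.
Qed.

Lemma prim_root_normR n (z : R[i]) : (0 < n)%N -> n.-primitive_root z -> normR z = 1.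
Proof.
move=> n0 /prim_expr_order zn.
have : normR z ^+ n == 1 by rewrite -normRX zn normR1.
by rewrite pexprn_eq1 ?normR_ge0// eqn0Ngt n0 => /eqP.
Qed.

Lemma conj_unimodular (z : R[i]) : normR z = 1 -> Num.conj z * z = 1.
Proof. by move=> z1; rewrite mulrC conjM_normR z1 expr1n. Qed.

(** Discrete orthogonality of characters. *)
Lemma sum_prim_root L (z : R[i]) k m : L.-primitive_root z -> (k < L)%N -> (m < L)%N ->
  \sum_(j < L) (z ^+ j) ^+ k * Num.conj ((z ^+ j) ^+ m) = (k == m)%:R * L%:R.
Proof.
move=> zL kL mL; have L0 : (0 < L)%N by exact: leq_ltn_trans kL.
have z1 := prim_root_normR L0 zL.
have z0 : z != 0 by rewrite -normR_eq0 z1 oner_eq0.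
have cz : Num.conj z = z^-1.
  by apply: (mulIf z0); rewrite conj_unimodular// mulVf.
have [->|km] := eqVneq k m.
  rewrite mul1r -[in RHS](card_ord L) -sum1_card natr_sum; apply: eq_bigr => j _.
  by rewrite mulrC conj_unimodular// !normRX z1 !expr1n.
rewrite mul0r; set t := z ^+ k / z ^+ m.
have tj (j : 'I_L) : (z ^+ j) ^+ k * Num.conj ((z ^+ j) ^+ m) = t ^+ j.
  by rewrite !rmorphXn /= cz /t -!exprVn exprMn -!exprM ![(j * _)%N]mulnC.
under eq_bigr do rewrite tj.
have t1 : t != 1.
  apply: contra km => /eqP h; apply/eqP.
  have : z ^+ k == z ^+ m by rewrite -[X in X == _](divfK (expf_neq0 m z0)) -/t h mul1r.
  by rewrite (eq_prim_root_expr zL) !modn_small// => /eqP.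
have tL : t ^+ L = 1.
  rewrite /t expr_div_n -!exprM ![(_ * L)%N]mulnC !exprM.
  by rewrite (prim_expr_order zL) !expr1n divr1.
have := subrX1 t L; rewrite tL subrr => /esym/eqP.
by rewrite mulf_eq0 subr_eq0 (negbTE t1)/= => /eqP.
Qed.

Lemma Parseval_prim_root L N (z : R[i]) x : L.-primitive_root z -> (N <= L)%N ->
  \sum_(j < L) normR (\sum_(n < N) x n * (z ^+ j) ^+ n) ^+ 2 = L%:R * nsq N x.
Proof.
move=> zL NL; apply: complexI; rewrite rmorph_sum /=.
transitivity (\sum_(j < L) \sum_(n < N) \sum_(m < N)
   x n * Num.conj (x m) * ((z ^+ j) ^+ n * Num.conj ((z ^+ j) ^+ m))).
  apply: eq_bigr => j _; rewrite -conjM_normR rmorph_sum /= big_distrlr /=.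
  by apply: eq_bigr => n _; apply: eq_bigr => m _; rewrite rmorphM /=; ring.
rewrite exchange_big /= rmorphM /= rmorph_sum /= mulr_sumr; apply: eq_bigr => n _.
rewrite exchange_big /= (bigD1 n)//= [X in _ + X]big1 ?addr0; last first.
  move=> m mn; rewrite -mulr_sumr (sum_prim_root zL) ?(leq_trans (ltn_ord _) NL)//.
  by rewrite eq_sym (inj_eq val_inj) (negbTE mn) mul0r mulr0.
rewrite -mulr_sumr (sum_prim_root zL) ?(leq_trans (ltn_ord _) NL)//.
by rewrite eqxx mul1r conjM_normR mulrC rmorph_nat.
Qed.

(** With at least [D + N] roots of unity there is no aliasing between the powers
    [z^(k + n)] and [z^m], so averaging singles out the terms with [k + n = m]. *)
Lemma Toeplitz_prim_root D N (z : R[i]) b x y :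
    (D + N).-primitive_root z ->
    (forall k, (D <= k)%N -> b k = 0) ->
  \sum_(j < D + N) (\sum_(k < D) b k * (z ^+ j) ^+ k) *
     (\sum_(n < N) x n * (z ^+ j) ^+ n) *
     Num.conj (\sum_(m < N) y m * (z ^+ j) ^+ m) =
  (D + N)%:R * Toeplitz b (fun=> 1) N x y.
Proof.
move=> zL bD; set L := (D + N)%N in zL *.
transitivity (\sum_(j < L) \sum_(m < N) \sum_(n < N) \sum_(k < D)
   b k * x n * Num.conj (y m) * ((z ^+ j) ^+ (k + n) * Num.conj ((z ^+ j) ^+ m))).
  apply: eq_bigr => j _; rewrite rmorph_sum /= mulr_sumr; apply: eq_bigr => m _.
  rewrite mulrC big_distrlr /= exchange_big mulr_sumr /=.
  apply: eq_bigr => n _; rewrite mulr_sumr; apply: eq_bigr => k _.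
  by rewrite rmorphM /= exprD; ring.
rewrite exchange_big /= /Toeplitz mulr_sumr; apply: eq_bigr => m _.
rewrite exchange_big /= mulr_suml mulr_sumr.
rewrite (big_ord_widen_cond _ xpredT
  (fun n => L%:R * (b (m - n)%N * (wprod (fun=> 1) n m)%:C * x n * Num.conj (y m)))
  (ltn_ord m)) /=.
rewrite [RHS]big_mkcond /=.
apply: eq_bigr => n _; rewrite exchange_big /=.
under eq_bigr => k _.
  rewrite -mulr_sumr (sum_prim_root zL); last 2 first.
  - by rewrite /L -addnS leq_add// ltnW.
  - by rewrite ltn_addl.
  over.
rewrite ltnS; case: ifPn => nm; last first.
  apply: big1 => k _; rewrite (_ : (_ == _) = false) ?mul0r ?mulr0//.
  by apply/eqP => knm; rewrite -knm leq_addl in nm.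
have W1 : wprod (fun=> 1) n m = 1 by rewrite /wprod big1.
have [mnD|Dmn] := ltnP (m - n) D; last first.
  rewrite bD// !mul0r mulr0; apply: big1 => k _.
  rewrite (_ : (_ == _) = false) ?mul0r ?mulr0//.
  apply/eqP => knm; have : (m - n = k)%N by rewrite -knm addnK.
  by move=> e; move: Dmn; rewrite e leqNgt ltn_ord.
rewrite (bigD1 (Ordinal mnD))//= subnK// eqxx W1 big1.
  by rewrite rmorph1 addr0 mul1r; ring.
move=> k kmn; rewrite (_ : (_ == _) = false) ?mul0r ?mulr0//.
apply/eqP => knm; move: kmn; rewrite -(inj_eq val_inj)/= -knm.
by rewrite addnK eqxx.
Qed.

(** At each root of unity [2 |b x y| <= C (|x|^2 + |y|^2)]; the average of the
    right-hand side is given by discrete orthogonality. *)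
Lemma Toeplitz_unweighted_le D N b x y (C : R) :
    (forall k, (D <= k)%N -> b k = 0) ->
    (forall z, normR z = 1 -> normR (\sum_(k < D) b k * z ^+ k) <= C) ->
  normR (Toeplitz b (fun=> 1) N x y) *+ 2 <= C * (nsq N x + nsq N y).
Proof.
move=> bD bC.
have [L0|L0] := posnP (D + N).
  have N0 : N = 0%N by lia.
  by rewrite N0 /Toeplitz /nsq !big_ord0 addr0 mulr0 normR0 mul0rn.
have [z zL] := ex_prim_root L0.
have LR : 0 < (D + N)%:R :> R by rewrite ltr0n.
have -> : normR (Toeplitz b (fun=> 1) N x y) =
    (D + N)%:R^-1 * normR ((D + N)%:R * Toeplitz b (fun=> 1) N x y).
  by rewrite normRM normR_nat mulrA mulVf ?mul1r// gt_eqF.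
rewrite -(Toeplitz_prim_root _ _ zL bD) -mulrnAr ler_pdivrMl// mulrCA mulrDr.
rewrite -!(Parseval_prim_root _ zL) ?leq_addl// -big_split /= mulr_sumr.
apply: le_trans (_ : (\sum_(j < D + N) normR
   ((\sum_(k < D) b k * (z ^+ j) ^+ k) * (\sum_(n < N) x n * (z ^+ j) ^+ n) *
    Num.conj (\sum_(m < N) y m * (z ^+ j) ^+ m))) *+ 2 <= _).
  by rewrite lerMn2r normR_sum orbT.
rewrite -sumrMnl; apply: ler_sum => j _; rewrite !normRM normR_conj.
set X := normR (\sum_(n < N) _); set Y := normR (\sum_(n < N) _).
have zj : normR (z ^+ j) = 1 by rewrite normRX (prim_root_normR L0 zL) expr1n.
have := bC _ zj; set B := normR _ => BC.
have C0 : 0 <= C by exact: le_trans (normR_ge0 _) BC.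
have XY : X * Y *+ 2 <= X ^+ 2 + Y ^+ 2 by have := sqr_ge0 (X - Y); rewrite sqrrB; lra.
apply: le_trans (_ : C * (X * Y *+ 2) <= _); last by rewrite ler_wpM2l.
rewrite (_ : B * X * Y *+ 2 = B * (X * Y *+ 2)); last by rewrite -mulrA mulrnAr.
by rewrite ler_wpM2r// mulrn_wge0// mulr_ge0 ?normR_ge0.
Qed.

(** For signs the weights are a coboundary, so a diagonal unitary conjugates
    the weighted shift into the unweighted one. *)
Lemma wprod_signs w n m : (forall i, w i = 1 \/ w i = -1) -> (n <= m)%N ->
  wprod w n m = wprod w 0 n * wprod w 0 m.
Proof.
move=> w1 nm; rewrite /wprod (@big_cat_nat _ _ _ n 0 m)//= mulrA -expr2.
rewrite (_ : _ ^+ 2 = 1) ?mul1r// -prodrXl big1// => i _.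
by case: (w1 i) => ->; rewrite ?sqrrN expr1n.
Qed.

Definition set_weight w k (t : R) : nat -> R := fun i => if i == k then t else w i.

Lemma wprod_affine w k n m : wprod w n m =
  (1 + w k) / 2 * wprod (set_weight w k 1) n m +
  (1 - w k) / 2 * wprod (set_weight w k (-1)) n m.
Proof.
rewrite /wprod; have [kin|kout] := boolP (k \in index_iota n m).
  have upd t : \prod_(n <= i < m) set_weight w k t i =
      t * \prod_(n <= i < m | i != k) w i.
    rewrite (bigD1_seq k)//= ?iota_uniq// /set_weight eqxx; congr (_ * _).
    by apply: eq_bigr => i /negbTE ->.
  by rewrite !upd (bigD1_seq k) ?iota_uniq//=; field.
have upd t : \prod_(n <= i < m) set_weight w k t i = \prod_(n <= i < m) w i.
  apply: eq_big_seq => i ii; rewrite /set_weight; case: eqP => // ik.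
  by rewrite -ik ii in kout.
by rewrite !upd; field.
Qed.

(** Von Neumann's inequality.  The form is affine in each weight, so its modulus
    over weights in [-1, 1] is largest at signs; there a diagonal change of basis
    removes them.  The bound of [2 |form|] by the sum of squares, instead of
    the product of norms, is additive over the roots of unity. *)
Lemma Toeplitz_le D N b w x y (C : R) :
    (forall k, (D <= k)%N -> b k = 0) ->
    (forall z, normR z = 1 -> normR (\sum_(k < D) b k * z ^+ k) <= C) ->
    (forall i, `|w i| <= 1) ->
  normR (Toeplitz b w N x y) *+ 2 <= C * (nsq N x + nsq N y).
Proof.
move=> bD bC w1.
suff H K v : (forall i, `|v i| <= 1) -> (forall i, (K <= i)%N -> v i = 1 \/ v i = -1) ->
    normR (Toeplitz b v N x y) *+ 2 <= C * (nsq N x + nsq N y).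
  pose v i := if (i < N)%N then w i else 1.
  have -> : Toeplitz b w N x y = Toeplitz b v N x y.
    apply: eq_bigr => m _; congr (_ * _); apply: eq_bigr => n _; congr (_ * _%:C * _).
    apply: eq_big_nat => i /andP[_ im]; rewrite /v ifT//.
    exact: ltn_trans im (ltn_ord m).
  apply: (H N) => i; first by rewrite /v; case: ifP; rewrite ?normr1.
  by rewrite /v ltnNge => ->; left.
elim: K v => [|K ih] v v1 vs.
  pose s n := (wprod v 0 n)%:C.
  have sE n : normR (s n) = 1.
    rewrite /s normR_real /wprod normr_prod big1// => i _.
    by case: (vs i isT) => ->; rewrite ?normrN normr1.
  have -> : Toeplitz b v N x y =
      Toeplitz b (fun=> 1) N (fun n => s n * x n) (fun n => s n * y n).
    apply: eq_bigr => m _; rewrite !mulr_suml; apply: eq_bigr => n _.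
    rewrite wprod_signs//; last by rewrite -ltnS.
      rewrite [wprod (fun=> 1) _ _]big1// !rmorphM /= conj_real /s.
      by rewrite rmorph1; ring.
    by move=> i; exact: vs.
  have nE u : nsq N (fun n => s n * u n) = nsq N u.
    by apply: eq_bigr => i _; rewrite normRM sE mul1r.
  by apply: le_trans (Toeplitz_unweighted_le _ _ _ bD bC) _; rewrite !nE.
set v1' := set_weight v K 1; set v2' := set_weight v K (-1).
have -> : Toeplitz b v N x y = ((1 + v K) / 2)%:C * Toeplitz b v1' N x y +
    ((1 - v K) / 2)%:C * Toeplitz b v2' N x y.
  rewrite /Toeplitz !mulr_sumr -big_split /=; apply: eq_bigr => m _.
  rewrite !mulrA -mulrDl; congr (_ * _); rewrite !mulr_sumr -big_split /=.
  apply: eq_bigr => n _; rewrite (wprod_affine v K) -/v1' -/v2' rmorphD /= !rmorphM /=.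
  ring.
have vs' t i : (t = 1 \/ t = -1) -> (K <= i)%N ->
    set_weight v K t i = 1 \/ set_weight v K t i = -1.
  rewrite /set_weight => t1 Ki; case: eqP => // iK; apply: vs.
  by rewrite ltn_neqAle eq_sym Ki andbT; apply/eqP.
have v1s t i : `|t| <= 1 -> `|set_weight v K t i| <= 1.
  by rewrite /set_weight; case: eqP.
have h1 := ih v1' (fun i => v1s 1 i (ltac:(by rewrite normr1)))
  (fun i => vs' 1 i (or_introl erefl)).
have h2 := ih v2' (fun i => v1s (-1) i (ltac:(by rewrite normrN normr1)))
  (fun i => vs' (-1) i (or_intror erefl)).
have /andP[vl vr] : - 1 <= v K <= 1 by rewrite -ler_norml.
apply: le_trans (_ : (((1 + v K) / 2) * normR (Toeplitz b v1' N x y) +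
   ((1 - v K) / 2) * normR (Toeplitz b v2' N x y)) *+ 2 <= _).
  rewrite lerMn2r /=; apply: le_trans (normRD _ _) _.
  by rewrite !normRM !normR_real !ger0_norm//; lra.
move: h1 h2; set a := normR _; set c := normR _; set M := C * _ => h1 h2.
have -> : ((1 + v K) / 2 * a + (1 - v K) / 2 * c) *+ 2 =
  (1 + v K) / 2 * (a *+ 2) + (1 - v K) / 2 * (c *+ 2) by ring.
have -> : M = (1 + v K) / 2 * M + (1 - v K) / 2 * M by field.
by apply: lerD; apply: ler_wpM2l => //; lra.
Qed.

Lemma Toeplitz_coef b n : Toeplitz b (fun=> 1) n.+1
  (fun k => (k == 0%N)%:R) (fun k => (k == n)%:R) = b n.
Proof.
rewrite /Toeplitz (bigD1 ord_max)//= [X in _ + X]big1 ?addr0; last first.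
  move=> i; rewrite -(inj_eq val_inj)/= => /negbTE ->.
  by rewrite rmorph0 mulr0.
rewrite eqxx rmorph1 mulr1 (bigD1 ord0)//= big1 ?addr0; last first.
  by move=> i; rewrite -(inj_eq val_inj)/= => /negbTE ->; rewrite mulr0.
by rewrite mulr1 subn0 /wprod big1// mulr1.
Qed.

Lemma nsq_delta n k : (k < n)%N -> nsq n (fun i => (i == k)%:R) = 1.
Proof.
move=> kn; rewrite /nsq (bigD1 (Ordinal kn))//= eqxx normR1 expr1n big1 ?addr0//.
move=> i; rewrite -(inj_eq val_inj)/= => /negbTE ->.
by rewrite normR0 expr0n.
Qed.

(** A coefficient is a value of the unweighted form at two basis vectors. *)
Lemma coef_le_sup D b n (C : R) :
    (forall k, (D <= k)%N -> b k = 0) ->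
    (forall z, normR z = 1 -> normR (\sum_(k < D) b k * z ^+ k) <= C) ->
  normR (b n) <= C.
Proof.
move=> bD bC.
have := Toeplitz_le n.+1 (fun k => (k == 0%N)%:R) (fun k => (k == n)%:R) bD bC
  (fun=> ltac:(by rewrite normr1) : `|1 : R| <= 1).
by rewrite Toeplitz_coef !nsq_delta//; lra.
Qed.

End Toeplitz.

(** * Power series and analytic functions on the disk *)

Section power_series.
Context {R : realType}.
Local Open Scope complex_scope.
Implicit Types (b c d : nat -> R[i]) (a z : R[i]) (f : R[i] -> R[i]).

Definition csum c (l : R[i]) := tendsto (fun N => \sum_(n < N) c n) l.

Definition psum b z (l : R[i]) := csum (fun n => b n * z ^+ n) l.

Lemma cvg_series_csum (c : nat -> R[i]^o) (l : R[i]^o) :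
  series c @ \oo --> l <-> csum c l.
Proof.
rewrite cvg_tendsto /csum; split; apply: eq_tendsto => n.
  by rewrite /series /= big_mkord.
by rewrite /series /= big_mkord.
Qed.

Lemma csum_ext c d (l : R[i]) : c =1 d -> csum c l -> csum d l.
Proof. by move=> /funext ->. Qed.

Lemma csum_unique c (l m : R[i]) : csum c l -> csum c m -> l = m.
Proof. exact: tendsto_unique. Qed.

Lemma csumD c d (l m : R[i]) : csum c l -> csum d m ->
  csum (fun n => c n + d n) (l + m).
Proof.
move=> cl dm; have := tendstoD cl dm; apply: eq_tendsto => n.
by rewrite big_split.
Qed.

Lemma csumM (t : R[i]) c (l : R[i]) : csum c l -> csum (fun n => t * c n) (t * l).
Proof.
move=> cl; have := tendstoMl t cl; apply: eq_tendsto => n.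
by rewrite mulr_sumr.
Qed.

Lemma csumB c d (l m : R[i]) : csum c l -> csum d m ->
  csum (fun n => c n - d n) (l - m).
Proof.
move=> cl dm; have := csumD cl (csumM (-1) dm); rewrite mulN1r.
by apply: csum_ext => n; rewrite mulN1r.
Qed.

Lemma csum_sum K (F : nat -> nat -> R[i]) (l : nat -> R[i]) :
  (forall k, csum (F k) (l k)) ->
  csum (fun n => \sum_(k < K) F k n) (\sum_(k < K) l k).
Proof.
move=> Fl; have := @tendsto_sum R _ _ (index_enum 'I_K) xpredT
  (fun (k : 'I_K) N => \sum_(n < N) F k n) (fun k => l k) (fun k _ => Fl k).
by apply: eq_tendsto => N; rewrite exchange_big.
Qed.

Lemma csum_eventually0 c N : (forall n, (N <= n)%N -> c n = 0) ->
  csum c (\sum_(n < N) c n).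
Proof.
move=> c0 e e0; exists N => n Nn.
rewrite -!(big_mkord xpredT) (@big_cat_nat _ _ _ N 0 n)//= addrAC subrr add0r.
by rewrite big_nat big1 ?normR0// => i /andP[/c0].
Qed.

Lemma geometric_partial_le (q : R) N M : 0 <= q < 1 ->
  \sum_(N <= n < M) q ^+ n <= q ^+ N / (1 - q).
Proof.
move=> /andP[q0 q1]; have q1' : 0 < 1 - q by rewrite subr_gt0.
have [NM|MN] := leqP N M; last first.
  by rewrite big_geq ?(ltnW MN)// divr_ge0// ?exprn_ge0// ltW.
rewrite ler_pdivlMr// mulr_suml.
have -> : \sum_(N <= n < M) q ^+ n * (1 - q) = q ^+ N - q ^+ M.
  rewrite (@telescope_sumr_eq _ N M (fun n => - q ^+ n))//.
    by rewrite opprK addrC.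
  by move=> n _; rewrite exprS; ring.
by rewrite lerBlDr lerDl exprn_ge0.
Qed.

Section geometric_domination.
Variables (K q : R).
Hypothesis q01 : 0 <= q < 1.

Let q0 : 0 <= q. Proof. by case/andP: q01. Qed.
Let q1 : q < 1. Proof. by case/andP: q01. Qed.

Lemma cvg_geometric_tail : (fun N => K * q ^+ N / (1 - q)) @ \oo --> (0 : R).
Proof.
have h : (fun n => q ^+ n) @ \oo --> (0 : R) by apply: cvg_expr; rewrite ger0_norm.
rewrite (_ : (fun N => _) = (fun N => (K / (1 - q)) * q ^+ N)); last first.
  by apply/funext => N; rewrite mulrAC.
by rewrite -[X in _ --> X](mulr0 (K / (1 - q))); apply: cvgM => //; exact: cvg_cst.
Qed.

Variable c : nat -> R[i].
Hypothesis cq : forall n, normR (c n) <= K * q ^+ n.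

Lemma csum_Cauchy N M : (N <= M)%N ->
  normR (\sum_(n < M) c n - \sum_(n < N) c n) <= K * q ^+ N / (1 - q).
Proof.
move=> NM; rewrite -!(big_mkord xpredT) (@big_cat_nat _ _ _ N 0 M)//= addrAC subrr add0r.
apply: le_trans (normR_sum _ _ _) _.
apply: le_trans (ler_sum _ (fun n _ => cq n)) _.
rewrite -mulr_sumr -mulrA; apply: ler_wpM2l; last exact: geometric_partial_le.
by have := le_trans (normR_ge0 _) (cq 0); rewrite expr0 mulr1.
Qed.

Lemma csum_geometric : exists l, csum c l.
Proof.
apply: Cauchy_tendsto => eps eps0.
have e2 : 0 < eps / 2 by rewrite divr_gt0.
move/cvgrPdist_lt/(_ _ e2) : cvg_geometric_tail => [N _ hN]; exists N => m n Nm Nn.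
have := hN N (leqnn N); rewrite /= sub0r normrN => /(le_lt_trans (ler_norm _)) h.
apply: le_lt_trans (normR_tri (\sum_(i < N) c i) _ _) _; rewrite (splitr eps).
apply: ltrD; first exact: le_lt_trans (csum_Cauchy Nm) h.
by rewrite normR_distC; exact: le_lt_trans (csum_Cauchy Nn) h.
Qed.

Lemma csum_tail (l : R[i]) N : csum c l ->
  normR (l - \sum_(n < N) c n) <= K * q ^+ N / (1 - q).
Proof.
move=> cl; apply: (@tendsto_normR_le _ _ _ _ _ N (tendstoB cl (@tendsto_cst _ _ _))).
by move=> M NM; exact: csum_Cauchy.
Qed.

Lemma csum_geometric_le (l : R[i]) : csum c l -> normR l <= K / (1 - q).
Proof. by move=> /(csum_tail 0); rewrite big_ord0 subr0 expr0 mulr1. Qed.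

End geometric_domination.

Lemma cvg_nat_geometric (q : R) : 0 <= q < 1 ->
  (fun n => n.+1%:R * q ^+ n) @ \oo --> (0 : R).
Proof.
(* n q^n = (n p^n) (q / p)^n with q < p < 1, and n p^n <= 1 + p + ... + p^(n-1) *)
move=> /andP[q0 q1]; pose p := (1 + q) / 2.
have p01 : 0 <= p < 1 by rewrite /p; apply/andP; split; lra.
have p0 : 0 < p by rewrite /p; lra.
have qp : 0 <= q / p < 1.
  by rewrite divr_ge0 ?(ltW p0)//= ltr_pdivrMr// mul1r /p; lra.
have np n : n.+1%:R * p ^+ n <= (1 - p)^-1.
  have := geometric_partial_le 0 n.+1 p01; rewrite expr0 mul1r; apply: le_trans.
  rewrite -[n.+1%:R]/(1 *+ n.+1 : R) -[X in X <= _]/((1 *+ n.+1) * p ^+ n) mulrnAl mul1r.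
  rewrite big_mkord -[X in _ *+ X](card_ord n.+1) -sumr_const; apply: ler_sum => i _.
  by case/andP: p01 => ? /ltW ?; rewrite ler_wiXn2l// -ltnS.
have := @cvg_geometric_tail ((1 - p)^-1 * (1 - q / p)) _ qp.
apply: squeeze_cvgr; last exact: cvg_cst.
near=> n; apply/andP; split; first by rewrite mulr_ge0 ?exprn_ge0.
have -> : n.+1%:R * q ^+ n = n.+1%:R * p ^+ n * (q / p) ^+ n.
  by rewrite -mulrA -exprMn mulrCA divff ?mulr1// gt_eqF.
have [qp0 qp1] := andP qp.
rewrite [X in _ <= X]mulrAC mulfK; last by rewrite gt_eqF// subr_gt0.
by rewrite ler_wpM2r ?exprn_ge0.
Unshelve. all: by end_near. Qed.

Lemma psum_terms_bounded b z (l : R[i]) : psum b z l ->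
  exists K, forall n, normR (b n) * normR z ^+ n <= K.
Proof.
move=> /tendsto_bounded[M hM]; exists (M + M) => n.
have := lerD (hM n.+1) (hM n); apply: le_trans.
rewrite -normRX -normRM; apply: le_trans (normRB _ _).
by rewrite big_ord_recr /= addrAC subrr add0r.
Qed.

Lemma geometric_terms (K s : R) b z : 0 < s ->
  (forall n, normR (b n) * s ^+ n <= K) ->
  forall n, normR (b n * z ^+ n) <= K * (normR z / s) ^+ n.
Proof.
move=> s0 bK n; rewrite normRM normRX.
have -> : normR (b n) * normR z ^+ n = normR (b n) * s ^+ n * (normR z / s) ^+ n.
  by rewrite -mulrA -exprMn mulrCA divff ?mulr1// gt_eqF.
by rewrite ler_wpM2r ?exprn_ge0 ?divr_ge0 ?normR_ge0 ?(ltW s0).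
Qed.

Lemma ratio_in01 (s : R) z : normR z < s -> 0 <= normR z / s < 1.
Proof.
move=> zs; have s0 : 0 < s by exact: le_lt_trans (normR_ge0 _) zs.
by rewrite divr_ge0 ?normR_ge0 ?(ltW s0)//= ltr_pdivrMr// mul1r.
Qed.

Lemma psum_exists (K s : R) b z : (forall n, normR (b n) * s ^+ n <= K) ->
  normR z < s -> exists l, psum b z l.
Proof.
move=> bK zs; have s0 : 0 < s by exact: le_lt_trans (normR_ge0 _) zs.
exact: (csum_geometric (ratio_in01 zs) (geometric_terms z s0 bK)).
Qed.

Lemma psum_radius_bound b f (s r : R) : 0 <= s < r ->
  (forall z, normR z < r -> psum b z (f z)) ->
  exists K, forall n, normR (b n) * s ^+ n <= K.
Proof.
move=> /andP[s0 sr] bf.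
have ns : normR (s%:C) = s by rewrite normR_real ger0_norm.
have [|K hK] := @psum_terms_bounded b s%:C (f s%:C); first by apply: bf; rewrite ns.
by exists K => n; have := hK n; rewrite ns.
Qed.

(** Cauchy's estimate, from the bound on coefficients of polynomials applied to
    the partial sums. *)
Lemma Cauchy_estimate c f (r s M : R) n : 0 <= s < r ->
  (forall z, normR z < r -> psum c z (f z)) ->
  (forall z, normR z <= s -> normR (f z) <= M) ->
  normR (c n) * s ^+ n <= M.
Proof.
move=> /andP[s0 sr] cf fM; apply/ler_addgt0Pl => e e0.
pose t := (s + r) / 2.
have st : s < t by rewrite /t; lra.
have t0 : 0 < t by lra.
have [K hK] : exists K, forall n, normR (c n) * t ^+ n <= K.
  by apply: psum_radius_bound cf; rewrite /t; apply/andP; split; lra.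
have q01 : 0 <= s / t < 1.
  by rewrite divr_ge0 ?(ltW t0)//= ltr_pdivrMr// mul1r.
move/cvgrPdist_lt/(_ _ e0) : (@cvg_geometric_tail K _ q01) => [N _ hN].
pose L := maxn N n.+1.
have /(le_lt_trans (ler_norm _))/ltW hL : `|K * (s / t) ^+ L / (1 - s / t)| < e.
  by have := hN L (leq_maxl _ _); rewrite /= sub0r normrN.
pose d k := if (k < L)%N then c k * s%:C ^+ k else 0.
have -> : normR (c n) * s ^+ n = normR (d n).
  by rewrite /d leq_maxr normRM normRX normR_real ger0_norm.
apply: (@coef_le_sup _ L) => [k|z z1]; first by rewrite /d leqNgt => /negbTE ->.
have zs : normR (s%:C * z) = s by rewrite normRM z1 mulr1 normR_real ger0_norm.
have -> : \sum_(k < L) d k * z ^+ k = \sum_(k < L) c k * (s%:C * z) ^+ k.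
  by apply: eq_bigr => k _; rewrite /d ltn_ord exprMn mulrA.
set S := \sum_(k < L) _.
have -> : S = f (s%:C * z) - (f (s%:C * z) - S) by rewrite opprB addrC subrK.
rewrite [leRHS]addrC; apply: le_trans (normRB _ _) _; apply: lerD; first by rewrite fM ?zs.
apply: le_trans hL; have := geometric_terms (s%:C * z) t0 hK.
rewrite zs => h; apply: (csum_tail q01 h); apply: cf; by rewrite zs.
Qed.

Lemma psum_coef_unique c d f (r : R) : 0 < r ->
  (forall z, normR z < r -> psum c z (f z)) ->
  (forall z, normR z < r -> psum d z (f z)) -> c =1 d.
Proof.
move=> r0 cf df n; apply/eqP; rewrite -subr_eq0 -normR_eq0 eq_le normR_ge0 andbT.
have r2 : 0 < r / 2 by rewrite divr_gt0.
have : normR (c n - d n) * (r / 2) ^+ n <= 0.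
  apply: (@Cauchy_estimate (fun n => c n - d n) (fun=> 0) r) => [|z zr|z _].
  - by apply/andP; split; lra.
  - have := csumB (cf z zr) (df z zr); rewrite subrr; apply: csum_ext => k.
    by rewrite mulrBl.
  - by rewrite normR0.
by rewrite pmulr_lle0// exprn_gt0.
Qed.

(** [C(n, k) |a|^(n - k) dl^k] is one term of the expansion of [(|a| + dl)^n]. *)
Lemma recenter_coef_bound c a (K s dl : R) k n : 0 < dl -> normR a + dl <= s ->
  (forall n, normR (c n) * s ^+ n <= K) ->
  normR (c n * 'C(n, k)%:R * a ^+ (n - k)) <=
    K / dl ^+ k * ((normR a + dl) / s) ^+ n.
Proof.
move=> dl0 ads cK; rewrite !normRM normR_nat normRX.
have a0 := normR_ge0 a.
have s0 : 0 < s by lra.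
have K0 : 0 <= K by apply: le_trans (cK 0%N); rewrite mulr1 normR_ge0.
have t0 : 0 <= (normR a + dl) / s by rewrite divr_ge0 ?(ltW s0)//; lra.
have [kn|nk] := leqP k n; last first.
  rewrite bin_small// mulr0 mul0r; apply: mulr_ge0; last exact: exprn_ge0.
  by apply: divr_ge0 => //; apply: exprn_ge0; exact: ltW.
have binle : 'C(n, k)%:R * normR a ^+ (n - k) * dl ^+ k <= (normR a + dl) ^+ n.
  rewrite exprDn (bigD1 (Ordinal (kn : (k < n.+1)%N)))//= -mulrA mulr_natl.
  rewrite lerDl sumr_ge0// => i _.
  by rewrite mulrn_wge0// mulr_ge0 ?exprn_ge0// ltW.
have -> : K / dl ^+ k * ((normR a + dl) / s) ^+ n =
    K * (normR a + dl) ^+ n / (dl ^+ k * s ^+ n).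
  by rewrite expr_div_n invfM; ring.
rewrite ler_pdivlMr ?mulr_gt0 ?exprn_gt0//.
have := ler_pM (mulr_ge0 (normR_ge0 (c n)) (exprn_ge0 n (ltW s0)))
  (mulr_ge0 (mulr_ge0 (ler0n R _) (exprn_ge0 _ a0)) (exprn_ge0 k (ltW dl0))) (cK n) binle.
by apply: le_trans; rewrite le_eqVlt; apply/orP; left; apply/eqP; ring.
Qed.

(** Taylor expansion of a power series at another point of its disk. *)
Lemma recenter c f a (r : R) : normR a < r ->
  (forall z, normR z < r -> psum c z (f z)) ->
  exists d, (forall k, csum (fun n => c n * 'C(n, k)%:R * a ^+ (n - k)) (d k)) /\
    forall z, normR (z - a) < r - normR a -> psum d (z - a) (f z).
Proof.
move=> ar cf; have a0 := normR_ge0 a.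
have dex k : exists l, csum (fun n => c n * 'C(n, k)%:R * a ^+ (n - k)) l.
  pose dl := (r - normR a) / 4; have dl0 : 0 < dl by rewrite divr_gt0// subr_gt0.
  pose s := normR a + dl + dl.
  have [K hK] : exists K, forall n, normR (c n) * s ^+ n <= K.
    by apply: psum_radius_bound cf; rewrite /s /dl; apply/andP; split; lra.
  have s0 : 0 < s by rewrite /s; lra.
  have ads : normR a + dl <= s by rewrite /s; lra.
  apply: (@csum_geometric (K / dl ^+ k) ((normR a + dl) / s)) => [|n].
    rewrite divr_ge0 ?(ltW s0)//=; last lra.
    by rewrite ltr_pdivrMr// mul1r /s; lra.
  exact: recenter_coef_bound.
exists (fun k => projT1 (cid (dex k))); split=> [k|z zar]; first by case: cid.
set d := fun k => _; have dE k : csum (fun n => c n * 'C(n, k)%:R * a ^+ (n - k)) (d k).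
  by rewrite /d; case: cid.
set h := z - a in zar *; have h0 := normR_ge0 h.
pose t := normR a + normR h; pose s := (t + r) / 2.
have [K hK] : exists K, forall n, normR (c n) * s ^+ n <= K.
  by apply: psum_radius_bound cf; rewrite /s /t; apply/andP; split; lra.
have s0 : 0 < s by rewrite /s /t; lra.
have q01 : 0 <= t / s < 1.
  apply/andP; split; first by rewrite divr_ge0 ?(ltW s0)// /t; lra.
  by rewrite ltr_pdivrMr// mul1r /s /t; lra.
apply: tendsto_squeeze (@cvg_geometric_tail K _ q01) => N; rewrite normR_distC.
have zE : z = a + h by rewrite /h addrC subrK.
have nz : normR z < r.
  by rewrite zE; apply: le_lt_trans (normRD _ _) _; lra.
(* what the first N Taylor terms leave of c_n z^n: it vanishes for n < N, so that
   the error is bounded by the tail of a geometric series *)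
pose E n := c n * z ^+ n - \sum_(k < N) h ^+ k * (c n * 'C(n, k)%:R * a ^+ (n - k)).
have csE : csum E (f z - \sum_(k < N) d k * h ^+ k).
  apply: csumB; first exact: cf.
  have := @csum_sum N (fun k n => h ^+ k * (c n * 'C(n, k)%:R * a ^+ (n - k)))
    (fun k => d k * h ^+ k).
  by apply => k; rewrite mulrC; apply: csumM.
have EE n : E n = c n * (\sum_(0 <= k < n.+1) a ^+ (n - k) * h ^+ k * 'C(n, k)%:R -
    \sum_(0 <= k < N) a ^+ (n - k) * h ^+ k * 'C(n, k)%:R).
  rewrite /E mulrBr zE exprDn !big_mkord; congr (_ * _ - _).
    by apply: eq_bigr => i _; rewrite mulr_natr.
  by rewrite mulr_sumr; apply: eq_bigr => i _; ring.
have E0 n : (n < N)%N -> E n = 0.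
  move=> nN; rewrite EE (@big_cat_nat _ _ _ n.+1 0 N)//= opprD addrA subrr sub0r.
  rewrite big_nat big1 ?oppr0 ?mulr0// => k /andP[nk _].
  by rewrite bin_small// mulr0.
have Eb n : normR (E n) <= K * (t / s) ^+ n.
  have [nN|Nn] := ltnP n N.
    rewrite E0// normR0 mulr_ge0 ?exprn_ge0//; last by case/andP: q01.
    by apply: le_trans (hK 0%N); rewrite mulr1 normR_ge0.
  rewrite EE (@big_cat_nat _ _ _ N 0 n.+1)//=; last exact: leqW.
  rewrite addrAC subrr add0r normRM.
  have bt : normR (\sum_(N <= k < n.+1) a ^+ (n - k) * h ^+ k * 'C(n, k)%:R) <= t ^+ n.
    apply: le_trans (normR_sum _ _ _) _.
    rewrite /t exprDn -(big_mkord xpredT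
      (fun i => (normR a ^+ (n - i) * normR h ^+ i) *+ 'C(n, i))).
    rewrite [X in _ <= X](@big_cat_nat _ _ _ N)//=; last exact: leqW.
    rewrite -[X in X <= _]add0r; apply: lerD.
      by apply: sumr_ge0 => i _; rewrite mulrn_wge0// mulr_ge0 ?exprn_ge0.
    apply: ler_sum => i _; by rewrite !normRM !normRX normR_nat mulr_natr.
  apply: le_trans (ler_wpM2l (normR_ge0 _) bt) _.
  rewrite exprMn exprVn mulrA ler_pdivlMr ?exprn_gt0// mulrAC.
  by rewrite ler_wpM2r// exprn_ge0// /t addr_ge0.
have := csum_tail q01 Eb N csE; rewrite [X in _ - X]big1 ?subr0// => i _.
by rewrite E0.
Qed.

Lemma psum_analytic c f (r : R) (a : R[i]) : normR a < r ->
  (forall z, normR z < r -> psum c z (f z)) -> analytic_at f a.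
Proof.
move=> ar cf; have [d [_ df]] := recenter ar cf.
exists d, (r - normR a); split; first by rewrite subr_gt0.
by move=> z zr; apply/cvg_series_csum; exact: df.
Qed.

(** Compactness of the closed disk in the form of a Lebesgue number: a property
    with a radius that is locally uniform holds with one radius. *)
Lemma compact_uniform (rho : R) (Q : R[i] -> R -> Prop) :
  (forall a (e e' : R), 0 < e' <= e -> Q a e -> Q a e') ->
  (forall a, normR a <= rho -> exists dl : R, 0 < dl /\
     forall a', normR a' <= rho -> normR (a' - a) < dl -> Q a' dl) ->
  exists dl : R, 0 < dl /\ forall a, normR a <= rho -> Q a dl.
Proof.
move=> Qmono Qloc.
pose box : set (R * R) := `[- rho, rho]%classic `*` `[- rho, rho]%classic.
have boxK : compact box by apply: compact_setX; exact: segment_compact.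
have /compact_near_coveringP/(_ R (0%R^'+)
  (fun dl (p : R * R) => normR (Complex p.1 p.2) <= rho -> Q (Complex p.1 p.2) dl)) := boxK.
have close (p q : R * R) (e : R) : ball p e q ->
    normR (Complex q.1 q.2 - Complex p.1 p.2) < e + e.
  move=> [/=]; rewrite -!ball_normE /= => h1 h2.
  by apply: le_lt_trans (normR_ReIm _) _; rewrite /= ltrD// distrC.
case.
  move=> p _; have [le_p|lt_p] := leP (normR (Complex p.1 p.2)) rho.
    have [dl [dl0 hdl]] := Qloc _ le_p.
    exists (ball p (dl / 2), [set e | 0 < e <= dl]) => /=.
      split; first by apply: nbhsx_ballx; rewrite divr_gt0.
      exists dl => // e /=; rewrite sub0r normrN => edl e0; rewrite e0/= ltW//.
      exact: le_lt_trans (ler_norm _) edl.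
    move=> [q e] /= [/close pq e0dl] qrho; apply: Qmono e0dl _; apply: hdl => //.
    by apply: lt_le_trans pq _; rewrite -splitr.
  pose e := (normR (Complex p.1 p.2) - rho) / 2.
  exists (ball p e, setT) => /=.
    by split; [apply: nbhsx_ballx; rewrite divr_gt0// subr_gt0|exact: filterT].
  move=> [q ?] /= [/close pq _] qrho; exfalso.
  have := normRB (Complex q.1 q.2) (Complex q.1 q.2 - Complex p.1 p.2).
  rewrite opprB addrC subrK; move: pq; rewrite /e; lra.
move=> dl0 dl0_gt0 /(_ (dl0 / 2)) h.
exists (dl0 / 2); split; first by rewrite divr_gt0.
move=> [x y] arho; apply: (h _ _ (x, y)) => //=.
- by rewrite sub0r normrN gtr0_norm ?divr_gt0// ltr_pdivrMr// ltr_pMr// ltr1n.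
- by rewrite divr_gt0.
- have := le_trans (normR_Re _) arho; have := le_trans (normR_Im _) arho.
  by move=> h1 h2; split => /=; rewrite in_itv /= -ler_norml.
Qed.

(** One parameter governs both the radius and the bound, so that [good_at] is
    monotone in it. *)
Definition good_at f a (dl : R) := exists c, forall z, normR (z - a) < dl ->
  psum c (z - a) (f z) /\ normR (f z) <= dl^-1.

Lemma good_at_mono f a (e e' : R) : 0 < e' <= e -> good_at f a e -> good_at f a e'.
Proof.
move=> /andP[e0 ee] [c hc]; exists c => z ze.
have [h1 h2] := hc z (lt_le_trans ze ee); split=> //.
by apply: le_trans h2 _; rewrite lef_pV2// posrE// (lt_le_trans e0).
Qed.

(** Recentering moves a power series to all nearby points at a cost in radius. *)
Lemma good_at_nbhd f a : analytic_at f a -> exists dl : R, 0 < dl /\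
  forall a', normR (a' - a) < dl -> good_at f a' dl.
Proof.
move=> [c [r [r0 cr]]].
have cf z : normR z < r -> psum c z (f (a + z)).
  move=> zr; apply/cvg_series_csum; have := cr (a + z).
  by rewrite [a + z - a]addrAC subrr add0r; apply.
have r2 : 0 <= r / 2 < r by apply/andP; split; lra.
have [K hK] := psum_radius_bound r2 cf.
have r4 : 0 < r / 2 by lra.
pose M := K / (1 - 2^-1) + 1.
have K0 : 0 <= K by apply: le_trans (hK 0%N); rewrite mulr1 normR_ge0.
have M0 : 0 < M by rewrite /M ltr_wpDl// divr_ge0//; lra.
have fM z : normR z <= r / 4 -> normR (f (a + z)) <= M.
  move=> zr; have q : 0 <= normR z / (r / 2) <= 2^-1.
    by rewrite divr_ge0 ?normR_ge0 ?(ltW r4)//= ler_pdivrMr//; lra.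
  have [q0 q1] := andP q.
  have half : 0 <= (2^-1 : R) < 1 by apply/andP; split; lra.
  have := csum_geometric_le half _ (cf z _); rewrite /M => h.
  apply: le_trans (h K _ _) _.
  - move=> n; apply: le_trans (geometric_terms z r4 hK n) _.
    by rewrite ler_wpM2l// lerXn2r ?nnegrE//; lra.
  - by apply: le_lt_trans zr _; lra.
  - by rewrite lerDl.
pose dl := Num.min (r / 8) M^-1.
have dl0 : 0 < dl by rewrite lt_min invr_gt0 M0 divr_gt0.
have dlr : dl <= r / 8 by rewrite ge_min lexx.
have dlM : M <= dl^-1 by rewrite -[M]invrK lef_pV2 ?posrE ?invr_gt0// ge_min lexx orbT.
exists dl; split=> // a' a'a.
have a'r : normR (a' - a) < r by lra.
have [d [_ hd]] := recenter a'r cf; exists d => z za'.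
have zz : z - a' = (z - a) - (a' - a) by rewrite opprB addrA subrK.
have za : normR (z - a) < r / 4.
  by apply: le_lt_trans (normR_tri a' z a) _; lra.
have aE : a + (z - a) = z by rewrite addrC subrK.
split.
  have := hd (z - a); rewrite -zz aE; apply; by lra.
by apply: le_trans dlM; rewrite -aE; apply: fM; exact: ltW.
Qed.

(** A power series representing [f] on [|z| < rho] represents it beyond as soon
    as [f] is locally analytic with uniform radius: estimating the Taylor
    coefficients at all centres [a] by Cauchy gives
    [|c_N| C(N, k) s^(N - k) delta^k <= M], and the sum over [k] is
    [|c_N| (s + delta)^N]. *)
Lemma psum_extend c f (rho dl : R) : 0 < rho -> 0 < dl ->
  (forall z, normR z < rho -> psum c z (f z)) ->
  (forall a, normR a <= rho -> good_at f a dl) ->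
  exists2 eta : R, 0 < eta & forall z, normR z < rho + eta -> psum c z (f z).
Proof.
move=> rho0 dl0 cf fgood.
have loc a : normR a < rho -> exists d,
    [/\ forall k, csum (fun n => c n * 'C(n, k)%:R * a ^+ (n - k)) (d k),
        forall z, normR (z - a) < dl -> psum d (z - a) (f z) &
        forall k, normR (d k) * (dl / 2) ^+ k <= dl^-1].
  move=> arho; have [d [dE df]] := recenter arho cf.
  have [c' hc'] := fgood a (ltW arho).
  have shift z : (z + a) - a = z by rewrite addrK.
  pose r := Num.min dl (rho - normR a).
  have r0 : 0 < r by rewrite lt_min dl0 subr_gt0.
  have dc : d =1 c'.
    apply: (@psum_coef_unique _ _ (fun z => f (z + a)) r) => // z; rewrite lt_min => /andP[zd za].
      by have := df (z + a); rewrite shift; apply.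
    by have := hc' (z + a); rewrite shift => /(_ zd)[].
  exists d; split=> // [z /hc'[]|k]; first by rewrite -(funext dc).
  apply: (@Cauchy_estimate d (fun z => f (z + a)) dl) => [|z zd|z zd].
  - by apply/andP; split; lra.
  - by have := hc' (z + a); rewrite shift (funext dc) => /(_ zd)[].
  - by have := hc' (z + a); rewrite shift; case=> //; lra.
pose S := rho + 3 / 8 * dl; have S0 : 0 < S by rewrite /S; lra.
have cS N : normR (c N) * S ^+ N <= N.+1%:R / dl.
  pose s := rho - Num.min (rho / 2) (dl / 8).
  have m1 : Num.min (rho / 2) (dl / 8) <= rho / 2 by rewrite ge_min lexx.
  have m2 : Num.min (rho / 2) (dl / 8) <= dl / 8 by rewrite ge_min lexx orbT.
  have m0 : 0 < Num.min (rho / 2) (dl / 8) by rewrite lt_min !divr_gt0.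
  have s01 : 0 <= s < rho by rewrite /s; apply/andP; split; lra.
  have cNk k : (k <= N)%N ->
      normR (c N) * (s ^+ (N - k) * (dl / 2) ^+ k * 'C(N, k)%:R) <= dl^-1.
    move=> kN; pose g a := if pselect (normR a < rho) is left h
      then projT1 (cid (loc a h)) k else 0.
    have gE a : normR a < rho -> exists d,
       [/\ csum (fun n => c n * 'C(n, k)%:R * a ^+ (n - k)) (d k),
        normR (d k) * (dl / 2) ^+ k <= dl^-1 & g a = d k].
      move=> h; rewrite /g; case: pselect => // h'; case: cid => /= d [h1 h2 h3].
      by exists d; split.
    pose b m := c (m + k)%N * 'C(m + k, k)%:R.
    have bg a : normR a < rho -> psum b a (g a).
      move=> /gE[d [h1 _ ->]].
      have := @tendsto_sub _ _ _ _ (fun n => n + k)%N (fun n => leq_addr k n) h1.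
      apply: eq_tendsto => n; rewrite /comp.
      rewrite -(big_mkord xpredT (fun i => c i * 'C(i, k)%:R * a ^+ (i - k))).
      rewrite -(big_mkord xpredT (fun i => b i * a ^+ i)).
      rewrite (@big_cat_nat _ _ _ k)//= ?leq_addl// [X in X + _]big_nat big1 ?add0r.
        rewrite -{1}[k]add0n big_addn addnK.
        by apply: eq_bigr => i _; rewrite addnK.
      by move=> i /andP[_ ik]; rewrite bin_small// mulr0 mul0r.
    have gM a : normR a <= s -> normR (g a) <= dl^-1 / (dl / 2) ^+ k.
      have [_ srho] := andP s01.
      move=> as'; have [d [_ h ->]] := gE a (le_lt_trans as' srho).
      by rewrite ler_pdivlMr// exprn_gt0// divr_gt0.
    have := Cauchy_estimate (N - k) s01 bg gM.
    rewrite /b subnK// normRM normR_nat ler_pdivlMr ?exprn_gt0 ?divr_gt0//.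
    by apply: le_trans; rewrite le_eqVlt; apply/orP; left; apply/eqP; ring.
  have SS : S <= s + dl / 2 by rewrite /S /s; lra.
  apply: le_trans (_ : normR (c N) * (s + dl / 2) ^+ N <= _).
    by rewrite ler_wpM2l ?normR_ge0// lerXn2r ?nnegrE//; lra.
  rewrite exprDn mulr_sumr (_ : N.+1%:R / dl = \sum_(k < N.+1) dl^-1); last first.
    by rewrite sumr_const card_ord mulr_natl.
  by apply: ler_sum => k _; rewrite -mulr_natr; apply: cNk; rewrite -ltnS.
pose r1 := rho + dl / 4; have r10 : 0 < r1 by rewrite /r1; lra.
have r1S : r1 < S by rewrite /r1 /S; lra.
have [K hK] : exists K, forall n, normR (c n) * r1 ^+ n <= K.
  have q01 : 0 <= r1 / S < 1.
    by rewrite divr_ge0 ?(ltW r10) ?(ltW S0)//= ltr_pdivrMr// mul1r.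
  have /cvg_seq_bounded[M [_ /(_ (M + 1))]] : cvgn (fun n => n.+1%:R * (r1 / S) ^+ n).
    by apply/cvg_ex; exists 0; exact: cvg_nat_geometric.
  rewrite ltrDl ltr01 => /(_ isT) hM; exists ((M + 1) / dl) => n.
  have -> : normR (c n) * r1 ^+ n = normR (c n) * S ^+ n * (r1 / S) ^+ n.
    by rewrite -mulrA -exprMn mulrCA divff ?mulr1// gt_eqF.
  have [q0 q1] := andP q01.
  apply: le_trans (ler_wpM2r (exprn_ge0 n q0) (cS n)) _.
  rewrite mulrAC ler_pM2r ?invr_gt0//; apply: le_trans (ler_norm _) _.
  exact: hM.
have [g cg] : exists g, forall z, normR z < r1 -> psum c z (g z).
  have ex z : exists l, normR z < r1 -> psum c z l.
    have [h|h] := pselect (normR z < r1); last by exists 0.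
    by have [l hl] := psum_exists hK h; exists l.
  by exists (fun z => projT1 (cid (ex z))) => z; case: cid => /=.
exists (dl / 8); first by rewrite divr_gt0.
move=> z zrho; have zr1 : normR z < r1 by rewrite /r1; lra.
have [?|rz] := ltP (normR z) rho; first exact: cf.
pose sg := Num.min (rho / 2) (dl / 16).
have m1 : sg <= rho / 2 by rewrite ge_min lexx.
have m2 : sg <= dl / 16 by rewrite ge_min lexx orbT.
have m0 : 0 < sg by rewrite lt_min !divr_gt0.
have z0 : 0 < normR z by lra.
pose a := ((rho - sg) / normR z)%:C * z.
have na : normR a = rho - sg.
  rewrite /a normRM normR_real ger0_norm; last by rewrite divr_ge0// ?ltW//; lra.
  by rewrite divfK// gt_eqF.
have nza : normR (z - a) = normR z - (rho - sg).
  have -> : z - a = (1 - (rho - sg) / normR z)%:C * z.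
    by rewrite rmorphB rmorph1 mulrBl mul1r.
  rewrite normRM normR_real ger0_norm.
    by rewrite [LHS]mulrBl mul1r divfK// gt_eqF.
  by rewrite subr_ge0 ler_pdivrMr// mul1r; lra.
have arho : normR a < rho by rewrite na; lra.
have [d [dE df _]] := loc a arho.
have ar1 : normR a < r1 by rewrite na /r1; lra.
have [d' [dE' dg]] := recenter ar1 cg.
have dd : d = d' by apply/funext => k; apply: csum_unique (dE k) (dE' k).
have fz : psum d (z - a) (f z) by apply: df; rewrite nza; lra.
have gz : psum d (z - a) (g z) by rewrite dd; apply: dg; rewrite nza na /r1; lra.
by rewrite (csum_unique fz gz); exact: cg.
Qed.

(** By [psum_extend] and compactness, the supremum of the radii at most 1 on
    which the Taylor series at 0 represents [f] cannot be smaller than 1. *)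
Lemma analytic_disk_psum f : (forall a, open_disk a -> analytic_at f a) ->
  exists c, forall z, normR z < 1 -> psum c z (f z).
Proof.
move=> fan; have [|c [r [r0 cr]]] := fan 0; first by rewrite /open_disk /= normR0.
have {}cr z : normR z < r -> psum c z (f z).
  by move=> zr; apply/cvg_series_csum; have := cr z; rewrite subr0; apply.
exists c; pose S := [set t : R | t <= 1 /\ forall z, normR z < t -> psum c z (f z)].
have S1 : ubound S 1 by move=> t [].
have Sr : S (Num.min r 1).
  split; first by rewrite ge_min lexx orbT.
  by move=> z; rewrite lt_min => /andP[/cr].
have hsup : has_sup S by split; [exists (Num.min r 1)|exists 1].
have rho0 : 0 < sup S.
  apply: lt_le_trans (_ : Num.min r 1 <= _); first by rewrite lt_min r0 ltr01.
  exact: sup_upper_bound.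
have cS z : normR z < sup S -> psum c z (f z).
  rewrite -subr_gt0 => /sup_adherent/(_ hsup)[t [_ h]].
  by rewrite subKr; exact: h.
suff S1le : 1 <= sup S by move=> z z1; apply: cS; exact: lt_le_trans z1 S1le.
rewrite leNgt; apply/negP => S1lt.
have [dl [dl0 hdl]] := @compact_uniform (sup S) (good_at f) (@good_at_mono f)
  (fun a ha => let: ex_intro dl (conj dl0 h) :=
     good_at_nbhd (fan a (le_lt_trans ha S1lt)) in
     ex_intro _ dl (conj dl0 (fun a' _ => h a'))).
have [eta eta0 h] := psum_extend rho0 dl0 cS hdl.
have : S (Num.min 1 (sup S + eta)).
  split; first by rewrite ge_min lexx.
  by move=> z; rewrite lt_min => /andP[_ /h].
move=> /(sup_upper_bound hsup); rewrite leNgt => /negP; apply.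
by rewrite lt_min S1lt ltrDl eta0.
Qed.

Lemma triangle_sum (F : nat -> nat -> R[i]) N :
  \sum_(n < N) \sum_(k < n.+1) F k (n - k)%N = \sum_(k < N) \sum_(l < N - k) F k l.
Proof.
elim: N => [|N ih]; first by rewrite !big_ord0.
rewrite big_ord_recr /= ih [RHS]big_ord_recr /=.
rewrite [\sum_(k < N.+1) F k _]big_ord_recr /= addrA; congr (_ + _).
  rewrite -big_split; apply: eq_bigr => k _ /=.
  by rewrite subSn ?big_ord_recr//= ltnW.
by rewrite subSn// subnn big_ord1.
Qed.

(** The partial sums of the product series differ from the products of partial
    sums by the pairs [k, l < N] with [k + l >= N], whose total is [O(N q^N)]. *)
Lemma Cauchy_product b c (f g : R[i] -> R[i]) (r : R) z : normR z < r ->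
  (forall z, normR z < r -> psum b z (f z)) ->
  (forall z, normR z < r -> psum c z (g z)) ->
  psum (mul_series b c) z (f z * g z).
Proof.
move=> zr bf cg; pose s := (normR z + r) / 2.
have s0 : 0 < s by have := normR_ge0 z; rewrite /s; lra.
have zs : normR z < s by rewrite /s; lra.
have sr : 0 <= s < r by rewrite (ltW s0) /s; lra.
have [K hK] := psum_radius_bound sr bf; have [K' hK'] := psum_radius_bound sr cg.
have q01 := ratio_in01 zs; have [q0 q1] := andP q01.
have := geometric_terms z s0 hK; have := geometric_terms z s0 hK'.
set q := normR z / s in q01 q0 q1 * => hc hb.
pose D N := \sum_(k < N) \sum_(N - k <= l < N) (b k * z ^+ k) * (c l * z ^+ l).
have D0 : tendsto D 0.
  have h : (fun N => K * K' / (1 - q) * (N.+1%:R * q ^+ N)) @ \oo --> (0 : R).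
    rewrite -[X in _ --> X](mulr0 (K * K' / (1 - q))); apply: cvgM; first exact: cvg_cst.
    exact: cvg_nat_geometric.
  apply: tendsto_squeeze h => N; rewrite subr0.
  have K0 : 0 <= K by apply: le_trans (hK 0%N); rewrite mulr1 normR_ge0.
  have K0' : 0 <= K' by apply: le_trans (hK' 0%N); rewrite mulr1 normR_ge0.
  have q1' : 0 < 1 - q by rewrite subr_gt0.
  apply: le_trans (_ : \sum_(k < N) K * K' / (1 - q) * q ^+ N <= _); last first.
    rewrite sumr_const card_ord -[leLHS]mulr_natl [leLHS]mulrCA; apply: ler_wpM2l.
      by rewrite divr_ge0// ?mulr_ge0// ltW.
    by rewrite ler_wpM2r ?exprn_ge0// ler_nat.
  apply: le_trans (normR_sum _ _ _) _; apply: ler_sum => k _.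
  rewrite -mulr_sumr normRM.
  have hl : normR (\sum_(N - k <= l < N) c l * z ^+ l) <= K' * (q ^+ (N - k) / (1 - q)).
    apply: le_trans (normR_sum _ _ _) _.
    apply: le_trans (ler_sum _ (fun n _ => hc n)) _.
    by rewrite -mulr_sumr; apply: ler_wpM2l => //; exact: geometric_partial_le.
  apply: le_trans (ler_pM (normR_ge0 _) (normR_ge0 _) (hb k) hl) _.
  have -> : q ^+ N = q ^+ k * q ^+ (N - k) by rewrite -exprD subnKC// ltnW.
  by rewrite le_eqVlt; apply/orP; left; apply/eqP; ring.
have := tendstoB (tendstoM (bf z zr) (cg z zr)) D0; rewrite subr0.
apply: eq_tendsto => N; rewrite big_distrlr /D /=.
transitivity (\sum_(k < N) \sum_(l < N - k) (b k * z ^+ k) * (c l * z ^+ l)).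
  rewrite -sumrB; apply: eq_bigr => k _.
  rewrite -!(big_mkord xpredT (fun l => (b k * z ^+ k) * (c l * z ^+ l))).
  by rewrite (@big_cat_nat _ _ _ (N - k) 0 N)//= ?leq_subr// addrK.
rewrite -(triangle_sum (fun k l => (b k * z ^+ k) * (c l * z ^+ l))).
apply: eq_bigr => n _; rewrite /mul_series mulr_suml; apply: eq_bigr => k _.
have -> : z ^+ n = z ^+ k * z ^+ (n - k) by rewrite -exprD subnKC// -ltnS.
by ring.
Qed.

(** The dilate [f(r z)] lives on the disk of radius [r < 1], where the partial
    sums converge uniformly. *)
Lemma dilation_approx b f (r eps : R) : 0 <= r < 1 -> 0 < eps ->
  (forall z, normR z < 1 -> psum b z (f z)) ->
  exists L0, forall L, (L0 <= L)%N -> forall z, normR z <= 1 ->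
    normR (f (r%:C * z) - \sum_(k < L) b k * r%:C ^+ k * z ^+ k) <= eps.
Proof.
move=> /andP[r0 r1] eps0 bf; pose s := (1 + r) / 2.
have s0 : 0 < s by rewrite /s; lra.
have [K hK] : exists K, forall n, normR (b n) * s ^+ n <= K.
  by apply: psum_radius_bound bf; rewrite /s; apply/andP; split; lra.
have K0 : 0 <= K by apply: le_trans (hK 0%N); rewrite mulr1 normR_ge0.
have q01 : 0 <= r / s < 1.
  by rewrite divr_ge0 ?(ltW s0)//= ltr_pdivrMr// mul1r /s; lra.
move/cvgrPdist_lt/(_ _ eps0) : (@cvg_geometric_tail K _ q01) => [L0 _ hL0].
exists L0 => L L0L z z1.
have /(le_lt_trans (ler_norm _))/ltW : `|K * (r / s) ^+ L / (1 - r / s)| < eps.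
  by have := hL0 L L0L; rewrite /= sub0r normrN.
apply: le_trans.
have nrz : normR (r%:C * z) <= r.
  by rewrite normRM normR_real ger0_norm// ler_piMr.
have -> : \sum_(k < L) b k * r%:C ^+ k * z ^+ k = \sum_(k < L) b k * (r%:C * z) ^+ k.
  by apply: eq_bigr => k _; rewrite exprMn mulrA.
have fz : psum b (r%:C * z) (f (r%:C * z)) by apply: bf; exact: le_lt_trans nrz r1.
apply: (csum_tail q01 _ _ fz) => n.
apply: le_trans (geometric_terms (r%:C * z) s0 hK n) _.
rewrite ler_wpM2l//; have s0' := ltW s0.
apply: lerXn2r; rewrite ?nnegrE; first by rewrite divr_ge0 ?normR_ge0.
  by rewrite divr_ge0.
by rewrite ler_pM2r ?invr_gt0.
Qed.

End power_series.

(** * Coordinates in a Hilbert space *)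

Section Hilbert.
Context {R : realType} {H : completeNormedModType R[i]}.
Variable ip : {dot H for Num.conj}.
Hypothesis normE : forall x : H, `|x| ^+ 2 = ip x x.
Local Open Scope complex_scope.
Implicit Types (x y z : H) (t : R[i]) (a : nat -> R[i]).

Lemma ipDl x y z : ip (x + y) z = ip x z + ip y z.
Proof. exact: linearDl. Qed.

Lemma ipZl t x y : ip (t *: x) y = t * ip x y.
Proof. exact: linearZl_LR. Qed.

Lemma ipC x y : ip x y = Num.conj (ip y x).
Proof. by rewrite hermC /= expr0 mul1r. Qed.

Lemma ipDr x y z : ip x (y + z) = ip x y + ip x z.
Proof. by rewrite ipC ipDl rmorphD /= -!ipC. Qed.

Lemma ipZr t x y : ip x (t *: y) = Num.conj t * ip x y.
Proof. by rewrite ipC ipZl rmorphM /= -ipC. Qed.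

Lemma ip0l x : ip 0 x = 0.
Proof. by rewrite -(scale0r x) ipZl mul0r. Qed.

Lemma ip0r x : ip x 0 = 0.
Proof. by rewrite ipC ip0l rmorph0. Qed.

Lemma ipNl x y : ip (- x) y = - ip x y.
Proof. by rewrite -scaleN1r ipZl mulN1r. Qed.

Lemma ipBl x y z : ip (x - y) z = ip x z - ip y z.
Proof. by rewrite ipDl ipNl. Qed.

Lemma ipBr x y z : ip x (y - z) = ip x y - ip x z.
Proof. by rewrite ipC ipBl rmorphB /= -!ipC. Qed.

Lemma ip_suml (I : Type) (r : seq I) (Q : pred I) (F : I -> H) y :
  ip (\sum_(i <- r | Q i) F i) y = \sum_(i <- r | Q i) ip (F i) y.
Proof.
elim/big_rec2: _ => [|i u v _ <-]; first exact: ip0l.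
by rewrite ipDl.
Qed.

Lemma ip_sumr (I : Type) (r : seq I) (Q : pred I) (F : I -> H) y :
  ip y (\sum_(i <- r | Q i) F i) = \sum_(i <- r | Q i) ip y (F i).
Proof.
elim/big_rec2: _ => [|i u v _ <-]; first exact: ip0r.
by rewrite ipDr.
Qed.

Lemma ip_self x : ip x x = (normR x ^+ 2)%:C.
Proof. by rewrite -normE normR_def rmorphXn. Qed.

Lemma normR_ip x : normR x ^+ 2 = complex.Re (ip x x).
Proof. by rewrite ip_self. Qed.

Lemma Cauchy_Schwarz x y : normR (ip x y) <= normR x * normR y.
Proof.
have [->|y0] := eqVneq y 0; first by rewrite ip0r !normR0 mulr0.
have ny : 0 < normR y by rewrite lt_neqAle normR_ge0 andbT eq_sym normR_eq0.
have ny2 : 0 < normR y ^+ 2 by rewrite exprn_gt0.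
pose t := ip x y * ((normR y ^+ 2)^-1)%:C.
have tE : Num.conj t = Num.conj (ip x y) * ((normR y ^+ 2)^-1)%:C.
  by rewrite rmorphM /= conj_real.
have : (normR (x - t *: y) ^+ 2)%:C =
    (normR x ^+ 2 - normR (ip x y) ^+ 2 / normR y ^+ 2)%:C.
  rewrite -ip_self ipBl !ipBr ipZl !ipZr ipZl !ip_self (ipC y x) tE /t.
  have e1 : ((normR y ^+ 2)^-1)%:C * (normR y ^+ 2)%:C = 1 :> R[i].
    by rewrite -rmorphM mulVf ?gt_eqF// rmorph1.
  have e2 : (normR (ip x y) ^+ 2 / normR y ^+ 2)%:C =
      ip x y * Num.conj (ip x y) * ((normR y ^+ 2)^-1)%:C :> R[i].
    by rewrite rmorphM conjM_normR.
  by rewrite rmorphB /= e2 -(mulrA (ip x y) _ (normR y ^+ 2)%:C) e1 mulr1; ring.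
move=> /complexI h; have := sqr_ge0 (normR (x - t *: y)).
rewrite h subr_ge0 ler_pdivrMr// -exprMn ler_sqr// nnegrE ?normR_ge0//.
by rewrite mulr_ge0 ?normR_ge0.
Qed.

Lemma tendsto_ipl (u : nat -> H) x y : tendsto u x -> tendsto (fun n => ip (u n) y) (ip x y).
Proof.
move=> ux eps eps0; have y0 : 0 < normR y + 1 by rewrite ltr_wpDl ?normR_ge0.
have [N hN] := ux _ (divr_gt0 eps0 y0); exists N => n /hN h.
rewrite -ipBl; apply: le_lt_trans (Cauchy_Schwarz _ _) _.
apply: le_lt_trans (_ : normR (u n - x) * (normR y + 1) < _).
  by rewrite ler_wpM2l ?normR_ge0// lerDl.
by rewrite -ltr_pdivlMr.
Qed.

Section basis.
Variable e : nat -> H.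
Hypothesis eONB : orthonormal_basis ip e.

Definition coord x n : R[i] := ip x (e n).
Local Notation co := coord.

Lemma ip_basis m n : ip (e m) (e n) = (m == n)%:R.
Proof. by have [h _] := eONB. Qed.

Lemma co_basis m n : co (e m) n = (m == n)%:R.
Proof. exact: ip_basis. Qed.

Lemma coD x y n : co (x + y) n = co x n + co y n.
Proof. exact: ipDl. Qed.

Lemma coZ t x n : co (t *: x) n = t * co x n.
Proof. exact: ipZl. Qed.

Lemma coB x y n : co (x - y) n = co x n - co y n.
Proof. exact: ipBl. Qed.

Definition comb N a : H := \sum_(n < N) a n *: e n.

Lemma co_comb N a m : co (comb N a) m = if (m < N)%N then a m else 0.
Proof.
rewrite /co ip_suml; case: ifPn => [mN|].
  rewrite (bigD1 (Ordinal mN))//= ipZl ip_basis eqxx mulr1 big1 ?addr0//.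
  by move=> i; rewrite -(inj_eq val_inj)/= ipZl ip_basis => /negbTE ->; rewrite mulr0.
rewrite -leqNgt => Nm; apply: big1 => i _; rewrite ipZl ip_basis.
by rewrite (_ : (_ == _) = false) ?mulr0// ltn_eqF// (leq_trans (ltn_ord i)).
Qed.

Lemma expansion x : tendsto (fun N => comb N (co x)) x.
Proof.
have [_ h] := eONB; have /cvg_tendsto := h x; apply: eq_tendsto => N.
by rewrite /series /= big_mkord.
Qed.

Lemma ip_expansion x y : csum (fun n => co x n * Num.conj (co y n)) (ip x y).
Proof.
apply: eq_tendsto (tendsto_ipl y (expansion x)) => N.
by rewrite ip_suml; apply: eq_bigr => n _; rewrite ipZl (ipC (e n)).
Qed.

Lemma co_inj x y : (forall n, co x n = co y n) -> x = y.
Proof.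
move=> xy; apply: tendsto_unique (expansion x) _.
by rewrite (funext xy); exact: expansion.
Qed.

Lemma Parseval x : (fun N => nsq N (co x)) @ \oo --> normR x ^+ 2.
Proof.
apply/tendsto_real; rewrite -ip_self; apply: eq_tendsto (ip_expansion x x) => N.
by rewrite rmorph_sum; apply: eq_bigr => n _; rewrite conjM_normR.
Qed.

Lemma nsq_nondecreasing a : nondecreasing_seq (fun N => nsq N a).
Proof.
apply/nondecreasing_seqP => N; rewrite /nsq big_ord_recr /= lerDl.
exact: sqr_ge0.
Qed.

Lemma Bessel x N : nsq N (co x) <= normR x ^+ 2.
Proof.
have h := @Parseval x; rewrite -(cvg_lim (@Rhausdorff R) h).
apply: nondecreasing_cvgn_le; first exact: nsq_nondecreasing.
by apply/cvg_ex; exists (normR x ^+ 2).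
Qed.

Lemma normR_co x n : normR (co x n) <= normR x.
Proof.
have := Cauchy_Schwarz x (e n); have : normR (e n) ^+ 2 = 1.
  by rewrite normR_ip ip_basis eqxx.
move=> /eqP; rewrite sqrp_eq1 ?normR_ge0// => /eqP ->.
by rewrite mulr1.
Qed.

Lemma normR_basis n : normR (e n) = 1.
Proof.
have : normR (e n) ^+ 2 = 1 by rewrite normR_ip ip_basis eqxx.
by move=> /eqP; rewrite sqrp_eq1 ?normR_ge0// => /eqP.
Qed.

Lemma normR_sqr_le x (M : R) : (forall N, nsq N (co x) <= M) -> normR x ^+ 2 <= M.
Proof.
move=> h; have hx := @Parseval x; rewrite -(cvg_lim (@Rhausdorff R) hx).
apply: limr_le; first by apply/cvg_ex; exists (normR x ^+ 2).
by near=> n; exact: h.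
Unshelve. all: by end_near. Qed.

Lemma normR_comb N a : normR (comb N a) ^+ 2 = nsq N a.
Proof.
rewrite normR_ip {2}/comb ip_sumr.
rewrite (eq_bigr (fun n : 'I_N => (normR (a n) ^+ 2)%:C)); last first.
  by move=> n _; rewrite ipZr -/(co _ _) co_comb ltn_ord mulrC conjM_normR.
by rewrite -rmorph_sum.
Qed.

Lemma nsq_split M N a : (N <= M)%N ->
  nsq M (fun n => if (n < N)%N then 0 else a n) = nsq M a - nsq N a.
Proof.
move=> NM; rewrite /nsq -(big_mkord xpredT (fun i => normR (a i) ^+ 2)).
rewrite -(big_mkord xpredT (fun i => normR (a i) ^+ 2)).
rewrite -(big_mkord xpredT (fun i => normR (if (i < N)%N then 0 else a i) ^+ 2)).
rewrite !(@big_cat_nat _ _ _ N 0 M)//= [X in _ = X - _]addrC addrK.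
rewrite big_nat big1 ?add0r => [|i /andP[_ ->]]; last by rewrite normR0 expr0n.
by apply: eq_big_nat => i /andP[Ni _]; rewrite ltnNge Ni.
Qed.

Lemma Riesz_Fischer a (M : R) : (forall N, nsq N a <= M) ->
  exists x, forall n, co x n = a n.
Proof.
move=> aM; have nd := nsq_nondecreasing a.
have cv : cvgn (fun N => nsq N a).
  by apply: nondecreasing_is_cvgn => //; exists M => _ [N _ <-].
have [l hl] : exists l : R, (fun N => nsq N a) @ \oo --> l.
  by exists (limn (fun N => nsq N a)).
have ub N : nsq N a <= l.
  by rewrite -(cvg_lim (@Rhausdorff R) hl); exact: nondecreasing_cvgn_le.
have [x hx] : exists x, tendsto (fun N => comb N a) x.
  apply: Cauchy_tendsto_complete => eps eps0.
  have e2 : 0 < (eps / 2) ^+ 2 by rewrite exprn_gt0// divr_gt0.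
  move/cvgrPdist_lt/(_ _ e2) : hl => [N _ hN]; exists N.
  suff h m : (N <= m)%N -> normR (comb m a - comb N a) < eps / 2.
    move=> m n Nm Nn; apply: le_lt_trans (normR_tri (comb N a) _ _) _.
    by rewrite (splitr eps) ltrD ?h// normR_distC h.
  move=> Nm; rewrite -(@ltr_pXn2r _ 2)// ?nnegrE ?normR_ge0 ?divr_ge0 ?(ltW eps0)//.
  have -> : comb m a - comb N a = comb m (fun n => if (n < N)%N then 0 else a n).
    apply: co_inj => n; rewrite coB !co_comb.
    have [nN|Nn] := ltnP n N; first by rewrite (leq_trans nN Nm) subrr.
    by rewrite subr0.
  rewrite normR_comb nsq_split//; apply: le_lt_trans (hN N (leqnn N)).
  by rewrite /= ger0_norm ?subr_ge0// lerD2r.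
exists x => n; apply: tendsto_unique (tendsto_ipl (e n) hx) _.
move=> eps eps0; exists n.+1 => N nN.
by rewrite -/(co _ _) co_comb nN subrr normR0.
Qed.

(** ** Bounded operators *)

Implicit Types (A B : H -> H).

Lemma linearD_op A x y : linear A -> A (x + y) = A x + A y.
Proof. by move=> h; have := h 1 x y; rewrite !scale1r. Qed.

Lemma linear0_op A : linear A -> A 0 = 0.
Proof. by move=> h; have := h (-1) 0 0; rewrite !scaleN1r oppr0 addr0 addNr. Qed.

Lemma linearZ_op A t x : linear A -> A (t *: x) = t *: A x.
Proof. by move=> h; have := h t x 0; rewrite (linear0_op h) !addr0. Qed.

Lemma linearB_op A x y : linear A -> A (x - y) = A x - A y.
Proof. by move=> h; rewrite linearD_op// -scaleN1r linearZ_op// scaleN1r. Qed.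

Lemma linear_sum_op A (I : Type) (r : seq I) (Q : pred I) (F : I -> H) : linear A ->
  A (\sum_(i <- r | Q i) F i) = \sum_(i <- r | Q i) A (F i).
Proof.
move=> h; elim/big_rec2: _ => [|i u v _ <-]; first exact: linear0_op.
by rewrite linearD_op.
Qed.

Lemma linear_comb_op A N a : linear A -> A (comb N a) = \sum_(n < N) a n *: A (e n).
Proof.
by move=> h; rewrite linear_sum_op//; apply: eq_bigr => n _; rewrite linearZ_op.
Qed.

Lemma bounded_bound A : bounded_operator A ->
  exists2 M : R, 0 <= M & forall x, normR (A x) <= M * normR x.
Proof.
move=> [_ [M hM]]; exists (Num.max M 0); first by rewrite le_max lexx orbT.
by move=> x; apply: le_trans (hM x) _; rewrite ler_wpM2r ?normR_ge0// le_max lexx.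
Qed.

Lemma tendsto_op A (u : nat -> H) x : bounded_operator A -> tendsto u x ->
  tendsto (fun n => A (u n)) (A x).
Proof.
move=> Ab; have [M M0 hM] := bounded_bound Ab; case: Ab => Al _.
move=> ux eps eps0; have M1 : 0 < M + 1 by rewrite ltr_wpDl.
have [N hN] := ux _ (divr_gt0 eps0 M1); exists N => n /hN h.
rewrite -linearB_op//; apply: le_lt_trans (hM _) _.
apply: le_lt_trans (_ : (M + 1) * normR (u n - x) < _).
  by rewrite ler_wpM2r ?normR_ge0// lerDl.
by rewrite mulrC -ltr_pdivlMr.
Qed.

Definition opset A := [set normR (A x) | x in [set x : H | normR x <= 1]].

Lemma opset_has_sup A : bounded_operator A -> has_sup (opset A).
Proof.
move=> Ab; split.
  by exists (normR (A 0)), 0 => //=; rewrite normR0.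
have [M M0 hM] := bounded_bound Ab; exists M => _ [x /= x1 <-].
by apply: le_trans (hM x) _; rewrite ler_piMr.
Qed.

Lemma operator_norm_ub A x : bounded_operator A ->
  normR (A x) <= operator_norm A * normR x.
Proof.
move=> Ab; have [Al _] := Ab.
have [->|x0] := eqVneq x 0; first by rewrite linear0_op// !normR0 mulr0.
have nx : 0 < normR x by rewrite lt_neqAle normR_ge0 andbT eq_sym normR_eq0.
rewrite -ler_pdivrMr//.
have -> : normR (A x) / normR x = normR (A ((normR x)^-1%:C *: x)).
  by rewrite linearZ_op// normRZ normR_real ger0_norm ?invr_ge0 ?normR_ge0// mulrC.
apply: (sup_upper_bound (opset_has_sup Ab)).
exists ((normR x)^-1%:C *: x) => //=.
by rewrite normRZ normR_real ger0_norm ?invr_ge0 ?normR_ge0// mulVf// gt_eqF.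
Qed.

Lemma operator_norm_le A (M : R) : 0 <= M ->
  (forall x, normR (A x) <= M * normR x) -> operator_norm A <= M.
Proof.
move=> M0 hM; apply: ge_sup.
  by exists (normR (A 0)), 0 => //=; rewrite normR0.
by move=> _ [x /= x1 <-]; apply: le_trans (hM x) _; rewrite ler_piMr.
Qed.

Lemma bounded_lin t A B : bounded_operator A -> bounded_operator B ->
  bounded_operator (t *: A + B).
Proof.
move=> Ab Bb; have [M M0 hM] := bounded_bound Ab; have [N N0 hN] := bounded_bound Bb.
case: Ab Bb => [Al _] [Bl _]; split.
  move=> s x y; rewrite !fctE Al Bl; rewrite !scalerDr !scalerA.
  by rewrite [t * s]mulrC addrACA.
exists (normR t * M + N) => x; rewrite !fctE.
apply: le_trans (normRD _ _) _; rewrite normRZ mulrDl -mulrA.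
by apply: lerD => //; rewrite ler_wpM2l ?normR_ge0.
Qed.

Lemma bounded_comp A B : bounded_operator A -> bounded_operator B ->
  bounded_operator (A \o B).
Proof.
move=> Ab Bb; have [M M0 hM] := bounded_bound Ab; have [N N0 hN] := bounded_bound Bb.
case: Ab Bb => [Al _] [Bl _]; split; first by move=> s x y /=; rewrite Bl Al.
exists (M * N) => x /=; apply: le_trans (hM _) _.
by rewrite -mulrA ler_wpM2l.
Qed.

Lemma bounded_id : bounded_operator (id : H -> H).
Proof. by split=> //; exists 1 => x; rewrite mul1r. Qed.

Lemma bounded_iter A k : bounded_operator A -> bounded_operator (iter k A).
Proof.
move=> Ab; elim: k => [|k ih]; first exact: bounded_id.
exact: (bounded_comp Ab ih).
Qed.

Lemma bounded0 : bounded_operator (fun _ => 0 : H).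
Proof.
split; first by move=> s x y; rewrite scaler0 addr0.
by exists 0 => x; rewrite normR0 mul0r.
Qed.

Lemma bounded_sub A B : bounded_operator A -> bounded_operator B ->
  bounded_operator (A - B).
Proof.
move=> Ab Bb; have := bounded_lin (-1) Bb Ab.
by rewrite (_ : -1 *: B + A = A - B)// scaleN1r addrC.
Qed.

Lemma bounded_poly_op A p : bounded_operator A -> bounded_operator (poly_op A p).
Proof.
move=> Ab; rewrite /poly_op.
elim: (size p) => [|n ih].
  rewrite (_ : (fun x : H => _) = (fun _ => 0)); first exact: bounded0.
  by apply/funext => x; rewrite big_ord0.
rewrite (_ : (fun x : H => _) =
    p`_n *: iter n A + (fun x => \sum_(k < n) p`_k *: iter k A x)).
  exact: bounded_lin (bounded_iter n Ab) ih.
by apply/funext => x; rewrite big_ord_recr /= addrC.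
Qed.

Lemma co_op_expansion A x m : bounded_operator A ->
  csum (fun n => co x n * co (A (e n)) m) (co (A x) m).
Proof.
move=> Ab; have := tendsto_ipl (e m) (tendsto_op Ab (expansion x)).
case: Ab => Al _; apply: eq_tendsto => N.
by rewrite linear_comb_op// ip_suml; apply: eq_bigr => n _; rewrite ipZl.
Qed.

End basis.

End Hilbert.

(** * Operators with a power series symbol *)

Section analytic_Toeplitz.
Context {R : realType}.
Local Open Scope complex_scope.
Implicit Types (w : nat -> R) (b x y : nat -> R[i]) (f : R[i] -> R[i]).

Definition radius (j : nat) : R := 1 - j.+1%:R^-1.

Lemma radius01 j : 0 <= radius j < 1.
Proof.
rewrite /radius subr_ge0 invf_le1 ?ltr0n// ler1n /= ltrBlDr ltrDl invr_gt0.
by rewrite ltr0n.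
Qed.

Lemma tendsto_radius : tendsto (fun j => (radius j)%:C) (1 : R[i]).
Proof.
rewrite (_ : (1 : R[i]) = 1%:C)//; apply/tendsto_real.
rewrite -[X in _ --> X]subr0; apply: cvgB; first exact: cvg_cst.
exact: cvg_harmonic.
Qed.

Lemma tendsto_radiusX k : tendsto (fun j => (radius j)%:C ^+ k) (1 : R[i]).
Proof.
elim: k => [|k ih]; first exact: tendsto_cst.
have := tendstoM tendsto_radius ih; rewrite mulr1; apply: eq_tendsto => j.
by rewrite exprS.
Qed.

(** The bound passes from the dilates [f(r z)], which are uniform limits of
    polynomials on the closed disk, to [f]. *)
Lemma Toeplitz_analytic_le N b f w x y (C : R) :
    (forall i, `|w i| <= 1) ->
    (forall z, normR z < 1 -> psum b z (f z)) ->
    (forall z, normR z < 1 -> normR (f z) <= C) ->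
  normR (Toeplitz b w N x y) *+ 2 <= C * (nsq N x + nsq N y).
Proof.
move=> w1 bf fC; set M := nsq N x + nsq N y.
have M0 : 0 <= M by rewrite addr_ge0 ?nsq_ge0.
have dil r : 0 <= r < 1 ->
    normR (Toeplitz (fun k => b k * r%:C ^+ k) w N x y) *+ 2 <= C * M.
  move=> r01; apply/ler_addgt0Pl => eps eps0.
  have M1 : 0 < M + 1 by rewrite ltr_wpDl.
  have d0 : 0 < eps / (M + 1) by rewrite divr_gt0.
  have [L0 hL0] := dilation_approx r01 d0 bf.
  pose L := maxn L0 N.
  pose b' k := if (k < L)%N then b k * r%:C ^+ k else 0.
  have -> : Toeplitz (fun k => b k * r%:C ^+ k) w N x y = Toeplitz b' w N x y.
    apply: eq_bigr => m _; congr (_ * _); apply: eq_bigr => n _; congr (_ * _ * _).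
    rewrite /b' ifT//; apply: leq_ltn_trans (leq_subr _ _) _.
    by rewrite (leq_trans (ltn_ord m))// leq_maxr.
  apply: le_trans (@Toeplitz_le _ L _ _ _ _ _ (C + eps / (M + 1)) _ _ w1) _.
  - by move=> k Lk; rewrite /b' ltnNge Lk.
  - move=> z z1; have z1' : normR z <= 1 by rewrite z1.
    have -> : \sum_(k < L) b' k * z ^+ k = \sum_(k < L) b k * r%:C ^+ k * z ^+ k.
      by apply: eq_bigr => k _; rewrite /b' ltn_ord.
    set S := \sum_(k < L) _.
    have -> : S = f (r%:C * z) - (f (r%:C * z) - S) by rewrite opprB addrC subrK.
    apply: le_trans (normRB _ _) _; apply: lerD; last by apply: hL0 => //; rewrite leq_maxl.
    apply: fC; rewrite normRM normR_real z1 mulr1.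
    by case/andP: r01 => ? ?; rewrite ger0_norm.
  - rewrite mulrDl addrC lerD2r mulrAC ler_pdivrMr// ler_pM2l//.
    by rewrite lerDl.
have -> : normR (Toeplitz b w N x y) *+ 2 = normR (Toeplitz b w N x y) * 2.
  by rewrite mulr_natr.
rewrite -ler_pdivlMr//.
apply: (@tendsto_normR_le _ _ (fun j => Toeplitz (fun k => b k * (radius j)%:C ^+ k) w N x y) _ _ 0).
  rewrite /Toeplitz; apply: tendsto_sum => m _.
  rewrite mulrC; apply: eq_tendsto (tendstoMl _ _) => [j|]; first by rewrite mulrC.
  apply: tendsto_sum => n _.
  have := tendstoMl (b (m - n)%N * (wprod w n m)%:C * x n) (tendsto_radiusX (m - n)).
  by rewrite mulr1; apply: eq_tendsto => j; ring.
by move=> j _; rewrite ler_pdivlMr// mulr_natr; apply/dil/radius01.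
Qed.

End analytic_Toeplitz.

Lemma sum_nat_shift (V : nmodType) a N (F : nat -> V) :
  \sum_(a <= i < a + N) F i = \sum_(i < N) F (i + a)%N.
Proof. by rewrite -{1}[a]add0n [(a + N)%N]addnC big_addn addnK big_mkord. Qed.

Section symbols.
Context {R : realType} {H : completeNormedModType R[i]}.
Variable ip : {dot H for Num.conj}.
Hypothesis normE : forall x : H, `|x| ^+ 2 = ip x x.
Variable e : nat -> H.
Hypothesis eONB : orthonormal_basis ip e.
Variable w : nat -> R.
Local Open Scope complex_scope.
Local Notation co := (coord ip e).
Local Notation comb := (comb e).
Implicit Types (A B T : H -> H) (b c : nat -> R[i]).

(** [A] acts as the formal power series [sum_k b_k T^k] in the shift [T] of
    weights [w].  The series is evaluated coordinatewise, where it is a finite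
    sum, so no convergence is presupposed. *)
Definition symbol A b := bounded_operator A /\ forall x m,
  co (A x) m = \sum_(n < m.+1) b (m - n)%N * (wprod w n m)%:C * co x n.

Definition entry b n m : R[i] :=
  if (n <= m)%N then b (m - n)%N * (wprod w n m)%:C else 0.

Lemma symbol_entry A b n m : symbol A b -> co (A (e n)) m = entry b n m.
Proof.
move=> [_ ->]; rewrite /entry; case: ifPn => [nm|mn].
  rewrite (bigD1 (Ordinal (nm : (n < m.+1)%N)))//= co_basis// eqxx mulr1.
  rewrite big1 ?addr0// => i; rewrite -(inj_eq val_inj)/= co_basis// eq_sym.
  by move=> /negbTE ->; rewrite mulr0.
apply: big1 => i _; rewrite co_basis// (_ : (_ == _) = false) ?mulr0//.
by rewrite gtn_eqF// (leq_trans (ltn_ord i))// ltnNge.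
Qed.

Lemma symbolP A b : bounded_operator A ->
  (forall n m, co (A (e n)) m = entry b n m) -> symbol A b.
Proof.
move=> Ab AE; split=> // x m.
apply: csum_unique (co_op_expansion normE eONB x m Ab) _.
have := @csum_eventually0 _ (fun n => co x n * entry b n m) m.+1.
have -> : \sum_(n < m.+1) co x n * entry b n m =
    \sum_(n < m.+1) b (m - n)%N * (wprod w n m)%:C * co x n.
  by apply: eq_bigr => n _; rewrite /entry -ltnS ltn_ord mulrC.
move=> h; apply: csum_ext (h _) => [n|n mn]; first by rewrite AE.
by rewrite /entry leqNgt mn mulr0.
Qed.

Lemma symbol_op_inj A B b : symbol A b -> symbol B b -> A = B.
Proof.
move=> [_ hA] [_ hB]; apply/funext => x; apply: (co_inj eONB) => m.
by rewrite hA hB.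
Qed.

Lemma symbol_lin (t : R[i]) A B b c : symbol A b -> symbol B c ->
  symbol (t *: A + B) (fun k => t * b k + c k).
Proof.
move=> [Ab hA] [Bb hB]; split; first exact: bounded_lin.
move=> x m; rewrite !fctE coD coZ hA hB mulr_sumr -big_split /=.
by apply: eq_bigr => n _; ring.
Qed.

Lemma symbol_sub A B b c : symbol A b -> symbol B c -> symbol (A - B) (fun k => b k - c k).
Proof.
move=> hA hB; have := symbol_lin (-1) hB hA.
rewrite (_ : -1 *: B + A = A - B); last by rewrite scaleN1r addrC.
by rewrite (_ : (fun k => _) = (fun k => b k - c k))//; apply/funext => k; ring.
Qed.

Lemma wprod_cat n m k : (n <= m)%N -> (m <= k)%N ->
  wprod w n k = wprod w n m * wprod w m k.
Proof. by move=> nm mk; rewrite /wprod (@big_cat_nat _ _ _ m n k). Qed.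

Lemma symbol_comp A B b c : symbol A b -> symbol B c -> symbol (A \o B) (mul_series b c).
Proof.
move=> hA hB; have [Ab _] := hA; have [Bb _] := hB.
apply: symbolP (bounded_comp Ab Bb) _ => n m.
have [_ hA'] := hA; rewrite /= hA'.
under eq_bigr do rewrite (symbol_entry _ _ hB).
rewrite /entry; case: ifPn => [nm|mn]; last first.
  apply: big1 => i _; rewrite ifF ?mulr0//; apply/negbTE; rewrite -ltnNge.
  by have := ltn_ord i; move: mn; lia.
rewrite -(big_mkord xpredT (fun i => b (m - i)%N * (wprod w i m)%:C *
  (if (n <= i)%N then c (i - n)%N * (wprod w n i)%:C else 0))).
rewrite (@big_cat_nat _ _ _ n)//=; last exact: leqW.
rewrite big_nat big1 ?add0r; last by move=> i /andP[_ ni]; rewrite leqNgt ni mulr0.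
rewrite /mul_series mulr_suml -(big_mkord xpredT (fun k => b k * c (m - n - k)%N * (wprod w n m)%:C)).
rewrite -{1}[n]add0n big_addn subSn// big_nat_rev /= add0n.
apply: eq_big_nat => i /andP[_]; rewrite ltnS => imn.
rewrite subSS.
have h1 : (m - (m - n - i + n) = i)%N by lia.
have h2 : (n <= m - n - i + n)%N by lia.
have h3 : (m - n - i + n <= m)%N by lia.
rewrite h1 h2 addnK (wprod_cat h2 h3) rmorphM /=; ring.
Qed.

Lemma iter_shift T n k : weighted_shift e w T ->
  iter k T (e n) = (wprod w n (n + k))%:C *: e (n + k)%N.
Proof.
move=> [Tb hT]; elim: k => [|k ih].
  by rewrite addn0 /wprod big_geq//= scale1r.
rewrite iterS ih linearZ_op; last by case: Tb.
rewrite hT scalerA addnS; congr (_ *: _).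
by rewrite /wprod [in RHS]big_nat_recr ?leq_addr//= rmorphM.
Qed.

Lemma symbol_poly T (p : {poly R[i]}) : weighted_shift e w T ->
  symbol (poly_op T p) (fun k => p`_k).
Proof.
move=> wT; have [Tb _] := wT; apply: symbolP; first exact: bounded_poly_op.
move=> n m; rewrite /poly_op /coord ip_suml.
under eq_bigr do rewrite (iter_shift _ _ wT) !ipZl -/(co _ _) co_basis//.
rewrite /entry; case: ifPn => [nm|mn]; last first.
  apply: big1 => k _; rewrite (_ : (_ == _) = false) ?mulr0//; apply/eqP => h.
  by move: mn; rewrite -h leq_addr.
have [hp|hp] := ltnP (m - n) (size p).
  rewrite (bigD1 (Ordinal hp))//= subnKC// eqxx mulr1 big1 ?addr0// => k.
  rewrite -(inj_eq val_inj)/= => kmn; rewrite (_ : (_ == _) = false) ?mulr0//.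
  by apply/eqP => h; move: kmn; rewrite -h addKn eqxx.
rewrite nth_default// mul0r; apply: big1 => k _.
rewrite (_ : (_ == _) = false) ?mulr0//; apply/eqP => h.
by have := leq_trans (ltn_ord k) hp; rewrite -h addKn ltnn.
Qed.

(** A function bounded by [C] on the disk is the symbol of an operator of norm
    at most [C]; it is built column by column, the bound on Toeplitz forms
    making the columns square summable. *)
Lemma symbol_exists b f (C : R) : (forall i, `|w i| <= 1) ->
    (forall z, normR z < 1 -> psum b z (f z)) ->
    (forall z, normR z < 1 -> normR (f z) <= C) ->
  exists2 A, symbol A b & forall x, normR (A x) <= C * normR x.
Proof.
move=> w1 bf fC.
have C0 : 0 <= C by apply: le_trans (normR_ge0 (f 0)) (fC 0 _); rewrite normR0.
pose a x m := \sum_(n < m.+1) b (m - n)%N * (wprod w n m)%:C * co x n.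
have aT x N u : Toeplitz b w N (co x) u = \sum_(m < N) a x m * Num.conj (u m).
  by [].
have nsqM (t : R) N u : nsq N (fun n => t%:C * u n) = t ^+ 2 * nsq N u.
  rewrite /nsq mulr_sumr; apply: eq_bigr => i _.
  by rewrite normRM normR_real exprMn real_normK// num_real.
have ale x N (C' : R) : C < C' -> nsq N (a x) <= C' ^+ 2 * normR x ^+ 2.
  move=> CC'; have C'0 : 0 < C' by exact: le_lt_trans CC'.
  have fC' z : normR z < 1 -> normR (f z) <= C'.
    by move=> z1; apply: le_trans (fC z z1) (ltW CC').
  have := Toeplitz_analytic_le N (co x) (fun m => (C'^-1)%:C * a x m) w1 bf fC'.
  rewrite nsqM aT.
  have -> : \sum_(m < N) a x m * Num.conj ((C'^-1)%:C * a x m) = (C'^-1 * nsq N (a x))%:C.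
    rewrite rmorphM /= /nsq rmorph_sum /= mulr_sumr; apply: eq_bigr => m _.
    by rewrite rmorphM /= conj_real -conjM_normR; ring.
  rewrite normR_real ger0_norm; last by rewrite mulr_ge0 ?nsq_ge0// invr_ge0 ltW.
  have := Bessel normE eONB x N; move: (nsq N (co x)) (nsq N (a x)) => s t.
  set X := normR x ^+ 2 => sX h.
  have {}h : t / C' <= C' * s.
    have e1 : C' * (s + C'^-1 ^+ 2 * t) = C' * s + t / C'.
      by field; rewrite gt_eqF.
    by rewrite e1 in h; move: h; rewrite [C'^-1 * t]mulrC; lra.
  move: h; rewrite ler_pdivrMr// => h; apply: le_trans h _.
  by rewrite mulrAC -expr2 ler_wpM2l// exprn_ge0// ltW.
have exA x : exists y, forall m, co y m = a x m.
  exact: (Riesz_Fischer normE eONB (fun N => ale x N (C + 1) (ltac:(by rewrite ltrDl)))).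
pose A x := projT1 (cid (exA x)).
have AE x m : co (A x) m = a x m by rewrite /A; case: cid.
have Ale x : normR (A x) <= C * normR x.
  apply/ler_addgt0Pl => eps eps0.
  have x1 : 0 < normR x + 1 by rewrite ltr_wpDl ?normR_ge0.
  pose C' := C + eps / (normR x + 1).
  have CC' : C < C' by rewrite ltrDl divr_gt0.
  have C'0 : 0 <= C' by apply: le_trans (ltW CC').
  apply: le_trans (_ : C' * normR x <= _); last first.
    rewrite /C' mulrDl addrC lerD2r mulrAC ler_pdivrMr// ler_pM2l// lerDl//.
  rewrite -(@ler_pXn2r _ 2)// ?nnegrE ?normR_ge0 ?mulr_ge0 ?normR_ge0// exprMn.
  apply: (normR_sqr_le normE eONB) => N; rewrite (funext (AE x)).
  exact: ale.
exists A => //; split=> //; split; last by exists C.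
move=> t x y; apply: (co_inj eONB) => m; rewrite coD coZ !AE /a mulr_sumr -big_split /=.
by apply: eq_bigr => n _; rewrite coD coZ; ring.
Qed.

(** ** Lower bound on the norm *)

(** On the corresponding basis vectors, a shift with such weights contains
    arbitrarily long pieces of almost the unweighted shift. *)
Definition near_one_windows := forall N (eps : R), 0 < eps ->
  exists a, forall i, (i < N)%N -> 1 - eps < w (a + i)%N.

Lemma tendsto_prod (I : Type) (r : seq I) (F : I -> nat -> R[i]) :
  (forall i, tendsto (F i) 1) -> tendsto (fun j => \prod_(i <- r) F i j) 1.
Proof.
move=> F1; elim: r => [|i r ih].
  by apply: (eq_tendsto (u := fun=> 1)); [move=> j; rewrite big_nil|exact: tendsto_cst].
have := tendstoM (F1 i) ih; rewrite mulr1; apply: eq_tendsto => j.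
by rewrite big_cons.
Qed.

(** Along windows of weights close to 1, the compressions of [A] approach
    sections of the unweighted Toeplitz matrix of its symbol. *)
Lemma window_Toeplitz_le A b (C : R) N x y :
  (forall i, 0 <= w i <= 1) -> near_one_windows -> symbol A b ->
  (forall u, normR (A u) <= C * normR u) ->
  normR (Toeplitz b (fun=> 1) N x y) *+ 2 <= C * (nsq N x + nsq N y).
Proof.
move=> w01 win hA AC.
have C0 : 0 <= C.
  have := le_trans (normR_ge0 _) (AC (e 0)).
  by rewrite (normR_basis normE eONB) mulr1.
pose emb a (u : nat -> R[i]) n := if (n < a)%N then 0 else u (n - a)%N.
have nemb a u : nsq (a + N) (emb a u) = nsq N u.
  rewrite /nsq -(big_mkord xpredT (fun i => normR (emb a u i) ^+ 2)).
  rewrite (@big_cat_nat _ _ _ a)//= ?leq_addr// [X in X + _]big_nat big1 ?add0r.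
    rewrite sum_nat_shift.
    by apply: eq_bigr => i _; rewrite /emb ltnNge leq_addl/= addnK.
  by move=> i /andP[_ ia]; rewrite /emb ia normR0 expr0n.
have key a : normR (Toeplitz b (fun i => w (a + i)%N) N x y) *+ 2 <=
    C * (nsq N x + nsq N y).
  pose X := comb (a + N) (emb a x); pose Y := comb (a + N) (emb a y).
  have nX u : normR (comb (a + N) (emb a u)) ^+ 2 = nsq N u.
    by rewrite (normR_comb normE eONB) nemb.
  have -> : Toeplitz b (fun i => w (a + i)%N) N x y = ip (A X) Y.
    rewrite /Y ip_sumr -(big_mkord xpredT (fun i => ip (A X) (emb a y i *: e i))).
    rewrite (@big_cat_nat _ _ _ a)//= ?leq_addr// [X in _ = X + _]big_nat.
    rewrite [X in _ = X + _]big1 ?add0r; last first.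
      by move=> i /andP[_ ia]; rewrite /emb ia scale0r ip0r.
    rewrite sum_nat_shift.
    apply: eq_bigr => m _; rewrite ipZr mulrC; congr (_ * _).
      by rewrite /emb ltnNge leq_addl /= addnK.
    have [_ hA'] := hA; rewrite -/(co _ _) hA'.
    rewrite -(big_mkord xpredT (fun n => b (m + a - n)%N * (wprod w n (m + a))%:C * co X n)).
    have am : (a <= (m + a).+1)%N by rewrite leqW// leq_addl.
    rewrite (@big_cat_nat _ _ _ a 0 _ _ _ (leq0n a) am) /= [X in _ = X + _]big_nat [X in _ = X + _]big1 ?add0r; last first.
      move=> i /andP[_ ia]; rewrite co_comb// (ltn_addr _ ia) /emb ia mulr0 //.
    rewrite -addSn [(m.+1 + a)%N]addnC sum_nat_shift; apply: eq_bigr => n _.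
    have nN : (n + a < a + N)%N by have := ltn_ord n; have := ltn_ord m; lia.
    rewrite co_comb// nN /emb ltnNge leq_addl/= addnK subnDr; congr (_ * _%:C * _).
    by rewrite /wprod big_addn addnK; apply: eq_bigr => i _; rewrite addnC.
  have := Cauchy_Schwarz normE (A X) Y => h.
  have h2 : normR (A X) * normR Y <= C * normR X * normR Y.
    by rewrite ler_wpM2r ?normR_ge0.
  rewrite -(nX x) -(nX y) -/X -/Y.
  have := sqr_ge0 (normR X - normR Y); rewrite sqrrB => h3.
  have h4 : (C * normR X * normR Y) *+ 2 <= C * (normR X ^+ 2 + normR Y ^+ 2).
    rewrite -mulrA -mulrnAr ler_wpM2l//; lra.
  by apply: le_trans h4; rewrite lerMn2r /=; exact: le_trans h2.
have ex j : exists a, forall i, (i < N)%N -> 1 - j.+1%:R^-1 < w (a + i)%N.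
  by apply: win; rewrite invr_gt0 ltr0n.
pose a j := projT1 (cid (ex j)).
have aE j i : (i < N)%N -> 1 - j.+1%:R^-1 < w (a j + i)%N.
  by rewrite /a; case: cid => /= ?; apply.
have wt i : (i < N)%N -> tendsto (fun j => (w (a j + i)%N)%:C) (1 : R[i]).
  move=> iN; apply: tendsto_squeeze (@cvg_harmonic R) => j.
  rewrite -(rmorph1 (real_complex R)) -rmorphB normR_real distrC ger0_norm.
    by rewrite lerBlDr -lerBlDl; apply/ltW; exact: aE.
  by rewrite subr_ge0; case/andP: (w01 (a j + i)%N).
have -> : normR (Toeplitz b (fun=> 1) N x y) *+ 2 = normR (Toeplitz b (fun=> 1) N x y) * 2.
  by rewrite mulr_natr.
rewrite -ler_pdivlMr//.
apply: (@tendsto_normR_le _ _ (fun j => Toeplitz b (fun i => w (a j + i)%N) N x y) _ _ 0).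
  rewrite /Toeplitz; apply: tendsto_sum => m _.
  rewrite mulrC; apply: eq_tendsto (tendstoMl _ _) => [j|]; first by rewrite mulrC.
  apply: tendsto_sum => n _.
  have Wt : tendsto (fun j => (wprod (fun i => w (a j + i)%N) n m)%:C) (1 : R[i]).
    apply: eq_tendsto (@tendsto_prod _ (index_iota n m)
      (fun i j => if (i < N)%N then (w (a j + i)%N)%:C else 1) _) => [j|i].
      rewrite /wprod rmorph_prod; apply: eq_big_nat => i /andP[_ im].
      by rewrite (ltn_trans im).
    by have [iN|_] := boolP (i < N)%N; [exact: wt|exact: tendsto_cst].
  rewrite [wprod _ _ _]big1// rmorph1.
  have := tendstoMl (b (m - n)%N * x n) Wt; rewrite mulr1 -mulrA [1 * _]mul1r.
  by apply: eq_tendsto => j; ring.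
by move=> j _; rewrite ler_pdivlMr// mulr_natr; exact: key.
Qed.

Lemma csum_geometric_series (t : R[i]) : normR t < 1 -> csum (fun n => t ^+ n) (1 - t)^-1.
Proof.
move=> t1; have t10 : 1 - t != 0.
  rewrite subr_eq0; apply/eqP => h; move: t1; rewrite -h normR1 ltxx //.
have nt0 : 0 < normR (1 - t) by rewrite lt_neqAle normR_ge0 andbT eq_sym normR_eq0.
have : (fun N => (normR (1 - t))^-1 * normR t ^+ N) @ \oo --> (0 : R).
  rewrite -[X in _ --> X](mulr0 (normR (1 - t))^-1); apply: cvgM; first exact: cvg_cst.
  by apply: cvg_expr; rewrite ger0_norm ?normR_ge0.
apply: tendsto_squeeze => N.
have -> : \sum_(n < N) t ^+ n - (1 - t)^-1 = - (t ^+ N / (1 - t)).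
  apply: (mulIf t10); rewrite mulrBl mulNr divfK// mulVf//.
  rewrite (_ : _ * (1 - t) = - ((t - 1) * \sum_(i < N) t ^+ i)); last by ring.
  by rewrite -subrX1; ring.
by rewrite normRN normRM normRV normRX mulrC.
Qed.

(** Reproducing kernels: for [c_n = conj(z)^n] the unweighted forms at [(c, c)]
    tend to [f(z) / (1 - |z|^2)], and [|c|^2 = 1 / (1 - |z|^2)]. *)
Lemma symbol_sup_le A b (C : R) :
  (forall i, 0 <= w i <= 1) -> near_one_windows -> symbol A b ->
  (forall u, normR (A u) <= C * normR u) ->
  exists f, forall z, normR z < 1 -> psum b z (f z) /\ normR (f z) <= C.
Proof.
move=> w01 win hA AC.
have key N x y := @window_Toeplitz_le A b C N x y w01 win hA AC.
have bC n : normR (b n) <= C.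
  have := key n.+1 (fun k => (k == 0%N)%:R) (fun k => (k == n)%:R).
  by rewrite Toeplitz_coef !nsq_delta//; lra.
have ex z : exists l, normR z < 1 -> psum b z l.
  have [h|h] := pselect (normR z < 1); last by exists 0.
  have [|l hl] := @psum_exists _ C 1 b z _ h; last by exists l.
  by move=> n; rewrite expr1n mulr1.
exists (fun z => projT1 (cid (ex z))) => z z1.
have zf z' : normR z' < 1 -> psum b z' (projT1 (cid (ex z'))) by case: cid.
split; first exact: zf.
set f := fun z => projT1 (cid (ex z)) in zf *; rewrite -/(f z).
pose c n := Num.conj z ^+ n.
have cg z' : normR z' < 1 -> psum c z' (1 - Num.conj z * z')^-1.
  move=> z'1; have : normR (Num.conj z * z') < 1.
    rewrite normRM normR_conj; apply: le_lt_trans z'1.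
    by rewrite ler_piMl ?normR_ge0// ltW.
  move=> /csum_geometric_series; apply: csum_ext => n.
  by rewrite /c exprMn.
have := Cauchy_product z1 cg zf; rewrite mulrC [Num.conj z * z]mulrC conjM_normR.
set q := normR z ^+ 2.
have q1 : q < 1 by rewrite /q expr_lt1// normR_ge0.
have q0 : 0 <= q by rewrite exprn_ge0// normR_ge0.
have q1' : 0 < 1 - q by rewrite subr_gt0.
rewrite -(rmorph1 (real_complex R)) -rmorphB -fmorphV => hf.
suff h : normR (f z * ((1 - q)^-1)%:C) <= C / (1 - q).
  move: h; rewrite normRM normR_real ger0_norm ?invr_ge0 ?(ltW q1')//.
  by rewrite ler_pM2r// invr_gt0.
apply: (tendsto_normR_le (N0 := 0) hf) => N _.
have -> : \sum_(m < N) mul_series c b m * z ^+ m = Toeplitz b (fun=> 1) N c c.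
  apply: eq_bigr => m _; rewrite /c rmorphXn /= conjCK; congr (_ * _).
  rewrite /mul_series; apply: eq_bigr => n _.
  by rewrite /wprod big1// rmorph1 mulr1 mulrC.
have nc : nsq N c <= (1 - q)^-1.
  have := @geometric_partial_le R q 0 N; rewrite q0 q1 expr0 mul1r big_mkord => /(_ isT).
  apply: le_trans; apply: ler_sum => n _.
  by rewrite /c normRX normR_conj -!exprM mulnC.
have C0 : 0 <= C := le_trans (normR_ge0 _) (bC 0%N).
have := key N c c; have : C * nsq N c <= C / (1 - q) by rewrite ler_wpM2l.
by rewrite mulrDr; lra.
Qed.

End symbols.

(** * Weak and weak-star closures *)

Section trace_class_factorization.
Context {R : realType} {H : completeNormedModType R[i]}.
Variable ip : {dot H for Num.conj}.
Hypothesis normE : forall x : H, `|x| ^+ 2 = ip x x.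
Variable e : nat -> H.
Hypothesis eONB : orthonormal_basis ip e.
Local Open Scope complex_scope.
Local Notation co := (coord ip e).
Implicit Types (A D K P Q : H -> H) (x y : H).

Definition psd Q := [/\ linear Q, forall x, 0 <= ip (Q x) x &
  forall x y, ip (Q x) y = Num.conj (ip (Q y) x)].

(** Hermitian symmetry is polarization: [<P u, u>] is real at [x + y] and [x + i y]. *)
Lemma positive_psd P : positive_operator ip P -> psd P.
Proof.
move=> [[Pl _] P0]; split=> // x y.
have real z : Num.conj (ip (P z) z) = ip (P z) z by apply: geC0_conj.
have [im [ci ii]] : exists im : R[i], Num.conj im = - im /\ im * im = -1.
  by exists 'i%R; split; [exact: conjCi|rewrite -expr2 sqrCi].
have e1 := real (x + y); have e2 := real (x + im *: y).
move: e1; rewrite linearD_op// !(ipDl, ipDr) !rmorphD /= !real => /eqP.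
rewrite !addrA -subr_eq0 => /eqP e1.
move: e2; rewrite linearD_op// linearZ_op// !(ipDl, ipDr, ipZl, ipZr) !rmorphD /= !rmorphM /= !real.
rewrite conjCK ci => /eqP; rewrite -subr_eq0 => /eqP e2.
move: e1 e2 ii; set a := ip (P x) y; set b := ip (P y) x.
set ca := Num.conj a; set cb := Num.conj b; set c := ip (P x) x; set d := ip (P y) y.
move=> e1 e2 ii.
have {}e1 : ca + cb = a + b.
  by apply/eqP; rewrite -subr_eq0 -[X in _ == X]e1; apply/eqP; ring.
have {}e2 : ca - cb = b - a.
  have e3 : im * (ca - cb - (b - a)) = 0 by rewrite -[RHS]e2; ring.
  apply/eqP; rewrite -subr_eq0.
  have : im * (im * (ca - cb - (b - a))) = 0 by rewrite e3 mulr0.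
  by rewrite mulrA ii mulN1r => /eqP; rewrite oppr_eq0.
have : 2 * cb = 2 * a.
  have -> : 2 * cb = (ca + cb) - (ca - cb) by ring.
  by rewrite e1 e2; ring.
by move/(mulfI _) => -> //; rewrite pnatr_eq0.
Qed.

Lemma psd_real Q x : psd Q -> ip (Q x) x = (complex.Re (ip (Q x) x))%:C.
Proof. by move=> [_ Q0 _]; rewrite RRe_real// ger0_real. Qed.

Lemma psd_ge0 Q x : psd Q -> 0 <= complex.Re (ip (Q x) x).
Proof. by move=> Qp; rewrite -lecR -psd_real//; case: Qp. Qed.

(** Positivity at [x - s <Q x, y> y] for all real [s]. *)
Lemma psd_Cauchy_Schwarz Q x y : psd Q -> normR (ip (Q x) y) ^+ 2 <=
  complex.Re (ip (Q x) x) * complex.Re (ip (Q y) y).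
Proof.
move=> Qp; have [Ql Q0 Qh] := Qp.
set X := complex.Re (ip (Q x) x); set d := complex.Re (ip (Q y) y).
set be := ip (Q x) y; set n := normR be ^+ 2.
have key (s : R) : 0 <= X - 2 * s * n + s ^+ 2 * n * d.
  have := psd_ge0 (x - (s%:C * be) *: y) Qp.
  rewrite linearB_op// linearZ_op// ipBl !ipBr ipZl !ipZr ipZl.
  rewrite (psd_real x Qp) (psd_real y Qp) -/X -/d (Qh y x) -/be rmorphM /= conj_real.
  have -> : X%:C - s%:C * Num.conj be * be -
      (s%:C * be * Num.conj be - s%:C * Num.conj be * (s%:C * be * d%:C)) =
      X%:C - (2 * s%:C) * (be * Num.conj be) + s%:C ^+ 2 * (be * Num.conj be) * d%:C by ring.
  rewrite conjM_normR -/n.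
  rewrite (_ : _ + _ = (X - 2 * s * n + s ^+ 2 * n * d)%:C)//.
  by rewrite rmorphD rmorphB /= !rmorphM /= rmorph_nat; ring.
have d0 : 0 <= d := psd_ge0 y Qp.
have n0 : 0 <= n by rewrite exprn_ge0 ?normR_ge0.
have X0 : 0 <= X := psd_ge0 x Qp.
have [dz|dz] := eqVneq d 0.
  have [nz|nz] := eqVneq n 0; first by rewrite nz dz mulr0.
  have := key ((X + 1) / n); rewrite dz !mulr0 addr0 -mulrA divfK//; lra.
have {}dz : 0 < d by rewrite lt_neqAle eq_sym dz.
have := key d^-1.
have -> : X - 2 * d^-1 * n + d^-1 ^+ 2 * n * d = X - n / d by field; rewrite gt_eqF.
by rewrite subr_ge0 ler_pdivrMr.
Qed.

Section Cholesky.
Variable P : H -> H.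
Hypothesis Ppsd : psd P.

(** At a zero pivot the inverse is 0, and the step removes nothing. *)
Definition pivot (F : H -> H) i : H :=
  ((Num.sqrt (complex.Re (ip (P (F (e i))) (e i))))^-1)%:C *: F (e i).

(** Cholesky's algorithm along the basis: [P \o elim i] is what remains of [P]
    after the removal of the rank-one operators of the first [i] steps.  Carrying
    [elim i] instead of the remainder keeps track of preimages under [P]. *)
Fixpoint elim i : H -> H :=
  if i is i'.+1 then
    fun x => elim i' x - ip x (P (pivot (elim i') i')) *: pivot (elim i') i'
  else id.

Definition chol i : H := P (pivot (elim i) i).

Lemma elimS i x : elim i.+1 x = elim i x - ip x (chol i) *: pivot (elim i) i.
Proof. by []. Qed.

Lemma elim_linear i : linear (elim i).
Proof.
elim: i => [|i ih] // t x y; rewrite !elimS ih ipDl ipZl scalerDl scalerBr -scalerA.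
by rewrite opprD addrACA.
Qed.

Lemma P_elimS i x : P (elim i.+1 x) = P (elim i x) - ip x (chol i) *: chol i.
Proof.
have [Pl _ _] := Ppsd.
by rewrite elimS linearB_op// (linearZ_op _ _ Pl).
Qed.

Lemma cholE i : chol i =
  ((Num.sqrt (complex.Re (ip (P (elim i (e i))) (e i))))^-1)%:C *: P (elim i (e i)).
Proof. by have [Pl _ _] := Ppsd; rewrite /chol /pivot (linearZ_op _ _ Pl). Qed.

Lemma ip_chol i x : psd (P \o elim i) ->
  normR (ip x (chol i)) ^+ 2 <= complex.Re (ip (P (elim i x)) x).
Proof.
move=> Qp; rewrite cholE ipZr conj_real normRM exprMn normR_real.
have := psd_Cauchy_Schwarz x (e i) Qp => /=.
have := psd_ge0 (e i) Qp; have := psd_ge0 x Qp => /=.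
have [_ _ /(_ x (e i)) /= ->] := Qp.
rewrite -[X in normR X ^+ 2 <= _](ipC ip) => /=.
set d := complex.Re (ip (P (elim i (e i))) (e i)); set X := complex.Re _.
move=> X0 d0 h.
have [dz|dz] := eqVneq d 0; first by rewrite dz sqrtr0 invr0 normr0 expr0n mul0r.
have {}dz : 0 < d by rewrite lt_neqAle eq_sym dz.
rewrite real_normK ?num_real// exprVn sqr_sqrtr// mulrC ler_pdivrMr//.
Qed.

Lemma elim_psd i : psd (P \o elim i).
Proof.
elim: i => [|i ih]; first by [].
have [Ql Q0 Qh] := ih; split.
- move=> t x y; have [Pl _ _] := Ppsd.
  by have /= -> := elim_linear i.+1 t x y; rewrite Pl.
- move=> x; rewrite -[(P \o _) x]/(P (elim i.+1 x)) P_elimS ipBl ipZl (ipC ip (chol i)) conjM_normR.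
  by rewrite (psd_real x ih) -rmorphB ler0c subr_ge0 ip_chol.
- move=> x y; rewrite -![(P \o elim i.+1) _]/(P (elim i.+1 _)) !P_elimS !ipBl !ipZl rmorphB rmorphM /=.
  by rewrite -(Qh x y) -!(ipC ip) [X in _ - X]mulrC.
Qed.

(** The step [i] annihilates [e_i], and the later ones leave this intact, their
    vectors being orthogonal to [e_i]. *)
Lemma P_elim_basis i : forall j, (j < i)%N -> P (elim i (e j)) = 0.
Proof.
have step k : (forall j, (j < k)%N -> P (elim k (e j)) = 0) ->
    forall j, (j < k)%N -> ip (e j) (chol k) = 0.
  move=> h j jk; have [_ _ Qh] := elim_psd k.
  rewrite cholE ipZr (ipC ip (e j)) -[P (elim k (e k))]/((P \o elim k) (e k)).
  by rewrite (Qh (e k) (e j)) /= (h j jk) ip0l !rmorph0 mulr0.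
elim: i => [|i ih] // j; rewrite ltnS leq_eqVlt => /orP[/eqP ->|ji]; last first.
  by rewrite P_elimS ih// (step _ ih)// scale0r subr0.
have Qp := elim_psd i; rewrite P_elimS {2}cholE scalerA cholE ipZr.
set d := complex.Re (ip (P (elim i (e i))) (e i)).
have [_ _ Qh] := Qp; rewrite (ipC ip (e i)) -/((P \o elim i) (e i)) (psd_real (e i) Qp) /= -/d.
rewrite !conj_real -!rmorphM /=.
have d0 : 0 <= d := psd_ge0 (e i) Qp.
have [dz|dz] := eqVneq d 0.
  (* a zero pivot: by Cauchy-Schwarz the vector to be removed is already zero *)
  have -> : P (elim i (e i)) = 0; last by rewrite scaler0 subr0.
  apply/eqP; rewrite -normR_eq0 -sqrf_eq0 -sqrf_eq0 eq_le sqr_ge0 andbT.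
  have := psd_Cauchy_Schwarz (e i) (P (elim i (e i))) Qp; rewrite /= -/d dz mul0r.
  by rewrite (ip_self normE) normR_real ger0_norm ?exprn_ge0 ?normR_ge0.
have {}dz : 0 < d by rewrite lt_neqAle eq_sym dz.
rewrite (_ : _ * _ * _ = 1); first by rewrite scale1r subrr.
have sd : Num.sqrt d != 0 by rewrite sqrtr_eq0 -ltNge.
by rewrite -{2}[d]sqr_sqrtr// expr2; field.
Qed.

Lemma sum_chol N x : \sum_(i < N) normR (ip x (chol i)) ^+ 2 <= complex.Re (ip (P x) x).
Proof.
suff -> : \sum_(i < N) normR (ip x (chol i)) ^+ 2 =
    complex.Re (ip (P x) x) - complex.Re (ip (P (elim N x)) x).
  by rewrite gerBl; exact: (psd_ge0 x (elim_psd N)).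
elim: N => [|N ih]; first by rewrite big_ord0 subrr.
rewrite big_ord_recr /= ih -/(elim N.+1 x) P_elimS ipBl ipZl (ipC ip (chol N)) conjM_normR.
have -> (z : R[i]) (r : R) : complex.Re (z - r%:C) = complex.Re z - r by case: z.
by rewrite opprB addrA addrAC; ring.
Qed.

End Cholesky.

Lemma normR_absolute_value K P x : absolute_value_of ip K P -> normR (K x) = normR (P x).
Proof.
move=> [Pp [L [_ LE] PL]]; have [_ _ Ph] := positive_psd Pp.
apply/eqP; rewrite -(@eqrXn2 _ 2) ?normR_ge0//; apply/eqP; apply: complexI.
rewrite -!(ip_self normE) LE -[L (K x)]/((L \o K) x) -PL /=.
by rewrite (ipC ip) Ph conjCK.
Qed.

(** A trace-class operator is [sum_i <., g_i> h_i] with [sum_i |g_i| |h_i|]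
    finite: for [|K| = sum_i <., g_i> g_i] the Cholesky factorization, with
    [g_i = |K| f_i], take [h_i = K f_i], as [K] and [|K|] have the same norms.
    On each basis vector the sum is finite. *)
Lemma trace_class_factor K : trace_class ip e K -> exists (g h : nat -> H) (S : R),
  [/\ forall i, normR (h i) = normR (g i),
      forall N, \sum_(i < N) normR (g i) ^+ 2 <= S &
      forall j N, (j < N)%N -> K (e j) = \sum_(i < N) ip (e j) (g i) *: h i].
Proof.
move=> [Kb [P KP Pcv]]; have [[Pb P0] _] := KP.
have Pp : psd P by apply: positive_psd.
have [Kl _] := Kb; have [Pl _ _] := Pp.
pose f i := pivot P (elim P i) i.
have [S hS] : exists S : R, forall N, \sum_(j < N) complex.Re (ip (P (e j)) (e j)) <= S.
  have [l] : exists l, csum (fun n => ip (P (e n)) (e n)) l.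
    exists (limn (series (fun n => ip (P (e n)) (e n) : R[i]^o))).
    exact/cvg_series_csum.
  move=> /tendsto_bounded[M hM]; exists M => N; apply: le_trans (hM N).
  have -> : \sum_(n < N) ip (P (e n)) (e n) = (\sum_(j < N) complex.Re (ip (P (e j)) (e j)))%:C.
    by rewrite rmorph_sum; apply: eq_bigr => j _; exact: psd_real.
  by rewrite normR_real ler_norm.
have FE N x : elim P N x = x - \sum_(i < N) ip x (chol P i) *: f i.
  elim: N => [|N ih]; first by rewrite big_ord0 subr0.
  by rewrite elimS ih big_ord_recr /= opprD addrA.
exists (chol P), (fun i => K (f i)), S; split.
- by move=> i; rewrite (normR_absolute_value _ KP).
- move=> N.
  have cv : (fun J => \sum_(i < N) nsq J (co (chol P i))) @ \oo -->
      \sum_(i < N) normR (chol P i) ^+ 2.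
    apply/tendsto_real; rewrite rmorph_sum.
    apply: (eq_tendsto (u := fun J => \sum_(i < N) (nsq J (co (chol P i)))%:C)).
      by move=> J; rewrite rmorph_sum.
    by apply: tendsto_sum => i _; apply/tendsto_real; exact: (Parseval normE eONB).
  rewrite -(cvg_lim (@Rhausdorff R) cv); apply: limr_le; first by apply/cvg_ex; eexists; exact: cv.
  near=> J; rewrite /nsq exchange_big /=; apply: le_trans (hS J).
  apply: ler_sum => j _; apply: le_trans (sum_chol Pp N (e j)).
  by apply: ler_sum => i _; rewrite /coord (ipC ip) normR_conj.
- move=> j N jN; have := P_elim_basis Pp jN.
  move=> /(congr1 (@normR R _)); rewrite normR0 -(normR_absolute_value _ KP) => /eqP.
  rewrite normR_eq0 FE (linearB_op _ _ Kl) subr_eq0 (linear_sum_op _ _ _ Kl) => /eqP ->.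
  by apply: eq_bigr => i _; rewrite (linearZ_op _ _ Kl).
Unshelve. all: by end_near. Qed.

End trace_class_factorization.

Lemma bounded_sum_tail {R : realType} (a : nat -> R) (B : R) : (forall n, 0 <= a n) ->
  (forall N, \sum_(n < N) a n <= B) -> forall eps, 0 < eps ->
  exists m, forall N, (m <= N)%N -> \sum_(m <= n < N) a n < eps.
Proof.
move=> a0 aB eps eps0; pose u N := \sum_(n < N) a n.
have nd : nondecreasing_seq u.
  by apply/nondecreasing_seqP => N; rewrite /u big_ord_recr /= lerDl.
have [l hl] : exists l : R, u @ \oo --> l.
  exists (limn u); apply: nondecreasing_is_cvgn => //.
  by exists B => _ [N _ <-]; exact: aB.
have ul N : u N <= l.
  rewrite -(cvg_lim (@Rhausdorff R) hl); apply: nondecreasing_cvgn_le => //.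
  by apply/cvg_ex; exists l.
move/cvgrPdist_lt/(_ _ eps0) : hl => [m _ hm]; exists m => N mN.
have -> : \sum_(m <= n < N) a n = u N - u m.
  rewrite /u -!(big_mkord xpredT a) (@big_cat_nat _ _ _ m 0 N)//=.
  by rewrite addrAC subrr add0r.
apply: le_lt_trans (hm m (leqnn m)).
by rewrite /= ger0_norm ?subr_ge0// lerD2r.
Qed.

Lemma csum_absolute {R : realType} (c : nat -> R[i]) (B : R) :
  (forall N, \sum_(n < N) normR (c n) <= B) -> exists l, csum c l.
Proof.
move=> cB; apply: Cauchy_tendsto => eps eps0.
have e2 : 0 < eps / 2 by rewrite divr_gt0.
have [N hN] := bounded_sum_tail (fun n => normR_ge0 (c n)) cB e2; exists N.
suff h m : (N <= m)%N -> normR (\sum_(n < m) c n - \sum_(n < N) c n) < eps / 2.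
  move=> m n Nm Nn; apply: le_lt_trans (normR_tri (\sum_(i < N) c i) _ _) _.
  by rewrite (splitr eps) ltrD ?h// normR_distC h.
move=> Nm; apply: le_lt_trans (hN m Nm).
rewrite -!(big_mkord xpredT c) (@big_cat_nat _ _ _ N 0 m)//=.
by rewrite addrAC subrr add0r normR_sum.
Qed.

Section closures.
Context {R : realType} {H : completeNormedModType R[i]}.
Variable ip : {dot H for Num.conj}.
Hypothesis normE : forall x : H, `|x| ^+ 2 = ip x x.
Variable e : nat -> H.
Hypothesis eONB : orthonormal_basis ip e.
Local Open Scope complex_scope.
Local Notation co := (coord ip e).
Local Notation comb := (comb e).
Implicit Types (A D K T : H -> H) (x y : H).

(** On bounded sets of operators, convergence of the matrix entries is weak
    convergence, and even weak-star convergence. *)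
Section bounded_sequence.
Variables (D : nat -> H -> H) (M : R).
Hypothesis Dl : forall j, linear (D j).
Hypothesis DM : forall j x, normR (D j x) <= M * normR x.
Hypothesis Dent : forall n m, tendsto (fun j => co (D j (e n)) m) 0.

Let M0 : 0 <= M.
Proof.
have := le_trans (normR_ge0 _) (DM 0 (e 0)).
by rewrite (normR_basis normE eONB) mulr1.
Qed.

Lemma bounded_entries_weak x y : tendsto (fun j => ip (D j x) y) 0.
Proof.
move=> eps eps0; pose t := M * (normR x + 1) + M * normR y + 1.
have nx := normR_ge0 x; have ny := normR_ge0 y.
have h1 : 0 <= M * (normR x + 1) by rewrite mulr_ge0// addr_ge0.
have h2 : 0 <= M * normR y by rewrite mulr_ge0.
have t0 : 0 < t by rewrite /t; lra.
pose d := Num.min 1 (eps / 2 / t).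
have d0 : 0 < d by rewrite lt_min ltr01 !divr_gt0.
have d1 : d <= 1 by rewrite ge_min lexx.
have dt : t * d <= eps / 2.
  by rewrite mulrC -ler_pdivlMr// ge_min lexx orbT.
have [N1 hN1] := expansion eONB x d0; have [N2 hN2] := expansion eONB y d0.
have := hN1 _ (leqnn N1); have := hN2 _ (leqnn N2).
set x' := comb N1 (co x); set y' := comb N2 (co y) => yy xx.
have : tendsto (fun j => ip (D j x') y') 0.
  apply: (eq_tendsto (u := fun j => \sum_(m < N2) \sum_(n < N1)
      (Num.conj (co y m) * co x n) * co (D j (e n)) m)).
    move=> j; rewrite ip_sumr; apply: eq_bigr => m _.
    rewrite ipZr (linear_comb_op _ _ _ (Dl j)) ip_suml mulr_sumr.
    by apply: eq_bigr => n _; rewrite ipZl mulrA.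
  rewrite [X in tendsto _ X](_ : 0 = \sum_(m < N2) \sum_(n < N1)
      (Num.conj (co y m) * co x n) * 0); last first.
    by rewrite big1// => m _; rewrite big1// => n _; rewrite mulr0.
  by apply: tendsto_sum => m _; apply: tendsto_sum => n _; exact: tendstoMl.
move=> /(_ _ (divr_gt0 eps0 (ltr0n R 2)))[N hN]; exists N => j /hN; rewrite !subr0 => hj.
have -> : ip (D j x) y = ip (D j x') y' - (ip (D j (x' - x)) y' + ip (D j x) (y' - y)).
  by rewrite (linearB_op _ _ (Dl j)) ipBl ipBr; ring.
apply: le_lt_trans (normRB _ _) _; rewrite (splitr eps).
apply: ltr_leD => //; apply: le_trans (normRD _ _) _; apply: le_trans dt.
have b1 : normR (ip (D j (x' - x)) y') <= M * d * (normR y + 1).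
  apply: le_trans (Cauchy_Schwarz normE _ _) _; apply: ler_pM; rewrite ?normR_ge0//.
    by apply: le_trans (DM _ _) _; rewrite ler_wpM2l// ltW.
  by have := normRD (y' - y) y; rewrite subrK; move: (ltW yy); lra.
have b2 : normR (ip (D j x) (y' - y)) <= M * normR x * d.
  apply: le_trans (Cauchy_Schwarz normE _ _) _; apply: ler_pM; rewrite ?normR_ge0//.
  exact: ltW.
apply: le_trans (lerD b1 b2) _.
rewrite /t !mulrDl !mulrDr !mulr1 mul1r.
have -> : M * d * normR y = M * normR y * d by ring.
by lra.
Qed.

(** With [K = sum_i <., g_i> h_i], the trace of [D K] is [sum_i <D h_i, g_i>], up
    to the tail of [sum_i |g_i|^2]; the finitely many leading terms tend to 0. *)
Lemma bounded_entries_weak_star K : trace_class ip e K -> forall eps : R, 0 < eps ->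
  exists N, forall j, (N <= j)%N -> normR (trace ip e (D j \o K)) < eps.
Proof.
move=> Ktr eps eps0.
have [g [h [S [hg gS KE]]]] := trace_class_factor normE eONB Ktr.
pose G i := normR (g i) ^+ 2; pose t := M + 1.
have G0 i : 0 <= G i by rewrite exprn_ge0 ?normR_ge0.
have t0 : 0 < t by rewrite /t ltr_wpDl.
pose s j i n := co (D j (h i)) n * Num.conj (co (g i) n).
have sb j i N : \sum_(n < N) normR (s j i n) <= t * G i.
  apply: le_trans (_ : \sum_(n < N) (normR (co (D j (h i)) n) ^+ 2 / t +
     t * normR (co (g i) n) ^+ 2) / 2 <= _).
    apply: ler_sum => n _; rewrite normRM normR_conj ler_pdivlMr//.
    move: (normR _) (normR _) => b a.
    have : 0 <= (a - t * b) ^+ 2 / t by rewrite divr_ge0 ?sqr_ge0 ?ltW.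
    rewrite (_ : (a - t * b) ^+ 2 / t = a ^+ 2 / t + t * b ^+ 2 - a * b * 2).
      by rewrite subr_ge0.
    by field; rewrite gt_eqF.
  rewrite -mulr_suml big_split /= -mulr_suml -mulr_sumr ler_pdivrMr//.
  have b1 : \sum_(n < N) normR (co (D j (h i)) n) ^+ 2 / t <= t * G i.
    rewrite -mulr_suml ler_pdivrMr//; apply: le_trans (Bessel normE eONB _ _) _.
    apply: le_trans (_ : (M * normR (h i)) ^+ 2 <= _).
      by rewrite lerXn2r ?nnegrE ?normR_ge0 ?mulr_ge0 ?normR_ge0.
    rewrite hg exprMn -/(G i) (_ : t * G i * t = t ^+ 2 * G i); last by ring.
    by rewrite ler_wpM2r// lerXn2r ?nnegrE ?(ltW t0)// /t lerDl.
  have b2 : t * \sum_(n < N) normR (co (g i) n) ^+ 2 <= t * G i.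
    by rewrite ler_pM2l//; exact: (Bessel normE eONB).
  by rewrite -mulr_suml in b1; lra.
pose u j n := ip (D j (K (e n))) (e n).
have uE j n N : (n < N)%N -> u j n = \sum_(i < N) s j i n.
  move=> nN; rewrite /u (KE n N nN) (linear_sum_op _ _ _ (Dl j)) ip_suml.
  apply: eq_bigr => i _; rewrite (linearZ_op _ _ (Dl j)) ipZl mulrC /s.
  by rewrite /coord -(ipC ip).
have uS j N : \sum_(n < N) u j n = \sum_(i < N) \sum_(n < N) s j i n.
  by rewrite exchange_big; apply: eq_bigr => n _; exact: uE.
have ucv j : exists l, csum (u j) l.
  apply: (@csum_absolute _ _ (t * S)) => N.
  apply: le_trans (_ : \sum_(i < N) \sum_(n < N) normR (s j i n) <= _).
    rewrite exchange_big /=; apply: ler_sum => n _.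
    by rewrite (uE j n N)// normR_sum.
  apply: le_trans (_ : \sum_(i < N) t * G i <= _).
    by apply: ler_sum => i _; exact: sb.
  by rewrite -mulr_sumr ler_pM2l.
have d0 : 0 < eps / 2 / t by rewrite !divr_gt0.
have [m hm] := bounded_sum_tail G0 gS d0.
have lead : tendsto (fun j => \sum_(i < m) ip (D j (h i)) (g i)) 0.
  rewrite [X in tendsto _ X](_ : 0 = \sum_(i < m) (0 : R[i])); last by rewrite big1.
  by apply: tendsto_sum => i _; exact: bounded_entries_weak.
have [N0 hN0] := lead _ (divr_gt0 eps0 (ltr0n R 2)); exists N0 => j /hN0.
rewrite subr0 => hj; have [l hl] := ucv j.
have -> : trace ip e (D j \o K) = l.
  by rewrite /trace; apply: cvg_lim; [exact: norm_hausdorff|exact/cvg_series_csum].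
set L := \sum_(i < m) _ in hj.
have close : normR (l - L) <= eps / 2.
  have lL : tendsto (fun N => \sum_(n < N) u j n - \sum_(i < m) \sum_(n < N) s j i n) (l - L).
    apply: tendstoB => //; apply: tendsto_sum => i _; exact: (ip_expansion normE eONB).
  apply: (tendsto_normR_le (N0 := m) lL) => N mN.
  rewrite uS -!(big_mkord xpredT (fun i => \sum_(n < N) s j i n)).
  rewrite (@big_cat_nat _ _ _ m 0 N)//= addrAC subrr add0r.
  apply: le_trans (normR_sum _ _ _) _.
  apply: le_trans (_ : \sum_(m <= i < N) t * G i <= _).
    apply: ler_sum => i _; apply: le_trans (sb j i N); exact: normR_sum.
  rewrite -mulr_sumr mulrC -ler_pdivlMr//; apply/ltW; exact: hm.
rewrite -[l](subrK L); apply: le_lt_trans (normRD _ _) _.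
by rewrite (splitr eps) ler_ltD.
Qed.

End bounded_sequence.

Variable w : nat -> R.
Hypothesis w01 : forall i, 0 <= w i <= 1.
Variable T : H -> H.
Hypothesis wT : weighted_shift e w T.
Local Notation symbol := (symbol ip e w).

Lemma wprod_ge0 n m : 0 <= wprod w n m.
Proof. by apply: prodr_ge0 => i _; case/andP: (w01 i). Qed.

Lemma wprod_le1 n m : wprod w n m <= 1.
Proof. by apply: prodr_ile1 => i _; exact: w01. Qed.

Lemma weight_norm_le1 i : `|w i| <= 1.
Proof. by have /andP[? ?] := w01 i; rewrite ger0_norm. Qed.

(** As weights may vanish, the coefficient [b_k] is read off at a place of the
    [k]-th diagonal where the product of weights does not; the other entries of
    the diagonal are compared with this one through polynomials in [T], whose
    entries along a diagonal are proportional to the products of weights.  Hence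
    two entries have to be approximated at the same time. *)
Lemma entrywise_closure_symbol A : near_one_windows w -> bounded_operator A ->
  (forall n1 m1 n2 m2 (eps : R), 0 < eps -> exists2 B, polynomials_in T B &
     normR (co (A (e n1)) m1 - co (B (e n1)) m1) < eps /\
     normR (co (A (e n2)) m2 - co (B (e n2)) m2) < eps) ->
  exists b, symbol A b.
Proof.
move=> win Ab Acl.
have ex k : exists n, 0 < wprod w n (n + k).
  have [a ha] := win k 1 ltr01; exists a.
  rewrite /wprod big_nat; apply: prodr_gt0 => i /andP[ai iak].
  have := ha (i - a)%N; rewrite subnKC// subrr; apply.
  by rewrite ltn_subLR.
pose n_ k := projT1 (cid (ex k)).
have nP k : 0 < wprod w (n_ k) (n_ k + k) by rewrite /n_; case: cid.
pose W k := wprod w (n_ k) (n_ k + k).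
pose b k := co (A (e (n_ k))) (n_ k + k) * ((W k)^-1)%:C.
exists b; apply: (symbolP normE eONB) => // n m.
have eq0 (z : R[i]) : (forall eps : R, 0 < eps -> normR z <= eps) -> z = 0.
  exact: normR_small_eq0.
rewrite /entry; case: ifPn => [nm|mn]; last first.
  apply: eq0 => eps eps0; have [_ [p _ <-] [h _]] := Acl n m n m eps eps0.
  move: h; rewrite (symbol_entry eONB _ _ (symbol_poly normE eONB p wT)) /entry (negbTE mn).
  by rewrite subr0 => /ltW.
set k := (m - n)%N; have mE : m = (n + k)%N by rewrite subnKC.
have Wk0 : W k != 0 by rewrite gt_eqF//; exact: nP.
have Wk : (W k)%:C != 0 :> R[i] by rewrite -normR_eq0 normR_real normr_eq0.
have iW : ((W k)^-1)%:C * (W k)%:C = 1 :> R[i] by rewrite -rmorphM mulVf// rmorph1.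
apply: (mulIf Wk).
have -> : b k * (wprod w n m)%:C * (W k)%:C =
    co (A (e (n_ k))) (n_ k + k) * (wprod w n m)%:C * (((W k)^-1)%:C * (W k)%:C).
  by rewrite /b; ring.
rewrite iW mulr1.
apply/eqP; rewrite -subr_eq0; apply/eqP; apply: eq0 => eps eps0.
have e2 : 0 < eps / 2 by rewrite divr_gt0.
have [_ [p _ <-] [h1 h2]] := Acl n m (n_ k) (n_ k + k)%N _ e2.
have hp := symbol_poly normE eONB p wT.
move: h1 h2; rewrite !(symbol_entry eONB _ _ hp) /entry nm leq_addr addKn -/k -/(W k).
set a1 := co _ _; set a2 := co _ _; set c := p`_k; set v := wprod w n m => h1 h2.
have -> : a1 * (W k)%:C - a2 * v%:C = (a1 - c * v%:C) * (W k)%:C - (a2 - c * (W k)%:C) * v%:C.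
  by ring.
apply: le_trans (normRB _ _) _; rewrite !normRM !normR_real (splitr eps).
have W1 : `|W k| <= 1 by rewrite ger0_norm ?wprod_ge0 ?wprod_le1.
have v1 : `|v| <= 1 by rewrite ger0_norm ?wprod_ge0 ?wprod_le1.
apply: lerD; first by apply: le_trans (ltW h1); rewrite ler_piMr ?normR_ge0.
by apply: le_trans (ltW h2); rewrite ler_piMr ?normR_ge0.
Qed.

End closures.

(** * The disk algebra and bounded analytic functions *)

(** A relation that is an algebraic and isometric correspondence is the graph of
    an isometric isomorphism. *)
Lemma isometrically_isomorphic_rel (R : realType) (U V : lmodType R[i])
    (mulU : U -> U -> U) (normU : U -> R) (A : set U)
    (mulV : V -> V -> V) (normV : V -> R) (B : set V) (Rel : U -> V -> Prop) :
    (forall u, A u <-> exists g, Rel u g) ->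
    (forall g, B g <-> exists u, Rel u g) ->
    (forall u g g', Rel u g -> Rel u g' -> g = g') ->
    (forall u u' g, Rel u g -> Rel u' g -> u = u') ->
    (forall (c : R[i]) u u' g g', Rel u g -> Rel u' g' -> Rel (c *: u + u') (c *: g + g')) ->
    (forall u u' g g', Rel u g -> Rel u' g' -> Rel (mulU u u') (mulV g g')) ->
    (forall u g, Rel u g -> normV g = normU u) ->
  isometrically_isomorphic mulU normU A mulV normV B.
Proof.
move=> AE BE fn inj lin mul nrm.
pose phi u := xget 0 [set g | Rel u g].
have phiE u g : Rel u g -> phi u = g.
  by move=> h; apply: fn (h); exact: (xgetI 0 h).
exists phi; split.
- split.
  + by move=> u /AE[g h]; rewrite (phiE _ _ h); apply/BE; exists u.
  + move=> u v; rewrite !inE => /AE[g h] /AE[g' h'].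
    rewrite (phiE _ _ h) (phiE _ _ h') => gg; apply: inj h _.
    by rewrite gg.
  + by move=> g /BE[u h]; exists u; [apply/AE; exists g|exact: phiE].
- move=> c x y /AE[g h] /AE[g' h']; rewrite (phiE _ _ h) (phiE _ _ h').
  exact/phiE/lin.
- move=> x y /AE[g h] /AE[g' h']; rewrite (phiE _ _ h) (phiE _ _ h').
  exact/phiE/mul.
- by move=> x /AE[g h]; rewrite (phiE _ _ h) (nrm _ _ h).
Qed.

Section function_algebras.
Context {R : realType}.
Local Open Scope complex_scope.
Implicit Types (f g : R[i]^o -> R[i]^o) (b c : nat -> R[i]) (p : {poly R[i]}).

Definition expands b g := forall z : R[i], normR z < 1 -> psum b z (g z).

Lemma psum_poly p (z : R[i]) : psum (fun k => p`_k) z p.[z].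
Proof.
have := @csum_eventually0 _ (fun k => p`_k * z ^+ k) (size p).
rewrite -horner_coef; apply => n pn.
by rewrite nth_default// mul0r.
Qed.

Lemma expands_unique b c g : expands b g -> expands c g -> b = c.
Proof. by move=> bg cg; apply/funext; exact: (psum_coef_unique ltr01 bg cg). Qed.

Lemma expands_eq b f g (z : R[i]) : expands b f -> expands b g -> normR z < 1 -> f z = g z.
Proof. by move=> bf bg z1; exact: csum_unique (bf z z1) (bg z z1). Qed.

Lemma expands_lin (t : R[i]) b c f g : expands b f -> expands c g ->
  expands (fun k => t * b k + c k) (t *: f + g).
Proof.
move=> bf cg z z1; have := csumD (csumM t (bf z z1)) (cg z z1).
by apply: csum_ext => n; rewrite mulrDl mulrA.
Qed.

Lemma expands_mul b c f g : expands b f -> expands c g ->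
  expands (mul_series b c) (pointwise_mul f g).
Proof. by move=> bf cg z z1; exact: (Cauchy_product z1 bf cg). Qed.

Lemma expands_analytic b g (a : R[i]^o) : expands b g -> open_disk a -> analytic_at g a.
Proof. by move=> bg a1; exact: (psum_analytic a1 bg). Qed.

Lemma sup_norm_le E f (C : R) : E !=set0 -> (forall z, E z -> normR (f z) <= C) ->
  sup_norm E f <= C.
Proof.
move=> [z0 Ez0] h; apply: ge_sup; first by exists (normR (f z0)), z0.
by move=> _ [z Ez <-]; exact: h.
Qed.

Lemma sup_norm_ub E f (C : R) z : (forall z, E z -> normR (f z) <= C) -> E z ->
  normR (f z) <= sup_norm E f.
Proof.
move=> h Ez; apply: sup_upper_bound; last by exists z.
by split; [exists (normR (f z)), z|exists C => _ [u Eu <-]; exact: h].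
Qed.

Lemma open_disk0 : @open_disk R !=set0.
Proof. by exists 0; rewrite /open_disk /= normR0. Qed.

Lemma closed_disk0 : @closed_disk R !=set0.
Proof. by exists 0; rewrite /closed_disk /= normR0. Qed.

Lemma Hardy_infinityP g : Hardy_infinity g <-> [/\ vanishes_off open_disk g,
  exists M : R, forall z, open_disk z -> normR (g z) <= M & exists b, expands b g].
Proof.
split=> [[v [M hM] an]|[v [M hM] [b bg]]].
  split=> //; first by exists M.
  by have [b hb] := analytic_disk_psum an; exists b.
by split=> //; [exists M|move=> a; exact: (expands_analytic bg)].
Qed.

Lemma Hardy_infinity_lin (t : R[i]) f g : Hardy_infinity f -> Hardy_infinity g ->
  Hardy_infinity (t *: f + g).
Proof.
move=> /Hardy_infinityP[vf [M hM] [b bf]] /Hardy_infinityP[vg [N hN] [c cg]].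
apply/Hardy_infinityP; split.
- by move=> z zn; rewrite !fctE vf// vg// scaler0 addr0.
- exists (normR t * M + N) => z z1; rewrite !fctE.
  apply: le_trans (normRD _ _) _; rewrite -[t *: f z]/(t * f z).
  rewrite [X in X + _ <= _](_ : _ = normR t * normR (f z)); last exact: normRM.
  by apply: lerD; [rewrite ler_wpM2l ?normR_ge0// hM|exact: hN].
- by exists (fun k => t * b k + c k); exact: expands_lin.
Qed.

Lemma Hardy_infinity_mul f g : Hardy_infinity f -> Hardy_infinity g ->
  Hardy_infinity (pointwise_mul f g).
Proof.
move=> /Hardy_infinityP[vf [M hM] [b bf]] /Hardy_infinityP[vg [N hN] [c cg]].
apply/Hardy_infinityP; split.
- by move=> z zn; rewrite /pointwise_mul vf// mul0r.
- exists (M * N) => z z1; rewrite /pointwise_mul.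
  rewrite [X in X <= _](_ : _ = normR (f z) * normR (g z)); last exact: normRM.
  by apply: ler_pM; rewrite ?normR_ge0 ?hM ?hN.
- by exists (mul_series b c); exact: expands_mul.
Qed.

(** ** Continuity up to the boundary *)

Definition continuous_on_disk (g : R[i] -> R[i]) := forall z, normR z <= 1 ->
  forall eps : R, 0 < eps -> exists2 dl : R, 0 < dl &
  forall z', normR z' <= 1 -> normR (z' - z) < dl -> normR (g z' - g z) < eps.

Lemma within_continuous_disk g :
  {within closed_disk, continuous g} <-> continuous_on_disk g.
Proof.
split=> [/subspace_continuousP gc z z1 eps eps0|gc].
  have eC0 : (0 : R[i]) < eps%:C by rewrite ltcR.
  have /cvgrPdist_lt/(_ _ eC0) := gc z z1.
  rewrite /prop_near1 /within /= => /nbhs_ballP[dl /= dl0 h].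
  have dR : dl = (complex.Re dl)%:C by rewrite RRe_real// gtr0_real.
  exists (complex.Re dl); first by rewrite -ltcR -dR.
  move=> z' z'1 zz; have := h z'; rewrite -ball_normE /= dR normR_def ltcR normR_distC.
  by move=> /(_ zz z'1); rewrite normR_def ltcR normR_distC.
apply/subspace_continuousP => z z1; apply/cvgrPdist_lt => eps eps0.
have eR : eps = (complex.Re eps)%:C by rewrite RRe_real// gtr0_real.
have e0 : 0 < complex.Re eps by rewrite -ltcR -eR.
have [dl dl0 h] := gc z z1 _ e0.
rewrite /prop_near1 /within /=; apply/nbhs_ballP; exists dl%:C => /=; first by rewrite ltcR.
move=> z'; rewrite -ball_normE /= normR_def ltcR normR_distC => zz z'1.
by rewrite normR_def eR ltcR normR_distC; exact: h.
Qed.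

Lemma continuous_on_diskM f g : continuous_on_disk f -> continuous_on_disk g ->
  continuous_on_disk (fun z => f z * g z).
Proof.
move=> fc gc z z1 eps eps0.
pose t := normR (f z) + normR (g z) + 1.
have f0 := normR_ge0 (f z : R[i]); have g0 := normR_ge0 (g z : R[i]).
have t0 : 0 < t by rewrite /t; lra.
pose d := Num.min 1 (eps / 2 / t).
have d0 : 0 < d by rewrite lt_min ltr01 !divr_gt0.
have d1 : d <= 1 by rewrite ge_min lexx.
have dt : t * d <= eps / 2 by rewrite mulrC -ler_pdivlMr// ge_min lexx orbT.
have [d1' d1'0 h1] := fc z z1 d d0; have [d2' d2'0 h2] := gc z z1 d d0.
exists (Num.min d1' d2'); first by rewrite lt_min d1'0.
move=> z' z'1; rewrite lt_min => /andP[/(h1 _ z'1) hf /(h2 _ z'1) hg].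
have -> : f z' * g z' - f z * g z =
   (f z' - f z) * (g z' - g z) + ((f z' - f z) * g z + f z * (g z' - g z)) :> R[i] by ring.
apply: le_lt_trans (normRD _ _) _; apply: le_lt_trans (lerD (lexx _) (normRD _ _)) _.
rewrite !normRM.
have a1 : normR (f z' - f z : R[i]) * normR (g z' - g z : R[i]) <= d * 1.
  by apply: ler_pM; rewrite ?normR_ge0// ltW// (lt_le_trans hg).
have a2 : normR (f z' - f z : R[i]) * normR (g z : R[i]) <= d * normR (g z : R[i]).
  by rewrite ler_wpM2r// ltW.
have a3 : normR (f z : R[i]) * normR (g z' - g z : R[i]) <= normR (f z : R[i]) * d.
  by rewrite ler_wpM2l// ltW.
apply: le_lt_trans (lerD a1 (lerD a2 a3)) _.
have -> : d * 1 + (d * normR (g z : R[i]) + normR (f z : R[i]) * d) = t * d by rewrite /t; ring.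
by apply: le_lt_trans dt _; lra.
Qed.

Lemma continuous_on_diskD (f g : R[i] -> R[i]) : continuous_on_disk f ->
  continuous_on_disk g -> continuous_on_disk (fun z => f z + g z).
Proof.
move=> fc gc z z1 eps eps0; have e2 : 0 < eps / 2 by rewrite divr_gt0.
have [d1 d10 h1] := fc z z1 _ e2; have [d2 d20 h2] := gc z z1 _ e2.
exists (Num.min d1 d2); first by rewrite lt_min d10.
move=> z' z'1; rewrite lt_min => /andP[/(h1 _ z'1) hf /(h2 _ z'1) hg].
rewrite opprD addrACA (splitr eps); apply: le_lt_trans (normRD _ _) _.
exact: ltrD.
Qed.

Lemma continuous_on_disk_cst (t : R[i]) : continuous_on_disk (fun=> t).
Proof.
by move=> z z1 eps eps0; exists 1 => // z' _ _; rewrite subrr normR0.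
Qed.

Lemma continuous_on_disk_poly p : continuous_on_disk (fun z => p.[z]).
Proof.
elim/poly_ind: p => [|p t ih].
  by under eq_fun do rewrite horner0; exact: continuous_on_disk_cst.
under eq_fun do rewrite hornerMXaddC.
apply: continuous_on_diskD (continuous_on_disk_cst t).
apply: continuous_on_diskM => // z z1 eps eps0.
by exists eps.
Qed.

Lemma normR_radius j (z : R[i]) : normR z <= 1 -> normR ((radius j)%:C * z) < 1.
Proof.
move=> z1; rewrite normRM normR_real; have /andP[r0 r1] := @radius01 R j.
by rewrite ger0_norm//; apply: le_lt_trans r1; rewrite ler_piMr.
Qed.

Lemma tendsto_radial (g : R[i] -> R[i]) (z : R[i]) : continuous_on_disk g -> normR z <= 1 ->
  tendsto (fun j => g ((radius j)%:C * z)) (g z).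
Proof.
move=> gc z1 eps eps0; have [dl dl0 h] := gc z z1 eps eps0.
have := tendstoM tendsto_radius (@tendsto_cst _ _ z); rewrite mul1r.
move=> /(_ _ dl0)[N hN]; exists N => n /hN; apply: h.
exact/ltW/normR_radius.
Qed.

Lemma continuous_disk_bound (g : R[i] -> R[i]) (C : R) : continuous_on_disk g ->
  (forall z, normR z < 1 -> normR (g z) <= C) ->
  forall z, normR z <= 1 -> normR (g z) <= C.
Proof.
move=> gc gC z z1; apply: (tendsto_normR_le (N0 := 0) (tendsto_radial gc z1)) => n _.
exact/gC/normR_radius.
Qed.

Lemma disk_algebraP g : disk_algebra g <-> [/\ vanishes_off closed_disk g,
  continuous_on_disk g & exists b, expands b g].
Proof.
split=> [[v /within_continuous_disk c an]|[v c [b bg]]].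
  by split=> //; have [b hb] := analytic_disk_psum an; exists b.
by split=> //; [exact/within_continuous_disk|move=> a; exact: (expands_analytic bg)].
Qed.

Lemma disk_algebra_lin (t : R[i]) f g : disk_algebra f -> disk_algebra g ->
  disk_algebra (t *: f + g).
Proof.
move=> /disk_algebraP[vf fc [b bf]] /disk_algebraP[vg gc [c cg]].
apply/disk_algebraP; split.
- by move=> z zn; rewrite !fctE vf// vg// scaler0 addr0.
- apply: (@continuous_on_diskD (fun z => t * f z) g) => //.
  by apply: (@continuous_on_diskM (fun=> t)) => //; exact: continuous_on_disk_cst.
- by exists (fun k => t * b k + c k); exact: expands_lin.
Qed.

Lemma disk_algebra_mul f g : disk_algebra f -> disk_algebra g ->
  disk_algebra (pointwise_mul f g).
Proof.
move=> /disk_algebraP[vf fc [b bf]] /disk_algebraP[vg gc [c cg]].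
apply/disk_algebraP; split.
- by move=> z zn; rewrite /pointwise_mul vf// mul0r.
- exact: continuous_on_diskM.
- by exists (mul_series b c); exact: expands_mul.
Qed.

Lemma disk_algebra_eq b f g : disk_algebra f -> disk_algebra g ->
  expands b f -> expands b g -> f = g.
Proof.
move=> /disk_algebraP[vf fc _] /disk_algebraP[vg gc _] bf bg; apply/funext => z.
have [z1|zn] := pselect (@closed_disk R z); last by rewrite vf// vg.
apply: tendsto_unique (tendsto_radial fc z1) _.
apply: eq_tendsto (tendsto_radial gc z1) => j.
by apply: esym; apply: (expands_eq bf bg); exact: normR_radius.
Qed.

Lemma Hardy_infinity_eq b f g : Hardy_infinity f -> Hardy_infinity g ->
  expands b f -> expands b g -> f = g.
Proof.
move=> [vf _ _] [vg _ _] bf bg; apply/funext => z.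
have [z1|zn] := pselect (@open_disk R z); first exact: (expands_eq bf bg).
by rewrite vf// vg.
Qed.

Definition dilated_poly b L (r : R) : {poly R[i]} := \poly_(k < L) (b k * r%:C ^+ k).

Lemma horner_dilated_poly b L r z :
  (dilated_poly b L r).[z] = \sum_(k < L) b k * r%:C ^+ k * z ^+ k.
Proof. by rewrite horner_poly. Qed.

Lemma bounded_poly_approximation b g (C : R) : expands b g ->
  (forall z : R[i], normR z < 1 -> normR (g z) <= C) ->
  exists p : nat -> {poly R[i]},
    (forall j z, normR z <= 1 -> normR (p j).[z] <= C + 1) /\
    forall k, tendsto (fun j => (p j)`_k) (b k).
Proof.
move=> bg gC.
have ex j := dilation_approx (radius01 j) ltr01 bg.
pose L j := maxn (projT1 (cid (ex j))) j.+1.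
exists (fun j => dilated_poly b (L j) (radius j)); split.
  move=> j z z1; rewrite horner_dilated_poly.
  have := projT2 (cid (ex j)) (L j) (leq_maxl _ _) z z1.
  set S := \sum_(k < _) _ => h.
  have -> : S = g ((radius j)%:C * z) - (g ((radius j)%:C * z) - S).
    by rewrite opprB addrC subrK.
  apply: le_trans (normRB _ _) _; apply: lerD => //.
  exact/gC/normR_radius.
move=> k; have := tendstoMl (b k) (tendsto_radiusX k); rewrite mulr1 => h eps /h[N hN].
exists (maxn N k) => n; rewrite geq_max => /andP[Nn kn].
by rewrite coef_poly ifT ?hN// (leq_trans _ (leq_maxr _ _))// ltnS.
Qed.

Lemma poly_bound p : exists M : R, forall z, normR z <= 1 -> normR p.[z] <= M.
Proof.
exists (\sum_(k < size p) normR p`_k) => z z1; rewrite horner_coef.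
apply: le_trans (normR_sum _ _ _) _; apply: ler_sum => k _.
by rewrite normRM normRX ler_piMr ?normR_ge0// exprn_ile1// normR_ge0.
Qed.

Lemma disk_algebra_poly_dense b g (eps : R) : disk_algebra g -> expands b g -> 0 < eps ->
  exists p : {poly R[i]}, forall z : R[i], normR z <= 1 -> normR (g z - p.[z] : R[i]) <= eps.
Proof.
move=> /disk_algebraP[_ gc _] bg eps0; have e2 : 0 < eps / 2 by rewrite divr_gt0.
pose Q (a : R[i]) (dl : R) := forall z, normR z <= 1 -> normR (z - a) < dl ->
  normR (g z - g a : R[i]) <= eps / 2.
have Qmono a (d d' : R) : 0 < d' <= d -> Q a d -> Q a d'.
  by move=> /andP[_ dd] h z z1 za; apply: h => //; exact: lt_le_trans za dd.
have Qloc a : normR a <= 1 -> exists dl : R, 0 < dl /\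
    forall a', normR a' <= 1 -> normR (a' - a) < dl -> Q a' dl.
  move=> a1; have e4 : 0 < eps / 4 by rewrite divr_gt0.
  have [dl dl0 h] := gc a a1 _ e4; exists (dl / 2); split; first by rewrite divr_gt0.
  move=> a' a'1 aa z z1 za.
  have h1 : normR (g a' - g a : R[i]) < eps / 4 by apply: h => //; lra.
  have h2 : normR (g z - g a : R[i]) < eps / 4.
    by apply: h => //; apply: le_lt_trans (normR_tri a' _ _) _; lra.
  apply: le_trans (normR_tri (g a) _ _) _; rewrite [X in _ + X]normR_distC; lra.
have [dl [dl0 hQ]] := compact_uniform Qmono Qloc.
pose r := 1 - Num.min dl 1 / 2.
have m0 : 0 < Num.min dl 1 by rewrite lt_min dl0 ltr01.
have m1 : Num.min dl 1 <= 1 by rewrite ge_min lexx orbT.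
have m2 : Num.min dl 1 <= dl by rewrite ge_min lexx.
have r01 : 0 <= r < 1 by rewrite /r; apply/andP; split; lra.
have [L hL] := dilation_approx r01 e2 bg.
exists (dilated_poly b L r) => z z1; rewrite horner_dilated_poly.
apply: le_trans (normR_tri (g (r%:C * z)) _ _) _; rewrite (splitr eps).
apply: lerD; last exact: hL.
have /andP[r0 r1] := r01.
apply: hQ => //.
  by rewrite normRM normR_real ger0_norm// mulr_ile1 ?normR_ge0 ?(ltW r1).
have -> : z - r%:C * z = (1 - r)%:C * z by rewrite [in RHS]rmorphB rmorph1 mulrBl mul1r.
rewrite normRM normR_real ger0_norm; last by rewrite subr_ge0 ltW.
apply: le_lt_trans (_ : (1 - r) * 1 < _); first by rewrite ler_wpM2l// subr_ge0 ltW.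
by rewrite mulr1 /r; lra.
Qed.

(** A function on the open disk that is a uniform limit of polynomials extends
    to a member of the disk algebra: the polynomials are uniformly Cauchy on the
    closed disk by continuity. *)
Lemma disk_algebra_uniform_limit b f (p : nat -> {poly R[i]}) : expands b f ->
  (forall j z, normR z < 1 -> normR (f z - (p j).[z]) <= j.+1%:R^-1) ->
  exists2 g, disk_algebra g & expands b g.
Proof.
move=> bf fp.
have pp i j z : normR z <= 1 -> normR ((p i).[z] - (p j).[z]) <= i.+1%:R^-1 + j.+1%:R^-1.
  have c : continuous_on_disk (fun z => (p i).[z] - (p j).[z]).
    have -> : (fun z => (p i).[z] - (p j).[z]) = (fun z => (p i - p j).[z]).
      by apply/funext => u; rewrite hornerD hornerN.
    exact: continuous_on_disk_poly.
  apply: (continuous_disk_bound c) => u u1.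
  apply: le_trans (normR_tri (f u) _ _) _; rewrite normR_distC.
  by apply: lerD; exact: fp.
have small (eps : R) : 0 < eps -> exists N, forall j, (N <= j)%N -> j.+1%:R^-1 < eps :> R.
  move=> eps0; have := @cvg_harmonic R => /cvgrPdist_lt/(_ _ eps0)[N _ hN].
  exists N => j /hN; rewrite /harmonic /= sub0r normrN ger0_norm//.
have ex z : exists l, normR z <= 1 -> tendsto (fun j => (p j).[z]) l.
  have [z1|zn] := pselect (normR z <= 1); last by exists 0.
  have [l hl] : exists l, tendsto (fun j => (p j).[z]) l.
    apply: Cauchy_tendsto => eps eps0; have e2 : 0 < eps / 2 by rewrite divr_gt0.
    have [N hN] := small _ e2; exists N => m n Nm Nn.
    by apply: le_lt_trans (pp m n z z1) _; rewrite (splitr eps) ltrD ?hN.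
  by exists l.
pose g (z : R[i]^o) : R[i]^o := if normR z <= 1 then projT1 (cid (ex z)) else 0.
have gl z : normR z <= 1 -> tendsto (fun j => (p j).[z]) (g z).
  by move=> z1; rewrite /g ifT//; exact: (projT2 (cid (ex z))).
have gp j (z : R[i]) : normR z <= 1 -> normR (g z - (p j).[z] : R[i]) <= j.+1%:R^-1.
  move=> z1; apply/ler_addgt0Pl => eps eps0; have [N hN] := small _ eps0.
  have h := tendstoB (gl z z1) (@tendsto_cst _ _ (p j).[z]).
  apply: (tendsto_normR_le (N0 := N) h) => n Nn.
  by apply: le_trans (pp n j z z1) _; rewrite lerD2r ltW// hN.
have gf (z : R[i]) : normR z < 1 -> g z = f z.
  move=> z1; apply/eqP; rewrite -subr_eq0; apply/eqP; apply: normR_small_eq0 => eps eps0.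
  have e2 : 0 < eps / 2 by rewrite divr_gt0.
  have [N /(_ N (leqnn N)) hN] := small _ e2.
  have h1 := gp N z (ltW z1); have h2 := fp N z z1.
  apply: le_trans (normR_tri ((p N).[z] : R[i]^o) _ _) _; rewrite [X in _ + X]normR_distC.
  apply: le_trans (lerD h1 h2) _; move: hN; move: (N.+1%:R^-1) => x; lra.
have bg : expands b g by move=> z z1; rewrite gf//; exact: bf.
exists g => //; apply/disk_algebraP; split; last by exists b.
  by move=> z; rewrite /closed_disk /g /=; case: ifP.
move=> z z1 eps eps0; have e3 : 0 < eps / 3 by rewrite divr_gt0.
have [N /(_ N (leqnn N)) hN] := small _ e3.
have [dl dl0 h] := continuous_on_disk_poly (p N) z1 e3.
exists dl => // z' z'1 /(h _ z'1) hz.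
have h1 := gp N z z1; have h2 := gp N z' z'1.
have -> : g z' - g z = (g z' - (p N).[z']) + (((p N).[z'] - (p N).[z]) - (g z - (p N).[z])) :> R[i].
  by ring.
apply: le_lt_trans (normRD _ _) _; apply: le_lt_trans (lerD (lexx _) (normRB _ _)) _.
by move: hN h1 h2 hz; move: (N.+1%:R^-1) => x; lra.
Qed.

End function_algebras.

(** * Operator algebras generated by a weighted shift *)

Lemma uniform_threshold m (Q : 'I_m -> nat -> Prop) :
  (forall i, exists N, forall j, (N <= j)%N -> Q i j) ->
  exists N, forall j, (N <= j)%N -> forall i, Q i j.
Proof.
move=> h; exists (\max_(i < m) projT1 (cid (h i))) => j hj i.
apply: (projT2 (cid (h i))); apply: leq_trans hj.
exact: (leq_bigmax i).
Qed.

Section shift_algebras.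
Context {R : realType} {H : completeNormedModType R[i]}.
Variable ip : {dot H for Num.conj}.
Hypothesis normE : forall x : H, `|x| ^+ 2 = ip x x.
Variable e : nat -> H.
Hypothesis eONB : orthonormal_basis ip e.
Variable w : nat -> R.
Hypothesis w01 : forall i, 0 <= w i <= 1.
Hypothesis win : near_one_windows w.
Variable T : H -> H.
Hypothesis wT : weighted_shift e w T.
Local Open Scope complex_scope.
Local Notation co := (coord ip e).
Local Notation symbol := (symbol ip e w).
Implicit Types (A B : H -> H) (b c : nat -> R[i]) (p : {poly R[i]}).

Let Tb : bounded_operator T. Proof. by case: wT. Qed.

Lemma symbol_norm_le A b f (C : R) : symbol A b -> expands b f ->
  (forall z : R[i], normR z < 1 -> normR (f z) <= C) ->
  forall x, normR (A x) <= C * normR x.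
Proof.
move=> hA bf fC.
have [A' hA' A'C] := symbol_exists normE eONB (weight_norm_le1 w01) bf fC.
by rewrite (symbol_op_inj eONB hA hA').
Qed.

Lemma symbol_function A b : symbol A b -> exists f : R[i]^o -> R[i]^o,
  [/\ vanishes_off open_disk f, expands b f &
      forall z : R[i], normR z < 1 -> normR (f z) <= operator_norm A].
Proof.
move=> hA; have [Ab _] := hA.
have [f hf] := symbol_sup_le normE eONB w01 win hA (fun u => operator_norm_ub u Ab).
exists (fun z => if normR z < 1 then f z else 0); split.
- by move=> z; rewrite /open_disk /=; case: ifP.
- by move=> z z1; rewrite z1; case: (hf z z1).
- by move=> z z1; rewrite z1; case: (hf z z1).
Qed.

(** The difference of the two symbols is a symbol of 0, and the norm bounds the
    function that it represents. *)
Lemma symbol_coef_inj A b c : symbol A b -> symbol A c -> b = c.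
Proof.
move=> hb hc; have h := symbol_sub hb hc.
have h0 u : normR ((A - A) u) <= 0 * normR u by rewrite !fctE subrr normR0 mul0r.
have [f hf] := symbol_sup_le normE eONB w01 win h h0.
have f0 (z : R[i]) : normR z < 1 -> f z = 0.
  move=> /hf[_]; rewrite le_eqVlt ltNge normR_ge0 orbF normR_eq0.
  by move/eqP.
apply/funext => n; apply/eqP; rewrite -subr_eq0; apply/eqP.
apply: (@psum_coef_unique _ (fun k => b k - c k) (fun=> 0) (fun=> 0) 1 ltr01) => z z1.
  by rewrite -(f0 z z1); case: (hf z z1).
rewrite [X in psum _ _ X](_ : 0 = \sum_(k < 0) (fun k : nat => 0 * z ^+ k) k); last by rewrite big_ord0.
by apply: csum_eventually0 => k _; rewrite mul0r.
Qed.

(** Von Neumann's inequality gives one bound, the windows of weights close to 1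
    the other. *)
Lemma operator_norm_symbol A b f : symbol A b -> expands b f ->
  (exists M : R, forall z : R[i], normR z < 1 -> normR (f z) <= M) ->
  sup_norm open_disk f = operator_norm A.
Proof.
move=> hA bf [M fM]; have [Ab _] := hA; apply/eqP; rewrite eq_le; apply/andP; split.
  apply: sup_norm_le; first exact: open_disk0.
  have [f' [_ bf' f'A]] := symbol_function hA.
  by move=> z z1; rewrite (expands_eq bf bf' z1); exact: f'A.
have fS (z : R[i]) : normR z < 1 -> normR (f z) <= sup_norm open_disk f.
  by move=> z1; exact: (@sup_norm_ub _ open_disk f M z fM z1).
apply: operator_norm_le; last exact: symbol_norm_le hA bf fS.
by apply: le_trans (fS 0 _); rewrite ?normR_ge0 ?normR0.
Qed.

(** Polynomials in [T], uniformly bounded, approximate an operator with a symbol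
    entrywise, hence weakly and weak-star. *)
Lemma symbol_approximation A b : symbol A b -> exists (p : nat -> {poly R[i]}) (M : R),
  [/\ forall j, linear (A - poly_op T (p j)),
      forall j x, normR ((A - poly_op T (p j)) x) <= M * normR x &
      forall n m, tendsto (fun j => co ((A - poly_op T (p j)) (e n)) m) 0].
Proof.
move=> hA; have [Ab _] := hA; have [f [_ bf fC]] := symbol_function hA.
have [p [pC pb]] := bounded_poly_approximation bf fC.
set C := operator_norm A in fC pC.
have hD j := symbol_sub hA (symbol_poly normE eONB (p j) wT).
exists p, (C + (C + 1)); split.
- by move=> j; have [] := bounded_sub Ab (bounded_poly_op (p j) Tb).
- move=> j; apply: (symbol_norm_le (hD j) (f := fun z => f z - (p j).[z])) => z z1.
    have := csumB (bf z z1) (psum_poly (p j) z); apply: csum_ext => n.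
    by rewrite mulrBl.
  apply: le_trans (normRB (f z : R[i]) _) _; apply: lerD; first exact: fC.
  exact/pC/ltW.
- move=> n m.
  apply: (eq_tendsto (u := fun j => (b (m - n)%N - (p j)`_(m - n)%N) *
      (if (n <= m)%N then (wprod w n m)%:C else 0))).
    by move=> j; rewrite (symbol_entry eONB _ _ (hD j)) /entry; case: ifP; rewrite ?mulr0.
  have := tendstoM (tendstoB (@tendsto_cst _ _ (b (m - n)%N)) (pb (m - n)%N))
    (@tendsto_cst _ _ (if (n <= m)%N then (wprod w n m)%:C else 0)).
  by rewrite subrr mul0r.
Qed.

Lemma wot_closure_symbol :
  wot_closure ip (polynomials_in T) = [set A | exists b, symbol A b].
Proof.
apply/seteqP; split=> A.
  move=> [Ab Acl]; apply: (entrywise_closure_symbol normE eONB w01 wT win Ab).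
  move=> n1 m1 n2 m2 eps eps0.
  have [B pB hB] := Acl 2%N (fun i => if i == ord0 then e n1 else e n2)
    (fun i => if i == ord0 then e m1 else e m2) eps eps0.
  exists B => //; have := hB ord0; have := hB (lift ord0 ord0).
  by rewrite /= !ipBl.
move=> [b hA]; have [Ab _] := hA; split=> // m x y eps eps0.
have [p [M [Dl DM Dent]]] := symbol_approximation hA.
have [|N hN] := @uniform_threshold m (fun i j =>
    normR (ip (A (x i) - poly_op T (p j) (x i)) (y i)) < eps).
  move=> i; have [N hN] := bounded_entries_weak normE eONB Dl DM Dent (x i) (y i) eps0.
  by exists N => j /hN; rewrite subr0.
by exists (poly_op T (p N)); [exists (p N)|move=> i; exact: hN].
Qed.

(** Against this rank-one operator the trace reads off the matrix entry from
    [e_n] to [e_m], so weak-star neighbourhoods control entries. *)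
Definition matrix_unit n m : H -> H := fun x => ip x (e m) *: e n.

Lemma matrix_unit_bounded n m : bounded_operator (matrix_unit n m).
Proof.
split; first by move=> t x y; rewrite /matrix_unit ipDl ipZl scalerDl scalerA.
exists 1 => x; rewrite /matrix_unit normRZ (normR_basis normE eONB) mulr1 mul1r.
exact: (normR_co normE eONB).
Qed.

Lemma matrix_unit_trace_class n m : trace_class ip e (matrix_unit n m).
Proof.
split; first exact: matrix_unit_bounded.
exists (matrix_unit m m).
  split.
    split; first exact: matrix_unit_bounded.
    move=> x; rewrite /matrix_unit ipZl (ipC ip (e m)) conjM_normR ler0c.
    by rewrite exprn_ge0// normR_ge0.
  exists (matrix_unit m n).
    split; first exact: matrix_unit_bounded.
    move=> x y; rewrite /matrix_unit ipZl ipZr -(ipC ip); ring.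
  apply/funext => x; rewrite /matrix_unit /= !ipZl.
  by rewrite !(ip_basis eONB) !eqxx.
apply/cvg_ex; exists (\sum_(j < m.+1) ip (matrix_unit m m (e j)) (e j)).
apply/cvg_series_csum; apply: csum_eventually0 => j mj.
by rewrite /matrix_unit ipZl (ip_basis eONB) gtn_eqF// mul0r.
Qed.

Lemma trace_matrix_unit D n m : linear D ->
  trace ip e (D \o matrix_unit n m) = co (D (e n)) m.
Proof.
move=> Dl; rewrite /trace; apply: cvg_lim; first exact: norm_hausdorff.
apply/cvg_series_csum.
have tE j : ip ((D \o matrix_unit n m) (e j)) (e j) = (j == m)%:R * co (D (e n)) m.
  rewrite /= /matrix_unit (linearZ_op _ _ Dl) ipZl (ip_basis eONB).
  by have [->//|_] := eqVneq j m; rewrite !mul0r.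
have := @csum_eventually0 _ (fun j => ip ((D \o matrix_unit n m) (e j)) (e j)) m.+1.
rewrite big_ord_recr /= big1 ?add0r; last first.
  by move=> i _; rewrite tE ltn_eqF// mul0r.
rewrite tE eqxx mul1r; apply => j mj.
by rewrite tE gtn_eqF// mul0r.
Qed.

Lemma weak_star_closure_symbol :
  weak_star_closure ip e (polynomials_in T) = [set A | exists b, symbol A b].
Proof.
apply/seteqP; split=> A.
  move=> [Ab Acl]; apply: (entrywise_closure_symbol normE eONB w01 wT win Ab).
  move=> n1 m1 n2 m2 eps eps0.
  have [|B pB hB] := Acl 2%N (fun i => if i == ord0 then matrix_unit n1 m1
      else matrix_unit n2 m2) eps eps0.
    by move=> i; case: ifP => _; exact: matrix_unit_trace_class.
  exists B => //; have := hB ord0; have := hB (lift ord0 ord0).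
  have [p _ pB'] := pB.
  have [Dl _] : bounded_operator (A - B).
    by apply: bounded_sub => //; rewrite -pB'; exact: bounded_poly_op.
  by rewrite /= !(trace_matrix_unit _ _ Dl) !coB.
move=> [b hA]; have [Ab _] := hA; split=> // m K eps eps0 Ktr.
have [p [M [Dl DM Dent]]] := symbol_approximation hA.
have [N hN] := @uniform_threshold m (fun i j =>
    normR (trace ip e ((A - poly_op T (p j)) \o K i)) < eps)
  (fun i => bounded_entries_weak_star normE eONB Dl DM Dent (Ktr i) eps0).
by exists (poly_op T (p N)); [exists (p N)|move=> i; exact: hN].
Qed.

(** ** Isometric isomorphisms *)

Lemma wot_closure_Hardy : isometrically_isomorphic (@comp_op R H) (@operator_norm R H)
  [set A | exists b, symbol A b] pointwise_mul (sup_norm open_disk) (@Hardy_infinity R).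
Proof.
apply: (isometrically_isomorphic_rel (Rel := fun A g =>
  exists b, [/\ symbol A b, Hardy_infinity g & expands b g])).
- move=> A; split=> [[b hA]|[g [b [hA _ _]]]]; last by exists b.
  have [f [vf bf fC]] := symbol_function hA; exists f, b; split=> //.
  by apply/Hardy_infinityP; split=> //; [exists (operator_norm A)|exists b].
- move=> g; split=> [gH|[A [b [_ gH _]]]//].
  have /Hardy_infinityP[_ [M hM] [b bg]] := gH.
  have [A hA _] := symbol_exists normE eONB (weight_norm_le1 w01) bg hM.
  by exists A, b.
- move=> A g g' [b [hA gH bg]] [b' [hA' gH' bg']].
  rewrite (symbol_coef_inj hA' hA) in bg'.
  exact: Hardy_infinity_eq gH gH' bg bg'.
- move=> A A' g [b [hA gH bg]] [b' [hA' gH' bg']].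
  rewrite (expands_unique bg' bg) in hA'.
  exact: (symbol_op_inj eONB hA hA').
- move=> t A A' g g' [b [hA gH bg]] [b' [hA' gH' bg']].
  exists (fun k => t * b k + b' k); split; first exact: symbol_lin.
    exact: Hardy_infinity_lin.
  exact: expands_lin.
- move=> A A' g g' [b [hA gH bg]] [b' [hA' gH' bg']].
  exists (mul_series b b'); split; first exact: symbol_comp.
    exact: Hardy_infinity_mul.
  exact: expands_mul.
- move=> A g [b [hA gH bg]]; apply: operator_norm_symbol hA bg _.
  by have [_] := gH.
Qed.

(** The functions of the approximating polynomials converge uniformly on the
    open disk, by the isometry. *)
Lemma norm_closure_symbol A : norm_closure (polynomials_in T) A ->
  exists b g, [/\ symbol A b, disk_algebra g & expands b g].
Proof.
move=> [Ab Acl].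
have Bb B : polynomials_in T B -> bounded_operator B.
  by move=> [p _ <-]; exact: bounded_poly_op.
have [b hA] : exists b, symbol A b.
  apply: (entrywise_closure_symbol normE eONB w01 wT win Ab) => n1 m1 n2 m2 eps eps0.
  have [B pB hB] := Acl eps eps0; exists B => //.
  have h n m : normR (co (A (e n)) m - co (B (e n)) m) < eps.
    rewrite -coB; apply: le_lt_trans (normR_co normE eONB _ _) _.
    apply: le_lt_trans hB.
    have := operator_norm_ub (e n) (bounded_sub Ab (Bb B pB)).
    by rewrite (normR_basis normE eONB) mulr1.
  by [].
have [f [_ bf _]] := symbol_function hA.
have ex j : exists p, operator_norm (A - poly_op T p) < j.+1%:R^-1.
  have j0 : (0 : R) < j.+1%:R^-1 by rewrite invr_gt0 ltr0n.
  by have [_ [p _ <-] hp] := Acl _ j0; exists p.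
have [|g gD bg] := @disk_algebra_uniform_limit R b f (fun j => projT1 (cid (ex j))) bf.
  move=> j z z1; case: cid => p /= hp.
  have hD := symbol_sub hA (symbol_poly normE eONB p wT).
  have [h [_ bh hC]] := symbol_function hD.
  have -> : f z - p.[z] = h z.
    apply: csum_unique (bh z z1); have := csumB (bf z z1) (psum_poly p z).
    by apply: csum_ext => n; rewrite mulrBl.
  exact: le_trans (hC z z1) (ltW hp).
by exists b, g.
Qed.

(** Polynomials are dense in the disk algebra, and the calculus is contractive. *)
Lemma disk_algebra_symbol b g : disk_algebra g -> expands b g ->
  exists2 A, norm_closure (polynomials_in T) A & symbol A b.
Proof.
move=> gD bg; have dense eps := @disk_algebra_poly_dense R b g eps gD bg.
have [M gM] : exists M : R, forall z : R[i], normR z < 1 -> normR (g z) <= M.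
  have [p hp] := dense 1 ltr01; have [M hM] := poly_bound p.
  exists (1 + M) => z z1; rewrite -[g z](subrK (p.[z] : R[i]^o)).
  apply: le_trans (normRD _ _) _; apply: lerD; [exact: (hp z (ltW z1))|exact: (hM z (ltW z1))].
have [A hA _] := symbol_exists normE eONB (weight_norm_le1 w01) bg gM.
exists A => //; have [Ab _] := hA; split=> // eps eps0.
have e2 : 0 < eps / 2 by rewrite divr_gt0.
have [p hp] := dense _ e2; exists (poly_op T p); first by exists p.
apply: le_lt_trans (_ : eps / 2 < _); last lra.
apply: operator_norm_le; first exact: ltW.
have hD := symbol_sub hA (symbol_poly normE eONB p wT).
apply: (symbol_norm_le hD (f := fun z => g z - p.[z])) => z z1; last exact: (hp z (ltW z1)).
have := csumB (bg z z1) (psum_poly p z); apply: csum_ext => n.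
by rewrite mulrBl.
Qed.

Lemma norm_closure_disk_algebra :
  isometrically_isomorphic (@comp_op R H) (@operator_norm R H)
    (norm_closure (polynomials_in T)) pointwise_mul (sup_norm closed_disk) (@disk_algebra R).
Proof.
apply: (isometrically_isomorphic_rel (Rel := fun A g =>
  exists b, [/\ symbol A b, disk_algebra g & expands b g])).
- move=> A; split=> [/norm_closure_symbol[b [g [hA gD bg]]]|[g [b [hA gD bg]]]].
    by exists g, b.
  have [A' hA' sA'] := disk_algebra_symbol gD bg.
  by rewrite (symbol_op_inj eONB hA sA').
- move=> g; split=> [gD|[A [b [_ gD _]]]//].
  have /disk_algebraP[_ _ [b bg]] := gD.
  by have [A _ hA] := disk_algebra_symbol gD bg; exists A, b.
- move=> A g g' [b [hA gH bg]] [b' [hA' gH' bg']].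
  rewrite (symbol_coef_inj hA' hA) in bg'.
  exact: disk_algebra_eq gH gH' bg bg'.
- move=> A A' g [b [hA gH bg]] [b' [hA' gH' bg']].
  rewrite (expands_unique bg' bg) in hA'.
  exact: (symbol_op_inj eONB hA hA').
- move=> t A A' g g' [b [hA gH bg]] [b' [hA' gH' bg']].
  exists (fun k => t * b k + b' k); split; first exact: symbol_lin.
    exact: disk_algebra_lin.
  exact: expands_lin.
- move=> A A' g g' [b [hA gH bg]] [b' [hA' gH' bg']].
  exists (mul_series b b'); split; first exact: symbol_comp.
    exact: disk_algebra_mul.
  exact: expands_mul.
- move=> A g [b [hA gD bg]].
  have /disk_algebraP[_ gc _] := gD.
  have [f [_ bf fA]] := symbol_function hA.
  have gA (z : R[i]) : normR z < 1 -> normR (g z) <= operator_norm A.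
    by move=> z1; rewrite (expands_eq bg bf z1); exact: fA.
  have gA' := continuous_disk_bound gc gA.
  have open := operator_norm_symbol hA bg (ex_intro _ _ gA).
  apply/eqP; rewrite eq_le; apply/andP; split.
    apply: sup_norm_le; [exact: closed_disk0|exact: gA'].
  rewrite -open; apply: sup_norm_le; first exact: open_disk0.
  by move=> z /ltW z1; exact: (@sup_norm_ub _ closed_disk g _ z gA' z1).
Qed.

(** ** Commutants *)

Lemma symbol_shift : symbol T (fun k => (k == 1%N)%:R).
Proof.
have := symbol_poly normE eONB 'X wT.
have -> : poly_op T 'X = T.
  apply/funext => x; rewrite /poly_op size_polyX big_ord_recr big_ord1 /=.
  by rewrite !coefX scale0r add0r scale1r.
by rewrite (_ : (fun k => _) = (fun k => (k == 1%N)%:R))//; apply/funext => k; rewrite coefX.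
Qed.

Lemma mul_seriesC b c : mul_series b c = mul_series c b.
Proof.
apply/funext => n; rewrite /mul_series (reindex_inj rev_ord_inj) /=.
apply: eq_bigr => k _; rewrite subSS mulrC; congr (_ * _).
by congr (c _); have := ltn_ord k; lia.
Qed.

Lemma symbol_commute A B b c : symbol A b -> symbol B c -> A \o B = B \o A.
Proof.
move=> hA hB; apply: (symbol_op_inj eONB (symbol_comp normE eONB hA hB)).
by rewrite mul_seriesC; exact: symbol_comp.
Qed.

Hypothesis w_neq0 : forall i, w i != 0.

Lemma wprod_neq0 n m : wprod w n m != 0.
Proof. by rewrite prodf_seq_neq0; apply/allP => i _; rewrite w_neq0. Qed.

(** An operator commuting with [T] is determined by the image of [e_0], since
    [T^n e_0] is a nonzero multiple of [e_n]; that image gives the symbol. *)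
Lemma commutant_symbol : commutant [set T] = [set A | exists b, symbol A b].
Proof.
apply/seteqP; split=> A; last first.
  move=> [b hA]; have [Ab _] := hA; split=> // _ ->.
  exact: symbol_commute hA symbol_shift.
move=> [Ab /(_ T erefl) AT]; have [Al _] := Ab.
exists (fun k => co (A (e 0)) k / (wprod w 0 k)%:C).
apply: (symbolP normE eONB) => // n m.
have comm k x : A (iter k T x) = iter k T (A x).
  elim: k => // k ih; rewrite !iterS -ih.
  by have := congr1 (@^~ (iter k T x)) AT.
have hTn := symbol_poly normE eONB 'X^n wT.
have TnE x : poly_op T 'X^n x = iter n T x.
  rewrite /poly_op size_polyXn big_ord_recr /= big1 ?add0r.
    by rewrite coefXn eqxx scale1r.
  by move=> i _; rewrite coefXn ltn_eqF// scale0r.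
have Wn : (wprod w 0 n)%:C != 0 :> R[i] by rewrite -normR_eq0 normR_real normr_eq0 wprod_neq0.
apply: (mulIf Wn).
have -> : co (A (e n)) m * (wprod w 0 n)%:C = co (iter n T (A (e 0))) m.
  by rewrite -comm (iter_shift _ _ wT) add0n (linearZ_op _ _ Al) coZ mulrC.
rewrite -TnE; have [_ ->] := hTn; rewrite /entry; case: ifPn => [nm|mn]; last first.
  rewrite mul0r; apply: big1 => i _; rewrite coefXn (_ : (_ == _) = false) ?mul0r//.
  by have := ltn_ord i; move: mn; lia.
have mn : (m - n < m.+1)%N by lia.
rewrite (bigD1 (Ordinal mn))//= big1 ?addr0; last first.
  move=> i; rewrite -(inj_eq val_inj)/= coefXn => h; rewrite (_ : (_ == _) = false) ?mul0r//.
  by have := ltn_ord i; move: h; lia.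
rewrite coefXn (_ : (_ == _) = true) ?mul1r; last by lia.
have W0 k : (wprod w 0 k)%:C != 0 :> R[i] by rewrite -normR_eq0 normR_real normr_eq0 wprod_neq0.
apply: (mulIf (W0 (m - n)%N)).
have e1 : (wprod w 0 (m - n))%:C * (wprod w (m - n) m)%:C =
    (wprod w n m)%:C * (wprod w 0 n)%:C :> R[i].
  rewrite -!rmorphM; congr _%:C; rewrite -(wprod_cat w (leq0n _) (leq_subr n m)).
  by rewrite mulrC -(wprod_cat w (leq0n _) nm).
rewrite [LHS](_ : _ = co (A (e 0)) (m - n) *
  ((wprod w 0 (m - n))%:C * (wprod w (m - n) m)%:C)); last by ring.
by rewrite e1; field; exact: W0.
Qed.

Lemma double_commutant_symbol : commutant (commutant [set T]) = [set A | exists b, symbol A b].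
Proof.
apply/seteqP; split=> A.
  move=> [Ab Acom]; rewrite -commutant_symbol; split=> // _ ->.
  by apply: Acom; rewrite commutant_symbol; exists (fun k => (k == 1%N)%:R); exact: symbol_shift.
move=> [b hA]; have [Ab _] := hA; split=> // B.
by rewrite commutant_symbol => -[c hB]; exact: symbol_commute hA hB.
Qed.

End shift_algebras.

(** * Multipliers of weighted Hardy spaces *)

Section uniform_boundedness.
Context {R : realType} {H : completeNormedModType R[i]}.
Local Open Scope complex_scope.

(** The uniform boundedness principle by a gliding hump: a step [+- y] can be
    chosen so as not to decrease the image under the next operator, since
    [2 |S y| <= |S (x + y)| + |S (x - y)|]. *)
Lemma uniform_boundedness (S : nat -> H -> H) : (forall N, bounded_operator (S N)) ->
  (forall x, exists C : R, forall N, normR (S N x) <= C) ->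
  exists2 M : R, 0 <= M & forall N x, normR (S N x) <= M * normR x.
Proof.
move=> Sb Spt; apply: contrapT => nM.
have big k : exists N, 4 ^+ k < operator_norm (S N).
  apply: contrapT => h; apply: nM; exists (4 ^+ k); first by rewrite exprn_ge0.
  move=> N x; apply: le_trans (operator_norm_ub x (Sb N)) _.
  rewrite ler_wpM2r ?normR_ge0// leNgt; apply/negP => h'.
  by apply: h; exists N.
pose N k := projT1 (cid (big k)).
pose t k := operator_norm (S (N k)).
have t4 k : 4 ^+ k < t k by rewrite /t /N; case: cid.
have t0 k : 0 < t k by apply: le_lt_trans (t4 k); rewrite exprn_ge0.
pose q : R := 3^-1.
have q0 : 0 < q by rewrite invr_gt0.
have exy k : exists y, normR y <= q ^+ k /\ 2 / 3 * t k * q ^+ k <= normR (S (N k) y).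
  have t3 : 0 < t k / 3 by rewrite divr_gt0.
  have [_ [x /= x1 <-] hx] := sup_adherent t3 (opset_has_sup (Sb (N k))).
  have qk : 0 < q ^+ k by rewrite exprn_gt0.
  exists ((q ^+ k)%:C *: x); have [Sl _] := Sb (N k).
  rewrite (linearZ_op _ _ Sl) !normRZ normR_real ger0_norm ?(ltW qk)//.
  split; first by rewrite ler_piMr// ltW.
  rewrite mulrC ler_pM2l//; apply: ltW; apply: le_lt_trans hx.
  by rewrite -/(operator_norm _) -/(t k); lra.
pose y k := projT1 (cid (exy k)).
have y1 k : normR (y k) <= q ^+ k by rewrite /y; case: cid => ? [].
have y2 k : 2 / 3 * t k * q ^+ k <= normR (S (N k) (y k)) by rewrite /y; case: cid => ? [].
pose x := fix x k : H := if k is k'.+1 then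
    (if normR (S (N k') (y k')) <= normR (S (N k') (x k' + y k'))
     then x k' + y k' else x k' - y k') else 0.
have xS k : normR (x k.+1 - x k) <= q ^+ k.
  rewrite /=; case: ifP => _.
    by rewrite addrAC subrr add0r.
  by rewrite addrAC subrr add0r normRN.
have xbig k : 2 / 3 * t k * q ^+ k <= normR (S (N k) (x k.+1)).
  apply: le_trans (y2 k) _; rewrite /=; case: ifPn => //; rewrite -ltNge => lt.
  have [Sl _] := Sb (N k).
  have : normR (S (N k) (y k)) *+ 2 <=
      normR (S (N k) (x k + y k)) + normR (S (N k) (x k - y k)).
    apply: le_trans (normRB _ _); rewrite -(linearB_op _ _ Sl).
    have -> : x k + y k - (x k - y k) = 2%:R%:C *: y k.
      by rewrite opprB addrC addrA subrK rmorph_nat scaler_nat mulr2n.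
    by rewrite (linearZ_op _ _ Sl) normRZ normR_real ger0_norm// mulr_natl.
  lra.
have xx n m : (n <= m)%N -> normR (x m - x n) <= 3 / 2 * q ^+ n.
  move=> nm; apply: le_trans (_ : 3 / 2 * (q ^+ n - q ^+ m) <= _); last first.
    by rewrite ler_pM2l// gerBl exprn_ge0// ltW.
  rewrite -(subnKC nm); elim: (m - n)%N => [|k ih].
    by rewrite addn0 !subrr mulr0 normR0.
  rewrite addnS; apply: le_trans (normR_tri (x (n + k)%N) _ _) _.
  apply: le_trans (lerD (xS _) ih) _.
  have -> : q ^+ (n + k).+1 = q ^+ (n + k) / 3 by rewrite exprS mulrC.
  lra.
have qpow (C : R) : (fun n => C * q ^+ n) @ \oo --> (0 : R).
  rewrite -[X in _ --> X](mulr0 C); apply: cvgM; first exact: cvg_cst.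
  by apply: cvg_expr; rewrite ger0_norm ?(ltW q0)// /q invf_lt1// ltr1n.
have [z hz] : exists z, tendsto x z.
  apply: Cauchy_tendsto_complete => eps eps0; have e2 : 0 < eps / 2 by rewrite divr_gt0.
  move/cvgrPdist_lt/(_ _ e2) : (qpow (3 / 2)) => [n0 _ /(_ n0 (leqnn n0))].
  rewrite /= sub0r normrN => /(le_lt_trans (ler_norm _)) h; exists n0 => m n n0m n0n.
  apply: le_lt_trans (normR_tri (x n0) _ _) _; rewrite (splitr eps); apply: ltrD.
    exact: le_lt_trans (xx _ _ n0m) h.
  by rewrite normR_distC; exact: le_lt_trans (xx _ _ n0n) h.
have xz n : normR (z - x n) <= 3 / 2 * q ^+ n.
  apply: (tendsto_normR_le (N0 := n) (tendstoB hz (@tendsto_cst _ _ (x n)))) => m nm.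
  exact: xx.
have [C hC] := Spt z.
have key k : t k * q ^+ k / 6 <= C.
  apply: le_trans (hC (N k)); have [Sl _] := Sb (N k).
  have -> : z = x k.+1 + (z - x k.+1) by rewrite addrC subrK.
  rewrite (linearD_op _ _ Sl).
  have h1 := xbig k.
  have h2 : normR (S (N k) (z - x k.+1)) <= t k * (q ^+ k / 2).
    apply: le_trans (operator_norm_ub _ (Sb (N k))) _.
    rewrite -/(t k) ler_pM2l//; apply: le_trans (xz k.+1) _; rewrite exprS /q; lra.
  have h3 := normRB (S (N k) (x k.+1) + S (N k) (z - x k.+1)) (S (N k) (z - x k.+1)).
  rewrite addrK in h3; lra.
have q34 : (fun k => (6 * C + 1) * (3 / 4) ^+ k) @ \oo --> (0 : R).
  rewrite -[X in _ --> X](mulr0 (6 * C + 1)); apply: cvgM; first exact: cvg_cst.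
  by apply: cvg_expr; rewrite ger0_norm//; lra.
move/cvgrPdist_lt/(_ _ ltr01) : q34 => [k _ /(_ k (leqnn k))].
rewrite /= sub0r normrN => /(le_lt_trans (ler_norm _)); apply/negP; rewrite -leNgt.
have p0 : 0 < (3 / 4 : R) ^+ k by rewrite exprn_gt0// divr_gt0.
have e1 : 4 ^+ k * q ^+ k * (3 / 4) ^+ k = 1.
  by rewrite -!exprMn (_ : 4 * q * (3 / 4) = 1) ?expr1n// /q; field.
have : 4 ^+ k * q ^+ k <= 6 * C.
  have := key k; have : 4 ^+ k * q ^+ k <= t k * q ^+ k.
    by rewrite ler_pM2r ?exprn_gt0// ltW.
  lra.
move=> h; apply: (@le_trans _ _ (6 * C * (3 / 4) ^+ k)).
  by rewrite -[leLHS]e1 ler_wpM2r// ltW.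
by rewrite ler_pM2r// lerDl.
Qed.

End uniform_boundedness.

Section multipliers.
Context {R : realType} {H : completeNormedModType R[i]}.
Variable ip : {dot H for Num.conj}.
Hypothesis normE : forall x : H, `|x| ^+ 2 = ip x x.
Variable e : nat -> H.
Hypothesis eONB : orthonormal_basis ip e.
Variable w : nat -> R.
Hypothesis w01 : forall i, 0 <= w i <= 1.
Hypothesis win : near_one_windows w.
Hypothesis w_neq0 : forall i, w i != 0.
Local Open Scope complex_scope.
Local Notation co := (coord ip e).
Local Notation symbol := (symbol ip e w).
Implicit Types (a b : nat -> R[i]^o) (x : H).

Let weightE n : weight w n = wprod w 0 n.
Proof. by rewrite /weight /wprod big_mkord. Qed.

Let W0 n : (wprod w 0 n)%:C != 0 :> R[i].
Proof. by rewrite -normR_eq0 normR_real normr_eq0 wprod_neq0. Qed.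

(** The unitary between the weighted Hardy space and [H] as a relation. *)
Definition realizes a x := forall n, co x n = a n * (wprod w 0 n)%:C.

Lemma square_terms_nsq a N :
  series (square_terms w a) N = nsq N (fun n => a n * (wprod w 0 n)%:C).
Proof.
rewrite /series /= big_mkord; apply: eq_bigr => n _.
by rewrite /square_terms weightE normRM exprMn normR_real real_normK ?num_real.
Qed.

Lemma realizes_Hardy a x : realizes a x -> Hardy_space w a /\ Hardy_norm w a = normR x.
Proof.
move=> ax; have h : series (square_terms w a) @ \oo --> normR x ^+ 2.
  rewrite (_ : series _ = (fun N => nsq N (co x))); first exact: (Parseval normE eONB).
  by apply/funext => N; rewrite square_terms_nsq (funext ax).
split; first by apply/cvg_ex; exists (normR x ^+ 2).
by rewrite /Hardy_norm (cvg_lim (@Rhausdorff R) h) sqrtr_sqr ger0_norm ?normR_ge0.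
Qed.

Lemma Hardy_realizes a : Hardy_space w a -> exists x, realizes a x.
Proof.
move=> ha; apply: (Riesz_Fischer normE eONB (M := limn (series (square_terms w a)))) => N.
rewrite -square_terms_nsq; apply: nondecreasing_cvgn_le => //.
apply/nondecreasing_seqP => n; rewrite /series /= big_nat_recr //= lerDl.
by rewrite /square_terms mulr_ge0 ?sqr_ge0.
Qed.

Lemma exists_realizes x : exists a, realizes a x.
Proof. by exists (fun n => co x n / (wprod w 0 n)%:C) => n; rewrite divfK. Qed.

Lemma mul_series_weight b a x m : realizes a x ->
  mul_series b a m * (wprod w 0 m)%:C =
  \sum_(n < m.+1) b (m - n)%N * (wprod w n m)%:C * co x n.
Proof.
move=> ax; rewrite (_ : mul_series b a m = mul_series a b m); last first.
  by rewrite (mul_seriesC (b : nat -> R[i]) a).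
rewrite /mul_series mulr_suml; apply: eq_bigr => n _.
have nm : (n <= m)%N by rewrite -ltnS.
by rewrite ax (wprod_cat w (leq0n n) nm) rmorphM /=; ring.
Qed.

Lemma symbol_realizes A b a x : symbol A b -> realizes a x ->
  realizes (mul_series b a) (A x).
Proof. by move=> [_ hA] ax m; rewrite hA (mul_series_weight b m ax). Qed.

(** Multiplication by a multiplier is everywhere defined, and each coordinate of
    the product depends on finitely many coefficients, so that the uniform
    boundedness principle applies to its truncations. *)
Lemma multiplier_symbol b : multiplier_algebra w b -> exists A, symbol A b.
Proof.
move=> hb.
have ex x : exists y, forall m, co y m =
    \sum_(n < m.+1) b (m - n)%N * (wprod w n m)%:C * co x n.
  have [a ax] := exists_realizes x; have [Ha _] := realizes_Hardy ax.
  have [y hy] := Hardy_realizes (hb a Ha); exists y => m.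
  by rewrite hy (mul_series_weight b m ax).
pose A x := projT1 (cid (ex x)).
have AE x m : co (A x) m = \sum_(n < m.+1) b (m - n)%N * (wprod w n m)%:C * co x n.
  by rewrite /A; case: cid.
have Al : linear A.
  move=> t x y; apply: (co_inj eONB) => m; rewrite coD coZ !AE mulr_sumr -big_split /=.
  by apply: eq_bigr => n _; rewrite coD coZ; ring.
have row m : exists2 C : R, 0 <= C & forall x, normR (co (A x) m) <= C * normR x.
  exists (\sum_(n < m.+1) normR (b (m - n)%N * (wprod w n m)%:C : R[i])).
    by apply: sumr_ge0 => n _; rewrite normR_ge0.
  move=> x; rewrite AE mulr_suml; apply: le_trans (normR_sum _ _ _) _.
  apply: ler_sum => n _; rewrite normRM ler_wpM2l ?normR_ge0//.
  exact: (normR_co normE eONB).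
pose S N x := comb e N (co (A x)).
have Sb N : bounded_operator (S N).
  split.
    move=> t x y; apply: (co_inj eONB) => m; rewrite coD coZ !(co_comb eONB) Al coD coZ.
    by case: ifP => _ //; rewrite mulr0 addr0.
  exists (\sum_(m < N) projT1 (cid2 (row m))) => x; rewrite mulr_suml.
  apply: le_trans (normR_sum _ _ _) _; apply: ler_sum => m _.
  rewrite normRZ (normR_basis normE eONB) mulr1.
  by case: cid2 => /= C C0; apply.
have SA N x : normR (S N x) <= normR (A x).
  rewrite -(@ler_pXn2r _ 2)// ?nnegrE ?normR_ge0// (normR_comb normE eONB).
  exact: (Bessel normE eONB).
have pt x : exists C : R, forall N, normR (S N x) <= C by exists (normR (A x)).
have [M M0 hM] := uniform_boundedness Sb pt.
exists A; split=> //; split=> //; exists M => x.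
rewrite -(@ler_pXn2r _ 2)// ?nnegrE ?normR_ge0 ?mulr_ge0 ?normR_ge0//.
apply: (normR_sqr_le normE eONB) => N; rewrite -(normR_comb normE eONB).
by rewrite lerXn2r ?nnegrE ?normR_ge0 ?mulr_ge0 ?normR_ge0// hM.
Qed.

Lemma multiplier_norm_symbol A b : symbol A b -> multiplier_norm w b = operator_norm A.
Proof.
move=> hA; congr sup; apply/seteqP; split=> r.
  move=> [a [Ha a1] <-]; have [x ax] := Hardy_realizes Ha.
  have [_ nx] := realizes_Hardy ax; exists x => /=; first by rewrite -nx.
  by have [_ ->] := realizes_Hardy (symbol_realizes hA ax).
move=> [x /= x1 <-]; have [a ax] := exists_realizes x; have [Ha na] := realizes_Hardy ax.
exists a => /=; first by rewrite na.
by have [_ ->] := realizes_Hardy (symbol_realizes hA ax).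
Qed.

Lemma symbol_multiplier A b : symbol A b -> multiplier_algebra w b.
Proof.
move=> hA a /Hardy_realizes[x ax].
by have [] := realizes_Hardy (symbol_realizes hA ax).
Qed.

Lemma multiplier_algebra_Hardy_infinity : isometrically_isomorphic mul_series
  (multiplier_norm w) (multiplier_algebra w) pointwise_mul (sup_norm open_disk)
  (@Hardy_infinity R).
Proof.
have sym (b : nat -> R[i]^o) g : Hardy_infinity g -> expands b g -> exists A, symbol A b.
  move=> /Hardy_infinityP[_ [M hM] _] bg.
  by have [A hA _] := symbol_exists normE eONB (weight_norm_le1 w01) bg hM; exists A.
apply: (isometrically_isomorphic_rel (Rel := fun b g => Hardy_infinity g /\ expands b g)).
- move=> b; split=> [/multiplier_symbol[A hA]|[g [gH bg]]]; last first.
    by have [A hA] := sym b g gH bg; exact: symbol_multiplier hA.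
  have [f [vf bf fC]] := symbol_function normE eONB w01 win hA; exists f; split=> //.
  by apply/Hardy_infinityP; split=> //; [exists (operator_norm A)|exists b].
- move=> g; split=> [gH|[b []//]].
  by have /Hardy_infinityP[_ _ [b bg]] := gH; exists b.
- by move=> b g g' [gH bg] [gH' bg']; exact: Hardy_infinity_eq gH gH' bg bg'.
- by move=> b b' g [_ bg] [_ bg']; exact: expands_unique bg bg'.
- move=> t b b' g g' [gH bg] [gH' bg']; split; first exact: Hardy_infinity_lin.
  exact: expands_lin.
- move=> b b' g g' [gH bg] [gH' bg']; split; first exact: Hardy_infinity_mul.
  exact: expands_mul.
- move=> b g [gH bg]; have [A hA] := sym b g gH bg; have [_ gM _] := gH.
  by rewrite (multiplier_norm_symbol hA) (operator_norm_symbol normE eONB w01 win hA bg gM).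
Qed.

End multipliers.

(** * Almost sure properties of the weights *)

Section weights.
Context {R : realType} {d : measure_display} {Omega : measurableType d}.
Context {P : probability Omega R}.
Variable X : nat -> {RV P >-> R}.
Hypothesis X_ident : identically_distributed X.

Lemma measurable_ball_real (c r : R) : measurable (ball c r).
Proof. by rewrite ball_itv; exact: measurable_itv. Qed.

Lemma prob_preimage n (B : set R) : measurable B ->
  P (X n @^-1` B) = P (X 0%N @^-1` B).
Proof. by move=> mB; have := X_ident n mB. Qed.

Lemma measurable_preimage n (B : set R) : measurable B -> measurable (X n @^-1` B).
Proof. by move=> mB; rewrite -[X in measurable X]setTI; exact: measurable_funP. Qed.

(** The complement of the closed support is null, being covered by the null
    balls with rational centre and radius. *)
Lemma ae_le_max_essran n (m : R) : ubound (essran (X 0%N)) m ->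
  {ae P, forall omega, X n omega <= m}.
Proof.
move=> ub.
pose D : set R -> \bar R := distribution P (X 0%N).
pose F k : set R := if @unpickle (rat * rat)%type k is Some qr then
  let B := ball (ratr qr.1 : R) (ratr qr.2) in
  if pselect (D B = 0%E) is left _ then B else set0 else set0.
have mF k : measurable (F k).
  rewrite /F; case: unpickle => // qr; case: pselect => _ //.
  exact: measurable_ball_real.
have F0 k : P (X n @^-1` F k) = 0%E.
  rewrite prob_preimage// /F; case: unpickle => [qr|]; last by rewrite preimage_set0 measure0.
  by case: pselect => [//|_]; rewrite preimage_set0 measure0.
have : P.-negligible (\bigcup_k (X n @^-1` F k)).
  apply: negligible_bigcup => k; apply/negligibleP; last exact: F0.
  exact: measurable_preimage.
apply: negligibleS => omega /= /negP; rewrite -ltNge => mX.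
have : ~ essran (X 0%N) (X n omega).
  by move=> /ub; apply/negP; rewrite -ltNge.
move=> /existsNP[eps /not_implyP[eps0 /negP]]; rewrite -leNgt => Dle.
have e3 : eps / 3 < 2 * eps / 3 by lra.
have [r] := rat_in_itvoo e3; rewrite in_itv /= => /andP[r1 r2].
have e3' : X n omega - eps / 3 < X n omega + eps / 3 by lra.
have [c] := rat_in_itvoo e3'; rewrite in_itv /= => /andP[c1 c2].
have sub : ball (ratr c : R) (ratr r) `<=` ball (X n omega) eps.
  move=> y; rewrite -!ball_normE /= => cy.
  have -> : X n omega - y = (X n omega - ratr c) + (ratr c - y) by rewrite addrA subrK.
  apply: le_lt_trans (ler_normD _ _) _.
  have : `|X n omega - ratr c| < eps / 3 by rewrite ltr_norml; apply/andP; split; lra.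
  lra.
have [k kE] : exists k, @unpickle (rat * rat)%type k = Some (c, r).
  by exists (pickle (c, r)); exact: pickleK.
exists k => //; rewrite /preimage /= /F kE /=.
case: pselect => [_|]; last first.
  case; apply/eqP; rewrite eq_le measure_ge0 andbT; apply: le_trans Dle.
  by apply: le_measure; rewrite ?inE//; exact: measurable_ball_real.
by rewrite -ball_normE /= ltr_norml; apply/andP; split; lra.
Qed.

Hypothesis X_indep : mutually_independent X.

Section runs.
Variables (B : set R) (N : nat).
Hypothesis mB : measurable B.
Hypothesis B_gt0 : (0 < P (X 0%N @^-1` B))%E.

Let q : R := fine (P (X 0%N @^-1` B)).

Let PB n : P (X n @^-1` B) = q%:E.
Proof. by rewrite prob_preimage// fineK// fin_num_measure//; exact: measurable_preimage. Qed.

Let q01 : 0 < q <= 1.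
Proof.
rewrite -lee_fin -lte_fin -(PB 0) B_gt0 probability_le1//.
exact: measurable_preimage.
Qed.

Definition all_in (s : seq nat) : set Omega := \bigcap_(k in [set` s]) (X k @^-1` B).

Lemma measurable_all_in s : measurable (all_in s).
Proof.
by apply: fin_bigcap_measurable => // k _; exact: measurable_preimage.
Qed.

Lemma prob_all_in s : uniq s -> P (all_in s) = (q ^+ size s)%:E.
Proof.
move=> us; rewrite /all_in (X_indep us (fun=> mB)).
elim: s {us} => [|k s ih]; first by rewrite big_nil expr0.
by rewrite big_cons ih PB -EFinM exprS.
Qed.

Definition no_run J : set Omega := \bigcap_(j in `I_J) ~` all_in (iota (j * N) N).

Lemma measurable_no_run J : measurable (no_run J).
Proof.
apply: fin_bigcap_measurable => // j _; apply: measurableC; exact: measurable_all_in.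
Qed.

(** The event [no_run J] depends on the indices below [J N] only; the further
    constraint on larger indices makes the induction on [J] go through. *)
Lemma prob_no_run J s : uniq s -> (forall k, k \in s -> (J * N <= k)%N) ->
  P (no_run J `&` all_in s) = ((1 - q ^+ N) ^+ J * q ^+ size s)%:E.
Proof.
elim: J s => [|J ih] s us sJ.
  have -> : no_run 0 = setT by rewrite /no_run II0 bigcap_set0.
  by rewrite setTI prob_all_in// expr0 mul1r.
have -> : no_run J.+1 `&` all_in s =
    (no_run J `&` all_in s) `\` all_in (iota (J * N) N).
  by rewrite /no_run IIS bigcap_setU bigcap_set1 setDE -!setIA [all_in s `&` _]setIC.
have m1 := measurable_no_run J; have m2 := measurable_all_in s.
have m3 := measurable_all_in (iota (J * N) N).
rewrite measureD//; last 2 first.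
- exact: measurableI.
- by rewrite ltey_eq fin_num_measure//; exact: measurableI.
have -> : no_run J `&` all_in s `&` all_in (iota (J * N) N) =
    no_run J `&` all_in (iota (J * N) N ++ s).
  rewrite -setIA [all_in s `&` _]setIC; congr (_ `&` _).
  rewrite /all_in (_ : [set` iota (J * N) N ++ s] = [set` iota (J * N) N] `|` [set` s]).
    by rewrite bigcap_setU.
  by apply/seteqP; split=> k /=; rewrite mem_cat => /orP.
have us' : uniq (iota (J * N) N ++ s).
  rewrite cat_uniq iota_uniq us andbT /=; apply/hasPn => k ks.
  rewrite mem_iota negb_and -!leqNgt; apply/orP; right.
  by have := sJ k ks; rewrite mulSn addnC.
have h1 : P (no_run J `&` all_in s) = ((1 - q ^+ N) ^+ J * q ^+ size s)%:E.
  by apply: ih => // k /sJ; apply: leq_trans; rewrite mulSn leq_addl.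
have h2 : P (no_run J `&` all_in (iota (J * N) N ++ s)) =
    ((1 - q ^+ N) ^+ J * (q ^+ N * q ^+ size s))%:E.
  rewrite ih// ?size_cat ?size_iota ?exprD// => k.
  rewrite mem_cat mem_iota => /orP[/andP[]//|/sJ].
  by apply: leq_trans; rewrite mulSn leq_addl.
transitivity (((1 - q ^+ N) ^+ J * q ^+ size s)%:E -
    ((1 - q ^+ N) ^+ J * (q ^+ N * q ^+ size s))%:E)%E.
  by congr (_ - _)%E; [exact: h1|exact: h2].
by rewrite -EFinB; congr _%:E; rewrite exprS; ring.
Qed.

(** Disjoint blocks of [N] indices are independent and each lies in [B] with
    the same positive probability, so some block does almost surely. *)
Lemma ae_run : {ae P, forall omega, exists a, forall i, (i < N)%N -> B (X (a + i)%N omega)}.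
Proof.
pose Bad := \bigcap_J no_run J.
have mBad : measurable Bad by apply: bigcapT_measurable => J; exact: measurable_no_run.
have Bad0 : P Bad = 0%E.
  have /andP[q0 q1] := q01.
  have r01 : 0 <= 1 - q ^+ N < 1.
    by rewrite subr_ge0 exprn_ile1 ?(ltW q0)//= ltrBlDr ltrDl exprn_gt0.
  have [r0 r1] := andP r01.
  have le J : (P Bad <= ((1 - q ^+ N) ^+ J)%:E)%E.
    have := @prob_no_run J [::] isT (fun k => ltac:(by [])).
    rewrite expr0 mulr1 => <-; apply: le_measure; rewrite ?inE//.
      by apply: measurableI; [exact: measurable_no_run|exact: measurable_all_in].
    move=> omega h; split; first exact: h.
    by move=> k.
  have Pfin : P Bad = (fine (P Bad))%:E by rewrite fineK// fin_num_measure.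
  apply/eqP; rewrite eq_le measure_ge0 andbT Pfin lee_fin.
  apply/ler_addgt0Pl => eps eps0; rewrite addr0.
  have : (fun J => (1 - q ^+ N) ^+ J) @ \oo --> (0 : R).
    by apply: cvg_expr; rewrite ger0_norm.
  move=> /cvgrPdist_lt/(_ _ eps0)[J _ /(_ J (leqnn J))].
  rewrite /= sub0r normrN => /(le_lt_trans (ler_norm _))/ltW; apply: le_trans.
  by rewrite -lee_fin -Pfin.
exists Bad; split=> // omega /= h J _ j _ hj; apply: h.
exists (j * N)%N => i iN; apply: hj => /=.
by rewrite mem_iota leq_addr ltn_add2l.
Qed.

End runs.

Lemma ae_near_one_windows : essran (X 0%N) 1 ->
  {ae P, forall omega, near_one_windows (fun n => X n omega)}.
Proof.
move=> ess1.
have win N m : {ae P, forall omega, exists a, forall i, (i < N)%N ->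
    `]1 - m.+1%:R^-1, +oo[%classic (X (a + i)%N omega)}.
  apply: ae_run => //.
  have m0 : (0 : R) < m.+1%:R^-1 by rewrite invr_gt0 ltr0n.
  have := ess1 _ m0; move=> /lt_le_trans; apply; apply: le_measure; rewrite ?inE.
  - exact: measurable_ball_real.
  - exact: measurable_itv.
  - move=> y /=; rewrite -ball_normE /= ltr_norml in_itv /= andbT => /andP[_ h].
    by rewrite ltrBlDr addrC -ltrBlDr.
have : {ae P, forall omega, forall N m, exists a, forall i, (i < N)%N ->
    `]1 - m.+1%:R^-1, +oo[%classic (X (a + i)%N omega)}.
  by apply/ae_foralln => N; apply/ae_foralln => m; exact: win.
apply: filterS => omega h N eps eps0.
have := @cvg_harmonic R => /cvgrPdist_lt/(_ _ eps0)[m _ /(_ m (leqnn m))].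
rewrite /harmonic /= sub0r normrN ger0_norm// => hm.
have [a ha] := h N m; exists a => i /ha /=; rewrite in_itv /= andbT.
by apply: lt_trans; rewrite ltrD2l ltrN2.
Qed.

End weights.

(** * Random weighted shifts *)

Theorem theorem1p5 (R : realType) (H : completeNormedModType R[i])
  (ip : {dot H for Num.conj}) (e : nat -> H)
  (d : measure_display) (Omega : measurableType d) (P : probability Omega R)
  (X : nat -> {RV P >-> R}) (T : Omega -> H -> H)
  (normE : forall x : H, `|x| ^+ 2 = ip x x)
  (eONB : orthonormal_basis ip e)
  (X_ge0 : forall n omega, 0 <= X n omega)
  (X_bounded : forall n, exists M : R, forall omega, X n omega <= M)
  (X_indep : mutually_independent X)
  (X_ident : identically_distributed X)
  (TX : random_weighted_shift e X T)
  (max_essran : is_max (essran (X 0%N)) 1) :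
  {ae P, forall omega,
    isometrically_isomorphic
      (@comp_op R H) (@operator_norm R H)
      (norm_closure (polynomials_in (T omega)))
      pointwise_mul (sup_norm closed_disk) (@disk_algebra R)} /\
  {ae P, forall omega,
    weak_star_closure ip e (polynomials_in (T omega)) =
    wot_closure ip (polynomials_in (T omega))} /\
  (P (X 0%N @^-1` [set 0]) = 0%E ->
    {ae P, forall omega,
      [/\ weak_star_closure ip e (polynomials_in (T omega)) =
            wot_closure ip (polynomials_in (T omega)),
          wot_closure ip (polynomials_in (T omega)) =
            commutant [set T omega],
          commutant [set T omega] = commutant (commutant [set T omega]) &
          isometrically_isomorphic
            (@comp_op R H) (@operator_norm R H)
            (wot_closure ip (polynomials_in (T omega)))
            pointwise_mul (sup_norm open_disk) (@Hardy_infinity R)]} /\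
    {ae P, forall omega,
      isometrically_isomorphic
        mul_series (multiplier_norm (fun n => X n omega))
        (multiplier_algebra (fun n => X n omega))
        pointwise_mul (sup_norm open_disk) (@Hardy_infinity R)}).
Proof.
have [ess1 ub1] := max_essran.
have regular : {ae P, forall omega,
    [/\ weighted_shift e (fun n => X n omega) (T omega),
        forall n, 0 <= X n omega <= 1 & near_one_windows (fun n => X n omega)]}.
  have le1 : {ae P, forall omega, forall n, X n omega <= 1}.
    by apply/ae_foralln => n; exact: ae_le_max_essran.
  apply: filterS3 TX le1 (ae_near_one_windows X_ident X_indep ess1) => omega wT Xle1 win.
  by split=> // n; rewrite X_ge0 Xle1.
split; first by apply: filterS regular => omega [wT w01 win]; exact: norm_closure_disk_algebra win _ wT.
split.
  apply: filterS regular => omega [wT w01 win].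
  by rewrite (weak_star_closure_symbol normE eONB w01 win wT) (wot_closure_symbol normE eONB w01 win wT).
move=> X0.
have neq0 : {ae P, forall omega, forall n, X n omega != 0}.
  apply/ae_foralln => n.
  have : P.-negligible (X n @^-1` [set 0]).
    apply/negligibleP; first exact: measurable_preimage.
    exact: etrans (prob_preimage X_ident n (measurable_set1 0)) X0.
  by apply: negligibleS => omega /= /negP; rewrite negbK => /eqP.
split.
  apply: filterS2 regular neq0 => omega [wT w01 win] w_neq0; split.
  - by rewrite (weak_star_closure_symbol normE eONB w01 win wT) (wot_closure_symbol normE eONB w01 win wT).
  - by rewrite (wot_closure_symbol normE eONB w01 win wT) (commutant_symbol normE eONB wT w_neq0).
  - by rewrite (double_commutant_symbol normE eONB wT w_neq0) (commutant_symbol normE eONB wT w_neq0).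
  - rewrite (wot_closure_symbol normE eONB w01 win wT).
    exact: (wot_closure_Hardy normE eONB w01 win).
apply: filterS2 regular neq0 => omega [_ w01 win] w_neq0.
exact: (multiplier_algebra_Hardy_infinity normE eONB w01 win w_neq0).
Qed.
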